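(* $\mathsf{IKP}^{-\mathrm{Inf}}\vdash(V=\mathbb L)^{\mathbb L}$, i.e. it is provable in $\mathsf{IKP}^{-\mathrm{Inf}}$ that every $x\in\mathbb L$ satisfies, relativized to $\mathbb L$, that there is an ordinal $\alpha$ with $x\in\mathbb L_\alpha$.
   Context: $\mathsf{IKP}^{-\mathrm{Inf}}$: intuitionistic logic; axioms Extensionality, Empty Set, Pairing, Unions, Set Induction scheme, $\Sigma_0$-Separation scheme, $\Sigma_0$-Collection scheme (no Infinity). An ordinal is a transitive set of transitive sets. The fundamental operations $\mathcal F_i$, $i\in\mathcal I$ (finite index set) are the binary operations: $\{x,y\}$; $x\cap\bigcap y$; $\bigcup x$; $x\setminus y$; $x\times y$; $x\cap\{z: y\text{ is an ordered pair}\wedge(z\in 1^{st}(y)\to z\in 2^{nd}(y))\}$; $\{\{u:\langle z,u\rangle\in x\}:z\in y\}$; $\mathrm{dom}(x)$; $\mathrm{ran}(x)$; $\{\langle u,v,w\rangle:\langle u,v\rangle\in x\wedge w\in y\}$; $\{\langle u,w,v\rangle:\langle u,v\rangle\in x\wedge w\in y\}$; $\{\langle v,u\rangle\in y\times x:u=v\}$; $\{\langle v,u\rangle\in y\times x:u\in v\}$ (Kuratowski pairs, $\langle a,b,c\rangle=\langle a,\langle b,c\rangle\rangle$). $\mathrm{cl}_0(b)=b\cup\{\mathcal F_i(x,y):x,y\in b,\ i\in\mathcal I\}$, $\mathrm{cl}(b)=\mathrm{cl}_0(b\cup\{b\})$, $\mathbb L_\alpha=\bigcup_{\beta\in\alpha}\mathrm{cl}(\mathbb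 L_\beta)$ (a $\Sigma$-recursion on ordinals), $\mathbb L=\bigcup_{\alpha\in\mathrm{Ord}}\mathbb L_\alpha$; $V=\mathbb L$ is the sentence $\forall x\,\exists\alpha\in\mathrm{Ord}\,(x\in\mathbb L_\alpha)$ and $(\cdot)^{\mathbb L}$ denotes relativization to $\mathbb L$. *)

(* Defs.v *)
From mathcomp Require Import all_boot.
From Stdlib Require List.

Set Implicit Arguments.
Unset Strict Implicit.
Unset Printing Implicit Defensive.

(** * First-order formulas of set theory *)

(* De Bruijn indices: the only terms are variables, and index 0 is the variable
   bound by the innermost enclosing quantifier. *)
Inductive form : Type :=
| Mem (x y : nat)
| Eq (x y : nat)
| Bot
| And (p q : form)
| Or (p q : form)
| Imp (p q : form)
| All (p : form)
| Ex (p : form).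

Declare Scope form_scope.
Delimit Scope form_scope with form.
Bind Scope form_scope with form.

Definition Neg (p : form) : form := Imp p Bot.
Definition Iff (p q : form) : form := And (Imp p q) (Imp q p).

(* In [All_in y p] and [Ex_in y p] the index [y] refers to the context outside
   the quantifier, hence the shift. *)
Definition All_in (y : nat) (p : form) : form := All (Imp (Mem 0 y.+1) p).
Definition Ex_in (y : nat) (p : form) : form := Ex (And (Mem 0 y.+1) p).

Notation "x ∈ y" := (Mem x y) (at level 70, no associativity) : form_scope.
Notation "x ≡ y" := (Eq x y) (at level 70, no associativity) : form_scope.
Notation "¬ p" := (Neg p) (at level 75, right associativity) : form_scope.
Notation "p ∧ q" := (And p q) (at level 80, right associativity) : form_scope.
Notation "p ∨ q" := (Or p q) (at level 85, right associativity) : form_scope.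
Notation "p ⇒ q" := (Imp p q) (at level 90, right associativity) : form_scope.
Notation "p ⇔ q" := (Iff p q) (at level 95, no associativity) : form_scope.

Local Open Scope form_scope.

Definition up (r : nat -> nat) (n : nat) : nat :=
  if n is m.+1 then (r m).+1 else 0.

Fixpoint ren (r : nat -> nat) (p : form) : form :=
  match p with
  | Mem x y => Mem (r x) (r y)
  | Eq x y => Eq (r x) (r y)
  | Bot => Bot
  | And p q => And (ren r p) (ren r q)
  | Or p q => Or (ren r p) (ren r q)
  | Imp p q => Imp (ren r p) (ren r q)
  | All p => All (ren (up r) p)
  | Ex p => Ex (ren (up r) p)
  end.

Definition shift (p : form) : form := ren S p.

(* Substitution of the variable [x] for index 0, the other free indices being
   lowered by one. *)
Definition inst (x : nat) (p : form) : form :=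
  ren (fun n => if n is m.+1 then m else x) p.

(** * Intuitionistic natural deduction with equality *)

(* [T] is the set of axioms.  An axiom may have free variables; since the rule
   [prf_AllI] shifts the hypotheses in [G] but not [T], such an axiom has the
   force of its universal closure. *)
Inductive prf (T : form -> Prop) : seq form -> form -> Prop :=
| prf_Ax G p : T p -> prf T G p
| prf_Hyp G p : List.In p G -> prf T G p
| prf_BotE G p : prf T G Bot -> prf T G p
| prf_AndI G p q : prf T G p -> prf T G q -> prf T G (p ∧ q)
| prf_AndE1 G p q : prf T G (p ∧ q) -> prf T G p
| prf_AndE2 G p q : prf T G (p ∧ q) -> prf T G q
| prf_OrI1 G p q : prf T G p -> prf T G (p ∨ q)
| prf_OrI2 G p q : prf T G q -> prf T G (p ∨ q)
| prf_OrE G p q r :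
    prf T G (p ∨ q) -> prf T (p :: G) r -> prf T (q :: G) r -> prf T G r
| prf_ImpI G p q : prf T (p :: G) q -> prf T G (p ⇒ q)
| prf_ImpE G p q : prf T G (p ⇒ q) -> prf T G p -> prf T G q
| prf_AllI G p : prf T (map shift G) p -> prf T G (All p)
| prf_AllE G p x : prf T G (All p) -> prf T G (inst x p)
| prf_ExI G p x : prf T G (inst x p) -> prf T G (Ex p)
| prf_ExE G p q :
    prf T G (Ex p) -> prf T (p :: map shift G) (shift q) -> prf T G q
| prf_EqI G x : prf T G (x ≡ x)
| prf_EqE G p x y :
    prf T G (x ≡ y) -> prf T G (inst x p) -> prf T G (inst y p).

Definition provable (T : form -> Prop) (p : form) : Prop := prf T [::] p.

(** * The theory IKP without Infinity *)

Inductive Sigma0 : form -> Prop :=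
| Sigma0_Mem x y : Sigma0 (x ∈ y)
| Sigma0_Eq x y : Sigma0 (x ≡ y)
| Sigma0_Bot : Sigma0 Bot
| Sigma0_And p q : Sigma0 p -> Sigma0 q -> Sigma0 (p ∧ q)
| Sigma0_Or p q : Sigma0 p -> Sigma0 q -> Sigma0 (p ∨ q)
| Sigma0_Imp p q : Sigma0 p -> Sigma0 q -> Sigma0 (p ⇒ q)
| Sigma0_All y p : Sigma0 p -> Sigma0 (All_in y p)
| Sigma0_Ex y p : Sigma0 p -> Sigma0 (Ex_in y p).

Definition ax_extensionality : form :=
  All (All (All (0 ∈ 2 ⇔ 0 ∈ 1) ⇒ 1 ≡ 0)).

Definition ax_empty : form :=
  Ex (All (¬ 0 ∈ 1)).

Definition ax_pairing : form :=
  All (All (Ex (All (0 ∈ 1 ⇔ 0 ≡ 3 ∨ 0 ≡ 2)))).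

Definition ax_union : form :=
  All (Ex (All (0 ∈ 1 ⇔ Ex_in 2 (1 ∈ 0)))).

(* In [p], index 0 is the induction variable and the others are parameters. *)
Definition ax_set_induction (p : form) : form :=
  All (All_in 0 (ren (up S) p) ⇒ p) ⇒ All p.

(* In [p], index 0 is the element x being tested, index 1 is the set a, and the
   others are parameters: for all a there is b such that
   x ∈ b iff x ∈ a and p(x, a), for all x.  The renaming skips b. *)
Definition ax_separation (p : form) : form :=
  All (Ex (All (0 ∈ 1 ⇔ 0 ∈ 2 ∧ ren (up S) p))).

(* In [p], index 0 is y, index 1 is x, index 2 is the set a, and the others are
   parameters: if for all x ∈ a there is y with p(y, x, a), then there is b such
   that for all x ∈ a there is y ∈ b with p(y, x, a).  The renaming skips b. *)
Definition ax_collection (p : form) : form :=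
  All (All_in 0 (Ex p) ⇒ Ex (All_in 1 (Ex_in 1 (ren (up (up S)) p)))).

Inductive IKP_minus_Inf : form -> Prop :=
| IKP_extensionality : IKP_minus_Inf ax_extensionality
| IKP_empty : IKP_minus_Inf ax_empty
| IKP_pairing : IKP_minus_Inf ax_pairing
| IKP_union : IKP_minus_Inf ax_union
| IKP_set_induction p : IKP_minus_Inf (ax_set_induction p)
| IKP_separation p : Sigma0 p -> IKP_minus_Inf (ax_separation p)
| IKP_collection p : Sigma0 p -> IKP_minus_Inf (ax_collection p).

(** * The constructible hierarchy *)

(* In all the definitions below the arguments are indices of free variables.
   Defined operations are given by their membership formula: [in_foo u x y]
   says "u ∈ foo(x, y)", and [is_set (in_foo ...) z] says "z is the set of all u
   with ...", where u has index 0 in the formula. *)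
Definition is_set (p : form) (z : nat) : form := All (0 ∈ z.+1 ⇔ p).

Definition in_upair (u x y : nat) : form := u ≡ x ∨ u ≡ y.

(* "p = <x, y>", for the Kuratowski pair {{x}, {x, y}}. *)
Definition is_pair (p x y : nat) : form :=
  is_set (is_set (in_upair 0 x.+2 x.+2) 0 ∨ is_set (in_upair 0 x.+2 y.+2) 0) p.

(* "t = <x, y, z>", that is <x, <y, z>>. *)
Definition is_triple (t x y z : nat) : form :=
  Ex (is_pair 0 y.+1 z.+1 ∧ is_pair t.+1 x.+1 0).

(* "<x, y> ∈ r". *)
Definition pair_in (x y r : nat) : form :=
  Ex (is_pair 0 x.+1 y.+1 ∧ 0 ∈ r.+1).

(* The membership formulas "u ∈ F(x, y)" of the fundamental operations F. *)

Definition in_bigcap (u x y : nat) : form :=        (* x ∩ ⋂ y *)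
  u ∈ x ∧ All_in y (u.+1 ∈ 0).

Definition in_bigcup (u x y : nat) : form :=        (* ⋃ x *)
  Ex_in x (u.+1 ∈ 0).

Definition in_diff (u x y : nat) : form :=          (* x \ y *)
  u ∈ x ∧ ¬ u ∈ y.

Definition in_prod (u x y : nat) : form :=          (* x × y *)
  Ex_in x (Ex_in y.+1 (is_pair u.+2 1 0)).

(* x ∩ {z : y is an ordered pair and (z ∈ 1st(y) implies z ∈ 2nd(y))} *)
Definition in_imp (u x y : nat) : form :=
  u ∈ x ∧ Ex (Ex (is_pair y.+2 1 0 ∧ (u.+2 ∈ 1 ⇒ u.+2 ∈ 0))).

(* {{v : <z, v> ∈ x} : z ∈ y} *)
Definition in_images (u x y : nat) : form :=
  Ex_in y (is_set (pair_in 1 0 x.+2) u.+1).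

Definition in_dom (u x y : nat) : form :=           (* dom x *)
  Ex (pair_in u.+1 0 x.+1).

Definition in_ran (u x y : nat) : form :=           (* ran x *)
  Ex (pair_in 0 u.+1 x.+1).

(* {<a, b, c> : <a, b> ∈ x, c ∈ y}, with a, b, c at indices 2, 1, 0 *)
Definition in_ext_right (u x y : nat) : form :=
  Ex (Ex (Ex (is_triple u.+3 2 1 0 ∧ pair_in 2 1 x.+3 ∧ 0 ∈ y.+3))).

(* {<a, c, b> : <a, b> ∈ x, c ∈ y}, with a, b, c at indices 2, 1, 0 *)
Definition in_ext_mid (u x y : nat) : form :=
  Ex (Ex (Ex (is_triple u.+3 2 0 1 ∧ pair_in 2 1 x.+3 ∧ 0 ∈ y.+3))).

(* {<b, a> ∈ y × x : a = b}, with b, a at indices 1, 0 *)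
Definition in_eq_rel (u x y : nat) : form :=
  Ex_in y (Ex_in x.+1 (is_pair u.+2 1 0 ∧ 0 ≡ 1)).

(* {<b, a> ∈ y × x : a ∈ b}, with b, a at indices 1, 0 *)
Definition in_mem_rel (u x y : nat) : form :=
  Ex_in y (Ex_in x.+1 (is_pair u.+2 1 0 ∧ 0 ∈ 1)).

Definition fundamental_ops : seq (nat -> nat -> nat -> form) :=
  [:: in_upair; in_bigcap; in_bigcup; in_diff; in_prod; in_imp; in_images;
      in_dom; in_ran; in_ext_right; in_ext_mid; in_eq_rel; in_mem_rel].

(* "u = F(x, y) for some fundamental operation F". *)
Definition is_fundamental_value (u x y : nat) : form :=
  foldr Or Bot [seq is_set (in_F 0 x.+1 y.+1) u | in_F <- fundamental_ops].

(* "u ∈ cl0(b)" *)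
Definition in_cl0 (u b : nat) : form :=
  u ∈ b ∨ Ex_in b (Ex_in b.+1 (is_fundamental_value u.+2 1 0)).

(* "u ∈ cl(b)", where cl(b) = cl0(b ∪ {b}) *)
Definition in_cl (u b : nat) : form :=
  Ex (is_set (0 ∈ b.+2 ∨ 0 ≡ b.+2) 0 ∧ in_cl0 u.+1 0).

Definition transitive_set (x : nat) : form :=
  All_in x (All_in 0 (0 ∈ x.+2)).

Definition Ord (x : nat) : form :=
  transitive_set x ∧ All_in x (transitive_set 0).

(* "f is a function with domain a". *)
Definition function_on (f a : nat) : form :=
  All_in f (Ex_in a.+1 (Ex (is_pair 2 1 0)))
  ∧ All_in a (Ex (pair_in 1 0 f.+2 ∧ All (pair_in 2 0 f.+3 ⇒ 0 ≡ 1))).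

(* "u ∈ ⋃_{c ∈ b} cl(f(c))" *)
Definition in_cl_step (u b f : nat) : form :=
  Ex_in b (Ex (pair_in 1 0 f.+2 ∧ in_cl u.+2 0)).

(* "f is a function with domain a, and f(b) = ⋃_{c ∈ b} cl(f(c)) for b ∈ a";
   for an ordinal a this says that f is the restriction of b ↦ L_b to a. *)
Definition L_recursion (f a : nat) : form :=
  function_on f a
  ∧ All_in a (All (pair_in 1 0 f.+2 ⇒ is_set (in_cl_step 0 2 f.+3) 0)).

(* "x ∈ L_a": the formula given by Σ-recursion on the ordinal a. *)
Definition in_L_at (x a : nat) : form :=
  Ex (L_recursion 0 a.+1 ∧ in_cl_step x.+1 a.+1 0).

(* "x ∈ L" *)
Definition in_L (x : nat) : form :=
  Ex (Ord 0 ∧ in_L_at x.+1 0).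

Definition V_eq_L : form :=
  All (Ex (Ord 0 ∧ in_L_at 1 0)).

(* Relativization to the class {x : C(x)}.  The class is given as a function
   from indices to formulas, and is applied to the variable bound by each
   quantifier. *)
Fixpoint relativize (C : nat -> form) (p : form) : form :=
  match p with
  | Mem x y => Mem x y
  | Eq x y => Eq x y
  | Bot => Bot
  | And p q => And (relativize C p) (relativize C q)
  | Or p q => Or (relativize C p) (relativize C q)
  | Imp p q => Imp (relativize C p) (relativize C q)
  | All p => All (Imp (C 0) (relativize C p))
  | Ex p => Ex (And (C 0) (relativize C p))
  end.

(* Main.v *)
(* The derived rules below read a context [G] as a world: to derive an
   implication, or to use a disjunction or an existential, one passes to an
   arbitrary larger context, to which all known facts are transported.  The
   variables are their own names, so that eigenvariable conditions disappear.

   In L, the axioms of IKP without Infinity hold: L is transitive and closed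
   under the fundamental operations; by Gödel's normal form, the set of tuples
   satisfying a Sigma0 formula is obtained by composing these operations; and
   collection in L follows from collection in V applied to the stages.  Hence
   every theorem holds relativized to L, in particular the existence of
   (L_b)_{b ∈ a} for every ordinal a of L.  It remains to see that each x in L
   belongs to L_a for some ordinal a which is itself in L: intuitionistically an
   ordinal b need not be in L, but there is an ordinal b* in L with
   L_{b*} = L_b, roughly the set of the c with cl(L_c) ⊆ L_b. *)

Require Import Defs.
From mathcomp Require Import all_boot.
From Stdlib Require List.

Set Implicit Arguments.
Unset Strict Implicit.
Unset Printing Implicit Defensive.

Local Open Scope form_scope.

(** * Derivations *)

(** Three obstacles shape the development. A stage adds a single round of the operations: cl(b)
    contains the product of two elements of b, but not the pairs in it. Stages therefore need not be
    transitive, and transitivity of L comes from a stronger, hereditary property.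

    The defining formulas have unbounded quantifiers, whereas separation, collection and
    absoluteness concern Sigma0 formulas. Each notion thus gets an equivalent bounded form, and
    before collection is applied to an existential statement, its witnesses are packed into one set,
    over whose elements the quantifiers then range. The equivalence of the two forms is itself a
    theorem, so it can be relativized.

    Finally, ordinals are not linearly ordered and excluded middle is missing. Common upper bounds
    are unions; where a witness cannot be selected, all admissible ones are united; implication and
    the universal quantifier are coded by operations of their own instead of by complements. *)

Definition scons (x : nat) (r : nat -> nat) (n : nat) : nat :=
  if n is m.+1 then r m else x.

Lemma ren_ext p r s : r =1 s -> ren r p = ren s p.
Proof.
elim: p r s => //= [x y|x y|p IHp q IHq|p IHp q IHq|p IHp q IHq|p IHp|p IHp] r s rs.
- by rewrite !rs.
- by rewrite !rs.
- by rewrite (IHp _ _ rs) (IHq _ _ rs).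
- by rewrite (IHp _ _ rs) (IHq _ _ rs).
- by rewrite (IHp _ _ rs) (IHq _ _ rs).
- by congr All; apply: IHp => -[|n] //=; rewrite rs.
- by congr Ex; apply: IHp => -[|n] //=; rewrite rs.
Qed.

Lemma ren_comp p r s : ren r (ren s p) = ren (fun n => r (s n)) p.
Proof.
elim: p r s => //= [p IHp q IHq|p IHp q IHq|p IHp q IHq|p IHp|p IHp] r s.
- by rewrite IHp IHq.
- by rewrite IHp IHq.
- by rewrite IHp IHq.
- by rewrite IHp; congr All; apply: ren_ext => -[|n].
- by rewrite IHp; congr Ex; apply: ren_ext => -[|n].
Qed.

Lemma ren_id p r : r =1 id -> ren r p = p.
Proof.
elim: p r => //= [x y|x y|p IHp q IHq|p IHp q IHq|p IHp q IHq|p IHp|p IHp] r rs.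
- by rewrite !rs.
- by rewrite !rs.
- by rewrite (IHp _ rs) (IHq _ rs).
- by rewrite (IHp _ rs) (IHq _ rs).
- by rewrite (IHp _ rs) (IHq _ rs).
- by rewrite IHp // => -[|n] //=; rewrite rs.
- by rewrite IHp // => -[|n] //=; rewrite rs.
Qed.

Lemma inst_shift y q : inst y (shift q) = q.
Proof. by rewrite /inst /shift ren_comp ren_id. Qed.

Lemma ren_inst r x p : ren r (inst x p) = inst (r x) (ren (up r) p).
Proof. by rewrite /inst !ren_comp; apply: ren_ext => -[]. Qed.

Lemma inst_ren y r p : inst y (ren (up r) p) = ren (scons y r) p.
Proof. by rewrite /inst ren_comp; apply: ren_ext => -[]. Qed.

Lemma ren_shift r p : ren (up r) (shift p) = shift (ren r p).
Proof. by rewrite /shift !ren_comp. Qed.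

(** A strict upper bound for the free indices, not their number; it drops by one under a binder. *)
Fixpoint fv (p : form) : nat :=
  match p with
  | Defs.Mem x y | Defs.Eq x y => maxn x.+1 y.+1
  | Bot => 0
  | And p q | Or p q | Imp p q => maxn (fv p) (fv q)
  | All p | Ex p => (fv p).-1
  end.

Lemma ren_fv p r s : (forall m, m < fv p -> r m = s m) -> ren r p = ren s p.
Proof.
elim: p r s => [x y|x y||p IHp q IHq|p IHp q IHq|p IHp q IHq|p IHp|p IHp] r s rs //=.
- by rewrite !rs // leq_max leqnn ?orbT.
- by rewrite !rs // leq_max leqnn ?orbT.
- by rewrite (IHp r s) ?(IHq r s) // => k Hk; apply: rs; rewrite leq_max Hk ?orbT.
- by rewrite (IHp r s) ?(IHq r s) // => k Hk; apply: rs; rewrite leq_max Hk ?orbT.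
- by rewrite (IHp r s) ?(IHq r s) // => k Hk; apply: rs; rewrite leq_max Hk ?orbT.
- congr All; apply: IHp => -[|k] //= Hk; rewrite rs //=.
  by rewrite -ltnS (ltn_predK Hk).
- congr Ex; apply: IHp => -[|k] //= Hk; rewrite rs //=.
  by rewrite -ltnS (ltn_predK Hk).
Qed.

(** Provides an index that is fresh for a whole context. *)
Lemma fv_bound_seq (G : seq form) :
  exists n, forall r s, (forall m, m < n -> r m = s m) ->
    map (ren r) G = map (ren s) G.
Proof.
elim: G => [|p G [n IH]]; first by exists 0.
exists (maxn n (fv p)) => r s rs /=.
by rewrite (@ren_fv p r s) ?(IH r s) // => k Hk; apply: rs; rewrite leq_max Hk ?orbT.
Qed.

Lemma Sigma0_ren p r : Sigma0 p -> Sigma0 (ren r p).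
Proof.
move=> H; elim: H r => /=; try by [constructor | move=> *; constructor; auto].
Qed.

(** Each scheme absorbs a renaming into its parameter formula. This is what lets derivations be
    renamed although [prf_AllI] leaves the axioms unshifted. *)
Lemma IKP_ren p r : IKP_minus_Inf p -> IKP_minus_Inf (ren r p).
Proof.
case=> {p}; try by constructor.
- move=> p.
  suff -> : ren r (ax_set_induction p) = ax_set_induction (ren (up r) p) by constructor.
  rewrite /ax_set_induction /= !ren_comp.
  have -> // : ren (fun n => up (up r) (up S n)) p = ren (fun n => up S (up r n)) p.
  by apply: ren_ext => -[|n].
- move=> p Hp.
  suff -> : ren r (ax_separation p) = ax_separation (ren (up (up r)) p).
    by constructor; apply: Sigma0_ren.
  rewrite /ax_separation /= /Iff /= !ren_comp.
  have -> // : ren (fun n => up (up (up r)) (up S n)) p = ren (fun n => up S (up (up r) n)) p.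
  by apply: ren_ext => -[|[|n]].
- move=> p Hp.
  suff -> : ren r (ax_collection p) = ax_collection (ren (up (up (up r))) p).
    by constructor; apply: Sigma0_ren.
  rewrite /ax_collection /= !ren_comp.
  have -> // : ren (fun n => up (up (up (up r))) (up (up S) n)) p
     = ren (fun n => up (up S) (up (up (up r)) n)) p.
  by apply: ren_ext => -[|[|[|n]]].
Qed.

(** * Weakening and renaming of derivations *)

Definition ext (G G' : seq form) := forall p, List.In p G -> List.In p G'.

Lemma ext_refl G : ext G G. Proof. by []. Qed.
Lemma ext_trans G1 G2 G3 : ext G1 G2 -> ext G2 G3 -> ext G1 G3.
Proof. by move=> H H' p /H/H'. Qed.
Lemma ext_cons p G : ext G (p :: G). Proof. by move=> q; right. Qed.
Lemma ext_cons2 p G G' : ext G G' -> ext (p :: G) (p :: G').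
Proof. by move=> H q [->|/H]; [left|right]. Qed.

Lemma weaken T G G' p : ext G G' -> prf T G p -> prf T G' p.
Proof.
move=> E H; elim: H G' E => {G p}.
- by move=> *; apply: prf_Ax.
- by move=> G p H G' E; apply: prf_Hyp; apply: E.
- by move=> G p _ IH G' E; apply: prf_BotE; auto.
- by move=> G p q _ IH _ IH' G' E; apply: prf_AndI; auto.
- by move=> G p q _ IH G' E; apply: prf_AndE1; apply: IH.
- by move=> G p q _ IH G' E; apply: prf_AndE2; apply: IH.
- by move=> G p q _ IH G' E; apply: prf_OrI1; auto.
- by move=> G p q _ IH G' E; apply: prf_OrI2; auto.
- move=> G p q r _ IH1 _ IH2 _ IH3 G' E.
  by apply: (prf_OrE (IH1 _ E)); [apply: IH2|apply: IH3]; apply: ext_cons2.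
- by move=> G p q _ IH G' E; apply: prf_ImpI; apply: IH; apply: ext_cons2.
- by move=> G p q _ IH _ IH' G' E; apply: prf_ImpE (IH _ E) (IH' _ E).
- move=> G p _ IH G' E; apply: prf_AllI; apply: IH => q /List.in_map_iff [h [<- /E Hh]].
  by apply: List.in_map.
- by move=> G p x _ IH G' E; apply: prf_AllE; auto.
- by move=> G p x _ IH G' E; apply: (@prf_ExI _ _ _ x); auto.
- move=> G p q _ IH _ IH' G' E; apply: (prf_ExE (IH _ E)); apply: IH'.
  by apply: ext_cons2 => h /List.in_map_iff [h' [<- /E Hh]]; apply: List.in_map.
- by move=> *; apply: prf_EqI.
- by move=> G p x y _ IH _ IH' G' E; apply: prf_EqE (IH _ E) (IH' _ E).
Qed.

Lemma prf_ren G p r :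
  prf IKP_minus_Inf G p -> prf IKP_minus_Inf (map (ren r) G) (ren r p).
Proof.
move=> H; elim: H r => {G p} /=.
- by move=> G p H r; apply: prf_Ax; apply: IKP_ren.
- by move=> G p H r; apply: prf_Hyp; apply: List.in_map.
- by move=> G p _ IH r; apply: prf_BotE; apply: IH.
- by move=> G p q _ IH _ IH' r; apply: prf_AndI; auto.
- by move=> G p q _ IH r; apply: prf_AndE1; apply: IH.
- by move=> G p q _ IH r; apply: prf_AndE2; apply: IH.
- by move=> G p q _ IH r; apply: prf_OrI1; auto.
- by move=> G p q _ IH r; apply: prf_OrI2; auto.
- by move=> G p q s _ IH1 _ IH2 _ IH3 r; apply: (prf_OrE (IH1 r)); auto.
- by move=> G p q _ IH r; apply: prf_ImpI; apply: IH.
- by move=> G p q _ IH _ IH' r; apply: prf_ImpE (IH _) (IH' _).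
- move=> G p _ IH r; apply: prf_AllI; have := IH (up r).
  by rewrite -!map_comp (eq_map (ren_shift r)).
- by move=> G p x _ IH r; rewrite ren_inst; apply: prf_AllE; apply: IH.
- by move=> G p x _ IH r; apply: (@prf_ExI _ _ _ (r x)); rewrite -ren_inst.
- move=> G p q _ IH _ IH' r; apply: (prf_ExE (IH r)); have := IH' (up r).
  by rewrite ren_shift -!map_comp (eq_map (ren_shift r)).
- by move=> *; apply: prf_EqI.
- move=> G p x y _ IH _ IH' r; rewrite ren_inst; apply: prf_EqE (IH _) _.
  by rewrite -ren_inst.
Qed.

(** * Derived rules on judgements *)

Notation "G ⊢ p" := (prf IKP_minus_Inf G p%form) (at level 94, p at level 93).

(** Among all [y] of the premise, one fresh for [G] and [p] is enough: renaming it to 0 and every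
    other index to its successor turns [G] into [map shift G] and [inst y p] back into [p]. *)
Lemma AllI G p : (forall y, G ⊢ inst y p) -> G ⊢ All p.
Proof.
move=> H; apply: prf_AllI.
have [n Hn] := fv_bound_seq G.
pose y := maxn n (fv p); pose r k := if k == y then 0 else k.+1.
have := prf_ren r (H y).
have -> : map (ren r) G = map shift G.
  apply: Hn => k Hk; rewrite /r ifN //.
  by rewrite neq_ltn (leq_trans Hk) // leq_maxl.
rewrite /inst ren_comp (@ren_fv _ _ id) ?ren_id // => -[|k] Hk /=; rewrite /r ?eqxx //.
by rewrite ifN // neq_ltn (leq_trans (ltnW Hk)) // leq_maxr.
Qed.

Lemma ImpI G p q : (forall G', ext G G' -> G' ⊢ p -> G' ⊢ q) -> G ⊢ p ⇒ q.
Proof.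
by move=> H; apply: prf_ImpI; apply: H; [apply: ext_cons|apply: prf_Hyp; left].
Qed.

Lemma ImpE G p q : G ⊢ p ⇒ q -> G ⊢ p -> G ⊢ q.
Proof. exact: prf_ImpE. Qed.

Lemma AllE G p x : G ⊢ All p -> G ⊢ inst x p.
Proof. exact: prf_AllE. Qed.

Lemma AndP G p q : G ⊢ p ∧ q -> (G ⊢ p) /\ (G ⊢ q).
Proof. by move=> H; split; [apply: prf_AndE1 H|apply: prf_AndE2 H]. Qed.

Lemma IffP G p q : G ⊢ (p ⇔ q) -> (G ⊢ p -> G ⊢ q) /\ (G ⊢ q -> G ⊢ p).
Proof. by move=> /AndP[H H']; split; apply: ImpE. Qed.

Lemma IffI G p q : (forall G', ext G G' -> G' ⊢ p -> G' ⊢ q) ->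
   (forall G', ext G G' -> G' ⊢ q -> G' ⊢ p) -> G ⊢ (p ⇔ q).
Proof. by move=> H H'; apply: prf_AndI; apply: ImpI. Qed.

Lemma OrE G p q r : G ⊢ p ∨ q -> (forall G', ext G G' -> G' ⊢ p -> G' ⊢ r) ->
   (forall G', ext G G' -> G' ⊢ q -> G' ⊢ r) -> G ⊢ r.
Proof.
move=> H H1 H2; apply: (prf_OrE H).
  by apply: H1; [apply: ext_cons|apply: prf_Hyp; left].
by apply: H2; [apply: ext_cons|apply: prf_Hyp; left].
Qed.

Lemma ExI G p x : G ⊢ inst x p -> G ⊢ Ex p.
Proof. exact: prf_ExI. Qed.

Lemma ExE G p q : G ⊢ Ex p ->
  (forall G', ext G G' -> forall y, G' ⊢ inst y p -> G' ⊢ q) -> G ⊢ q.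
Proof.
move=> H H1.
(* The eigenvariable is handled by [AllI]; renaming by [S] then moves the implication into the
   shifted context of [prf_ExE], where it is instantiated at 0. *)
have /(prf_ren S) H2 : G ⊢ All (p ⇒ shift q).
  apply: AllI => y; apply: ImpI => G' E Hp.
  by change (G' ⊢ inst y (shift q)); rewrite inst_shift; apply: H1 Hp.
apply: (prf_ExE H); apply: ImpE; last by apply: prf_Hyp; left.
have := AllE 0 (weaken (@ext_cons p _) H2).
rewrite /inst /shift /= !ren_comp (@ren_id p) => [|[]] //.
Qed.

Lemma EqR G x y p : G ⊢ x ≡ y -> G ⊢ inst x p -> G ⊢ inst y p.
Proof. exact: prf_EqE. Qed.

Lemma EqS G x y : G ⊢ x ≡ y -> G ⊢ y ≡ x.
Proof.
by move=> H; apply: (@EqR _ x y (0 ≡ x.+1) H); apply: prf_EqI.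
Qed.

Lemma AllinI G a p : (forall G', ext G G' -> forall y, G' ⊢ y ∈ a -> G' ⊢ inst y p) ->
  G ⊢ All_in a p.
Proof. by move=> H; apply: AllI => y; apply: ImpI => G' E; apply: H. Qed.

Lemma AllinE G a p x : G ⊢ All_in a p -> G ⊢ x ∈ a -> G ⊢ inst x p.
Proof. by move=> /(AllE x); apply: ImpE. Qed.

Lemma ExinI G a p x : G ⊢ x ∈ a -> G ⊢ inst x p -> G ⊢ Ex_in a p.
Proof. by move=> H1 H2; apply: (@ExI _ _ x); apply: prf_AndI. Qed.

Lemma ExinE G a p q : G ⊢ Ex_in a p ->
  (forall G', ext G G' -> forall y, G' ⊢ y ∈ a -> G' ⊢ inst y p -> G' ⊢ q) -> G ⊢ q.
Proof.
move=> H H1; apply: (ExE H) => G' E y Hy; 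
apply: (H1 _ E y); [exact: (prf_AndE1 (p := y ∈ a) Hy)|].
exact: (prf_AndE2 (q := inst y p) Hy).
Qed.

Lemma is_setI G z p :
  (forall G', ext G G' -> forall y, G' ⊢ y ∈ z -> G' ⊢ inst y p) ->
  (forall G', ext G G' -> forall y, G' ⊢ inst y p -> G' ⊢ y ∈ z) -> G ⊢ is_set p z.
Proof. by move=> H H'; apply: AllI => y; apply: IffI => G' E; [apply: H|apply: H']. Qed.

Lemma is_set1 G z p y : G ⊢ is_set p z -> G ⊢ y ∈ z -> G ⊢ inst y p.
Proof. by move=> /(AllE y) H; case: (IffP (p := y ∈ z) (q := inst y p) H); auto. Qed.

Lemma is_set2 G z p y : G ⊢ is_set p z -> G ⊢ inst y p -> G ⊢ y ∈ z.
Proof. by move=> /(AllE y) H; case: (IffP (p := y ∈ z) (q := inst y p) H); auto. Qed.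

Lemma extensionality G x y :
  (forall G', ext G G' -> forall u, G' ⊢ u ∈ x -> G' ⊢ u ∈ y) ->
  (forall G', ext G G' -> forall u, G' ⊢ u ∈ y -> G' ⊢ u ∈ x) -> G ⊢ x ≡ y.
Proof.
move=> H H'.
have /(AllE x)/(AllE y) A : G ⊢ ax_extensionality by apply: prf_Ax; constructor.
by apply: (ImpE A); apply: AllI => u; apply: IffI => G' E; [apply: H|apply: H'].
Qed.

Lemma set_induction G p :
  (forall G', ext G G' -> forall x,
     (forall G'', ext G' G'' -> forall y, G'' ⊢ y ∈ x -> G'' ⊢ inst y p) ->
     G' ⊢ inst x p) ->
  forall x, G ⊢ inst x p.
Proof.
move=> H x; apply: AllE.
have A : G ⊢ ax_set_induction p by apply: prf_Ax; constructor.
apply: (ImpE A); apply: AllI => y; apply: ImpI => G' E Hy.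
have Hy' : G' ⊢ All_in y p.
  move: (Hy : G' ⊢ ren (scons y id) (All_in 0 (ren (up S) p))).
  by rewrite /All_in /= ren_comp (@ren_id p) // => -[].
by apply: H => // G'' E' z; apply: AllinE (weaken E' Hy').
Qed.

(* In [p], index 0 is the element, and index [n.+1] stands for the variable [n]. *)
Lemma separation G a p : Sigma0 p ->
  G ⊢ Ex (is_set (0 ∈ a.+2 ∧ ren (up S) p) 0).
Proof.
move=> Hp; pose q := ren (up S) p.
have /(AllE a) : G ⊢ ax_separation q.
  by apply: prf_Ax; constructor; apply: Sigma0_ren.
rewrite /inst /= /is_set /Iff /q !ren_comp.
by rewrite (@ren_ext p _ (up S)) // => -[|n].
Qed.

(* In [p], index 0 is the value, index 1 the argument, and index [n.+2] stands
   for the variable [n]. *)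
Lemma collection G a p : Sigma0 p ->
  G ⊢ All_in a (Ex p) -> G ⊢ Ex (All_in a.+1 (Ex_in 1 (ren (up (up S)) p))).
Proof.
move=> Hp H; pose q := ren (up (up S)) p.
have /(AllE a) : G ⊢ ax_collection q.
  by apply: prf_Ax; constructor; apply: Sigma0_ren.
rewrite /inst /= /q !ren_comp.
rewrite (@ren_id p) => [|[|[]]] //.
rewrite (@ren_ext p _ (up (up S))) => [|[|[]]] //.
by move/ImpE; apply.
Qed.

Lemma pairing G x y : G ⊢ Ex (is_set (in_upair 0 x.+2 y.+2) 0).
Proof.
by have /(AllE x)/(AllE y) : G ⊢ ax_pairing by apply: prf_Ax; constructor.
Qed.

Lemma union G x : G ⊢ Ex (is_set (Ex_in x.+2 (1 ∈ 0)) 0).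
Proof. by have /(AllE x) : G ⊢ ax_union by apply: prf_Ax; constructor. Qed.

Lemma ren_Neg r p : ren r (¬ p) = ¬ ren r p. Proof. by []. Qed.
Lemma ren_Iff r p q : ren r (p ⇔ q) = (ren r p ⇔ ren r q). Proof. by []. Qed.
Lemma ren_All_in r y p : ren r (All_in y p) = All_in (r y) (ren (up r) p).
Proof. by []. Qed.
Lemma ren_Ex_in r y p : ren r (Ex_in y p) = Ex_in (r y) (ren (up r) p).
Proof. by []. Qed.
Lemma ren_is_set r p z : ren r (is_set p z) = is_set (ren (up r) p) (r z).
Proof. by []. Qed.
Lemma ren_upair r u x y : ren r (in_upair u x y) = in_upair (r u) (r x) (r y).
Proof. by []. Qed.
Lemma ren_pair r p x y : ren r (is_pair p x y) = is_pair (r p) (r x) (r y).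
Proof. by []. Qed.
Lemma ren_triple r t x y z :
  ren r (is_triple t x y z) = is_triple (r t) (r x) (r y) (r z).
Proof. by []. Qed.
Lemma ren_pair_in r x y z : ren r (pair_in x y z) = pair_in (r x) (r y) (r z).
Proof. by []. Qed.
Lemma ren_transitive_set r x : ren r (transitive_set x) = transitive_set (r x).
Proof. by []. Qed.
Lemma ren_Ord r x : ren r (Ord x) = Ord (r x). Proof. by []. Qed.
#[global] Hint Rewrite ren_Neg ren_Iff ren_All_in ren_Ex_in ren_is_set ren_upair
  ren_pair ren_triple ren_pair_in ren_transitive_set ren_Ord : kren.

Definition inst2 (y x : nat) (p : form) : form := ren (scons y (scons x id)) p.

Ltac ksimp := unfold inst, inst2, shift; cbn [ren up scons]; autorewrite with kren;
  cbn [ren up scons].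

(* The tactics below work on judgements [G ⊢ p].  Given [E : ext G G'], [klift E]
   moves every hypothesis from [G] to [G'].  An equation rewrites from right to
   left, by [prf_EqE]. *)
Ltac klift E :=
  match type of E with ext ?G ?G' =>
    repeat match goal with
    | H : prf IKP_minus_Inf G _ |- _ => apply (weaken E) in H
    | H : forall G'', ext G G'' -> _ |- _ =>
        let H' := fresh in
        pose proof (fun G0 E0 => H G0 (ext_trans E E0)) as H'; cbv beta in H';
        clear H; rename H' into H
    end; clear E; clear G; rename G' into G
  end.

Ltac kenter := let G' := fresh "G" in let E := fresh "E" in intros G' E; klift E.
Ltac ki := apply: ImpI; kenter.
Tactic Notation "ka" ident(y) := apply: AllI; intros y; ksimp.
Tactic Notation "kai" ident(y) := apply: AllinI; kenter; intros y; ksimp.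
Tactic Notation "kset" ident(y) := apply: is_setI; kenter; intros y; ksimp.
Tactic Notation "kext" ident(y) := apply: extensionality; kenter; intros y; ksimp.
Tactic Notation "kx" constr(H) ident(y) := apply: (ExE H); kenter; intros y; ksimp.
Tactic Notation "kxi" constr(H) ident(y) := apply: (ExinE H); kenter; intros y; ksimp.
Ltac kor H := apply: (OrE H); kenter; ksimp.
Tactic Notation "ke" constr(x) := apply: (@ExI _ _ x); ksimp.
Tactic Notation "kei" constr(x) := apply: (@ExinI _ _ _ x); ksimp.
Ltac kand := apply: prf_AndI; ksimp.

(** Every variable of type [nat] in a formula is an index, so replacing each by its successor puts
    the formula under one more binder. *)
Ltac kshift P :=
  match P with
  | context [?v] =>
     let _ := match goal with _ => is_var v end in
     let T := type of v in
     let _ := match goal with _ => constr_eq T nat end in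
     let F := eval pattern v in P in
     lazymatch F with ?f _ =>
       let f' := kshift f in let r := eval cbv beta in (f' (S v)) in r end
  | _ => P
  end.

(* A formula [p] such that [P] is [inst y p]. *)
Ltac kabs y P :=
  let F := eval pattern y in P in
  lazymatch F with ?f _ =>
    let f' := kshift f in let r := eval cbv beta in (f' 0) in r end.

Ltac krwin E H :=
  lazymatch type of E with prf _ ?G (Eq ?x ?y) =>
  lazymatch type of H with prf _ G ?P =>
    let p := kabs y P in
    let F := eval pattern y in P in
    lazymatch F with ?f _ =>
      let Q := eval cbv beta in (f x) in
      let H' := fresh in
      assert (H' : prf IKP_minus_Inf G Q) by exact (@EqR G y x p (EqS E) H);
      clear H; rename H' into H
  end end end.

Ltac krw E :=
  lazymatch type of E with prf _ ?G (Eq ?x ?y) =>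
  lazymatch goal with |- prf _ G ?P =>
    let p := kabs y P in
    let F := eval pattern y in P in
    lazymatch F with ?f _ =>
      let Q := eval cbv beta in (f x) in
      let H := fresh in
      suff H : prf IKP_minus_Inf G Q by exact (@EqR G x y p E H)
    end end end.

Ltac ksub0 E :=
  lazymatch type of E with prf _ ?G (Eq ?x ?y) =>
  try lazymatch goal with |- prf _ G ?P =>
    lazymatch P with context [y] =>
    let p := kabs y P in
    let F := eval pattern y in P in
    lazymatch F with ?f _ =>
      let Q := eval cbv beta in (f x) in
      let H := fresh in
      suff H : prf IKP_minus_Inf G Q by exact (@EqR G x y p E H)
    end end end;
  repeat match goal with H : prf _ G ?P |- _ =>
    lazymatch H with E => fail | _ => idtac end;
    lazymatch P with context [y] => krwin E H end
  end end.

Ltac ksub E := let E' := fresh in pose proof E as E'; ksub0 E'; clear E'.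

(** * Sets and pairs *)

Lemma Sigma0_Neg p : Sigma0 p -> Sigma0 (¬ p).
Proof. by move=> H; constructor=> //; constructor. Qed.
#[global] Hint Resolve Sigma0_Neg Sigma0_ren : s0.
#[global] Hint Constructors Sigma0 : s0.
Ltac s0 := solve [eauto 30 with s0].

(** In continuation form the new set is a variable outside [p], so the renaming by which the axiom
    skips it disappears. *)
Lemma sepE G a p q : Sigma0 p ->
  (forall G', ext G G' -> forall b, G' ⊢ is_set (0 ∈ a.+1 ∧ p) b -> G' ⊢ q) ->
  G ⊢ q.
Proof.
move=> Hp H; apply: (ExE (separation G a Hp)) => G' E b Hb.
apply: (H _ E b); move: (Hb : G' ⊢ ren (scons b id) (is_set (0 ∈ a.+2 ∧ ren (up S) p) 0)).
by rewrite /is_set /= /Iff ren_comp (@ren_id p) // => -[].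
Qed.

Lemma sep1 G a b p u : G ⊢ is_set (0 ∈ a.+1 ∧ p) b -> G ⊢ u ∈ b -> G ⊢ u ∈ a.
Proof. by move=> H /(is_set1 H); apply: (@prf_AndE1 _ _ (u ∈ a) (inst u p)). Qed.

Lemma sep2 G a b p u : G ⊢ is_set (0 ∈ a.+1 ∧ p) b -> G ⊢ u ∈ b -> G ⊢ inst u p.
Proof. by move=> H /(is_set1 H); apply: (@prf_AndE2 _ _ (u ∈ a) (inst u p)). Qed.

Lemma sepI G a b p u :
  G ⊢ is_set (0 ∈ a.+1 ∧ p) b -> G ⊢ u ∈ a -> G ⊢ inst u p -> G ⊢ u ∈ b.
Proof. by move=> H H1 H2; apply: (is_set2 H); apply: prf_AndI. Qed.

Lemma collE G a p q : Sigma0 p ->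
  (forall G', ext G G' -> forall x, G' ⊢ x ∈ a -> G' ⊢ inst x (Ex p)) ->
  (forall G', ext G G' -> forall c, G' ⊢ All_in a (Ex_in c.+1 p) -> G' ⊢ q) ->
  G ⊢ q.
Proof.
move=> Hp H1 H2; apply: (ExE (collection Hp (AllinI H1))) => G' E c Hc.
apply: (H2 _ E c).
move: (Hc : G' ⊢ ren (scons c id) (All_in a.+1 (Ex_in 1 (ren (up (up S)) p)))).
rewrite /All_in /Ex_in /= ren_comp (@ren_id p) // => -[|[|n]] //.
Qed.

Tactic Notation "ksep" constr(a) constr(p) ident(b) ident(H) :=
  apply: (@sepE _ a p _); [s0 | kenter; intros b H].
Tactic Notation "kcoll" constr(a) constr(p) :=
  apply: (@collE _ a p _); [s0 | kenter; ksimp | kenter].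

Definition sub (x y : nat) : form := All_in x (0 ∈ y.+1).

(** The [eq_] formulas identify a set by bounded quantifiers only, so that separation and collection
    apply to formulas built from them and their meaning is the same in L. *)
Definition eq_upair (z x y : nat) : form :=
  x ∈ z ∧ y ∈ z ∧ All_in z (0 ≡ x.+1 ∨ 0 ≡ y.+1).

(* "z = t ∪ {x}" *)
Definition eq_adj (z t x : nat) : form :=
  All_in t (0 ∈ z.+1) ∧ x ∈ z ∧ All_in z (0 ∈ t.+1 ∨ 0 ≡ x.+1).

Definition eq_cup (z x y : nat) : form :=
  All_in x (0 ∈ z.+1) ∧ All_in y (0 ∈ z.+1) ∧ All_in z (0 ∈ x.+1 ∨ 0 ∈ y.+1).

Definition eq_union (z x : nat) : form :=
  All_in x (All_in 0 (0 ∈ z.+2)) ∧ All_in z (Ex_in x.+1 (1 ∈ 0)).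

(* [is_pair] and [pair_in] with bounded quantifiers *)
Definition opair (p x y : nat) : form :=
  Ex_in p (eq_upair 0 x.+1 x.+1) ∧ Ex_in p (eq_upair 0 x.+1 y.+1)
  ∧ All_in p (eq_upair 0 x.+1 x.+1 ∨ eq_upair 0 x.+1 y.+1).

Definition opair_in (x y r : nat) : form := Ex_in r (opair 0 x.+1 y.+1).

(* In [p], indices 1 and 0 are the components of the pair ranging over [x], and
   index [n.+2] stands for the variable [n]. *)
Definition skip2 (n : nat) : nat := if n is m.+2 then m.+4 else n.
Definition All_pr (x : nat) (p : form) : form :=
  All_in x (All_in 0 (All_in 0 (All_in 1 (opair 3 1 0 ⇒ ren skip2 p)))).
Definition Ex_pr (x : nat) (p : form) : form :=
  Ex_in x (Ex_in 0 (Ex_in 0 (Ex_in 1 (opair 3 1 0 ∧ ren skip2 p)))).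

Lemma ren_sub r x y : ren r (sub x y) = sub (r x) (r y). Proof. by []. Qed.
Lemma ren_eq_upair r z x y : ren r (eq_upair z x y) = eq_upair (r z) (r x) (r y).
Proof. by []. Qed.
Lemma ren_eq_adj r z x y : ren r (eq_adj z x y) = eq_adj (r z) (r x) (r y).
Proof. by []. Qed.
Lemma ren_eq_cup r z x y : ren r (eq_cup z x y) = eq_cup (r z) (r x) (r y).
Proof. by []. Qed.
Lemma ren_eq_union r z x : ren r (eq_union z x) = eq_union (r z) (r x).
Proof. by []. Qed.
Lemma ren_opair r p x y : ren r (opair p x y) = opair (r p) (r x) (r y).
Proof. by []. Qed.
Lemma ren_opair_in r p x y : ren r (opair_in p x y) = opair_in (r p) (r x) (r y).
Proof. by []. Qed.
Lemma ren_All_pr r x p : ren r (All_pr x p) = All_pr (r x) (ren (up (up r)) p).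
Proof.
rewrite /All_pr /All_in /= !ren_comp.
by rewrite (@ren_ext p _ (fun n => skip2 (up (up r) n))) // => -[|[]].
Qed.
Lemma ren_Ex_pr r x p : ren r (Ex_pr x p) = Ex_pr (r x) (ren (up (up r)) p).
Proof.
rewrite /Ex_pr /Ex_in /= !ren_comp.
by rewrite (@ren_ext p _ (fun n => skip2 (up (up r) n))) // => -[|[]].
Qed.
#[global] Hint Rewrite ren_sub ren_eq_upair ren_eq_adj ren_eq_cup ren_eq_union
  ren_opair ren_opair_in ren_All_pr ren_Ex_pr : kren.

Lemma Sigma0_sub x y : Sigma0 (sub x y). Proof. rewrite /sub; s0. Qed.
Lemma Sigma0_eq_upair x y z : Sigma0 (eq_upair x y z).
Proof. rewrite /eq_upair; s0. Qed.
#[global] Hint Resolve Sigma0_sub Sigma0_eq_upair : s0.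
Lemma Sigma0_opair x y z : Sigma0 (opair x y z). Proof. rewrite /opair; s0. Qed.
#[global] Hint Resolve Sigma0_opair : s0.
Lemma Sigma0_opair_in x y z : Sigma0 (opair_in x y z).
Proof. rewrite /opair_in; s0. Qed.
Lemma Sigma0_All_pr x p : Sigma0 p -> Sigma0 (All_pr x p).
Proof. by move=> H; rewrite /All_pr; s0. Qed.
Lemma Sigma0_Ex_pr x p : Sigma0 p -> Sigma0 (Ex_pr x p).
Proof. by move=> H; rewrite /Ex_pr; s0. Qed.
#[global] Hint Resolve Sigma0_opair_in Sigma0_All_pr Sigma0_Ex_pr : s0.

Lemma subE G x y u : G ⊢ sub x y -> G ⊢ u ∈ x -> G ⊢ u ∈ y.
Proof. exact: AllinE. Qed.

Lemma Sub_refl G x : G ⊢ sub x x.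
Proof. by kai u. Qed.

Lemma Sub_trans G x y z : G ⊢ sub x y -> G ⊢ sub y z -> G ⊢ sub x z.
Proof. by move=> H H'; kai u => Hu; apply: (subE H'); apply: (subE H). Qed.

Lemma Sub_antisym G x y : G ⊢ sub x y -> G ⊢ sub y x -> G ⊢ x ≡ y.
Proof. by move=> H H'; kext u; apply: subE. Qed.

Lemma eq_upair1 G z x y : G ⊢ eq_upair z x y -> G ⊢ x ∈ z.
Proof. by case/AndP. Qed.
Lemma eq_upair2 G z x y : G ⊢ eq_upair z x y -> G ⊢ y ∈ z.
Proof. by case/AndP=> _ /AndP[]. Qed.
Lemma eq_upairE G z x y u : G ⊢ eq_upair z x y -> G ⊢ u ∈ z -> G ⊢ u ≡ x ∨ u ≡ y.
Proof. by case/AndP=> _ /AndP[_ H]; apply: (AllinE H). Qed.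
Lemma eq_upair11 G z x u : G ⊢ eq_upair z x x -> G ⊢ u ∈ z -> G ⊢ u ≡ x.
Proof. by move=> H Hu; kor (eq_upairE H Hu). Qed.

Lemma eq_upairP G z x y : G ⊢ is_set (in_upair 0 x.+1 y.+1) z <-> G ⊢ eq_upair z x y.
Proof.
split=> H.
  kand; first by apply: (is_set2 H); apply: prf_OrI1; apply: prf_EqI.
  kand; first by apply: (is_set2 H); apply: prf_OrI2; apply: prf_EqI.
  by kai u => Hu; apply: (is_set1 H Hu).
kset u => Hu; first by apply: eq_upairE H Hu.
by kor Hu => Hu'; krw (EqS Hu'); [apply: eq_upair1 H|apply: eq_upair2 H].
Qed.

Lemma upair_ex G x y : G ⊢ Ex (eq_upair 0 x.+1 y.+1).
Proof. by kx (pairing G x y) z => Hz; ke z; apply/eq_upairP. Qed.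

Lemma eq_upair_fun G z z' x y : G ⊢ eq_upair z x y -> G ⊢ eq_upair z' x y -> G ⊢ z ≡ z'.
Proof.
move=> H H'; kext u => Hu.
  by kor (eq_upairE H Hu) => E; krw (EqS E); [apply: eq_upair1 H'|apply: eq_upair2 H'].
by kor (eq_upairE H' Hu) => E; krw (EqS E); [apply: eq_upair1 H|apply: eq_upair2 H].
Qed.

Lemma union_ex G x : G ⊢ Ex (eq_union 0 x.+1).
Proof.
kx (union G x) z => Hz; ke z; kand.
  by kai u => Hu; kai v => Hv; apply: (is_set2 Hz); apply: (ExinI (x := u)).
by kai u => Hu; apply: (is_set1 Hz).
Qed.
Lemma eq_unionI G z x u v : G ⊢ eq_union z x -> G ⊢ u ∈ x -> G ⊢ v ∈ u -> G ⊢ v ∈ z.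
Proof.
case/AndP=> H _ Hu; have Hx : G ⊢ All_in u (0 ∈ z.+1) := AllinE H Hu.
exact: AllinE Hx.
Qed.
Lemma eq_unionE G z x v : G ⊢ eq_union z x -> G ⊢ v ∈ z -> G ⊢ Ex_in x (v.+1 ∈ 0).
Proof. by case/AndP=> _ H Hu; exact: (AllinE H Hu). Qed.

Lemma cup1 G z x y u : G ⊢ eq_cup z x y -> G ⊢ u ∈ x -> G ⊢ u ∈ z.
Proof. by case/AndP=> H _; exact: (AllinE H). Qed.
Lemma cup2 G z x y u : G ⊢ eq_cup z x y -> G ⊢ u ∈ y -> G ⊢ u ∈ z.
Proof. by case/AndP=> _ /AndP[H _]; exact: (AllinE H). Qed.
Lemma cupE G z x y u : G ⊢ eq_cup z x y -> G ⊢ u ∈ z -> G ⊢ u ∈ x ∨ u ∈ y.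
Proof. by case/AndP=> _ /AndP[_ H]; exact: (AllinE H). Qed.
Lemma cup_ex G x y : G ⊢ Ex (eq_cup 0 x.+1 y.+1).
Proof.
kx (upair_ex G x y) p => Hp; kx (union_ex G p) z => Hz; ke z; kand; [|kand].
- by kai u => Hu; apply: (eq_unionI Hz _ Hu); apply: eq_upair1 Hp.
- by kai u => Hu; apply: (eq_unionI Hz _ Hu); apply: eq_upair2 Hp.
- kai u => Hu; kxi (eq_unionE Hz Hu) v => Hv Huv.
  by kor (eq_upairE Hp Hv) => E; krwin (EqS E) Huv; [apply: prf_OrI1|apply: prf_OrI2].
Qed.

Lemma adj1 G z t x u : G ⊢ eq_adj z t x -> G ⊢ u ∈ t -> G ⊢ u ∈ z.
Proof. by case/AndP=> H _; exact: (AllinE H). Qed.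
Lemma adj2 G z t x : G ⊢ eq_adj z t x -> G ⊢ x ∈ z.
Proof. by case/AndP=> _ /AndP[]. Qed.
Lemma adjE G z t x u : G ⊢ eq_adj z t x -> G ⊢ u ∈ z -> G ⊢ u ∈ t ∨ u ≡ x.
Proof. by case/AndP=> _ /AndP[_ H]; exact: (AllinE H). Qed.
Lemma adj_ex G t x : G ⊢ Ex (eq_adj 0 t.+1 x.+1).
Proof.
kx (upair_ex G x x) p => Hp; kx (cup_ex G t p) z => Hz; ke z; kand; [|kand].
- by kai u => Hu; apply: (cup1 Hz Hu).
- by apply: (cup2 Hz); apply: (eq_upair1 Hp).
- kai u => Hu; kor (cupE Hz Hu) => Hu'; first exact: prf_OrI1.
  by apply: prf_OrI2; apply: eq_upair11 Hp Hu'.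
Qed.
Lemma eq_adjP G c b : G ⊢ is_set (0 ∈ b.+1 ∨ 0 ≡ b.+1) c <-> G ⊢ eq_adj c b b.
Proof.
split=> H.
  kand; first by kai u => Hu; apply: (is_set2 H); apply: prf_OrI1.
  kand; first by apply: (is_set2 H); apply: prf_OrI2; apply: prf_EqI.
  by kai u => Hu; apply: (is_set1 H Hu).
kset u => Hu; first by apply: adjE H Hu.
by kor Hu => Hu'; [apply: adj1 H Hu'|krw (EqS Hu'); apply: adj2 H].
Qed.

Lemma opair1 G p x y : G ⊢ opair p x y -> G ⊢ Ex_in p (eq_upair 0 x.+1 x.+1).
Proof. by case/AndP. Qed.
Lemma opair2 G p x y : G ⊢ opair p x y -> G ⊢ Ex_in p (eq_upair 0 x.+1 y.+1).
Proof. by case/AndP=> _ /AndP[]. Qed.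
Lemma opairE G p x y u : G ⊢ opair p x y -> G ⊢ u ∈ p ->
  G ⊢ eq_upair u x x ∨ eq_upair u x y.
Proof. by case/AndP=> _ /AndP[_ H]; exact: (AllinE H). Qed.

Lemma opairP G p x y : G ⊢ is_pair p x y <-> G ⊢ opair p x y.
Proof.
split=> H.
  kand.
    kx (upair_ex G x x) z => Hz; kei z => //; apply: (is_set2 H); apply: prf_OrI1; ksimp.
    exact/eq_upairP.
  kand.
    kx (upair_ex G x y) z => Hz; kei z => //; apply: (is_set2 H); apply: prf_OrI2; ksimp.
    exact/eq_upairP.
  kai u => Hu; have : G ⊢ is_set (in_upair 0 x.+1 x.+1) u ∨ is_set (in_upair 0 x.+1 y.+1) u.
    exact: is_set1 H Hu.
  by move=> D; kor D => /eq_upairP D'; [apply: prf_OrI1|apply: prf_OrI2].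
kset u => Hu.
  by kor (opairE H Hu) => Hu'; [apply: prf_OrI1|apply: prf_OrI2]; apply/eq_upairP.
kor Hu => /eq_upairP Hu'.
  by kxi (opair1 H) v => Hv Hv'; krw (eq_upair_fun Hv' Hu').
by kxi (opair2 H) v => Hv Hv'; krw (eq_upair_fun Hv' Hu').
Qed.

Lemma opair_ex G x y : G ⊢ Ex (opair 0 x.+1 y.+1).
Proof.
kx (upair_ex G x x) s => Hs; kx (upair_ex G x y) t => Ht.
kx (upair_ex G s t) p => Hp; ke p; kand; [|kand].
- by kei s => //; apply: eq_upair1 Hp.
- by kei t => //; apply: eq_upair2 Hp.
- kai u => Hu; kor (eq_upairE Hp Hu) => E; [apply: prf_OrI1|apply: prf_OrI2].
    by krw (EqS E).
  by krw (EqS E).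
Qed.

Lemma opair_fun G p q x y : G ⊢ opair p x y -> G ⊢ opair q x y -> G ⊢ p ≡ q.
Proof.
wlog suff : G p q / G ⊢ opair p x y -> G ⊢ opair q x y -> G ⊢ sub p q.
  by move=> W H H'; apply: Sub_antisym; apply: W.
move=> H H'; kai u => Hu; kor (opairE H Hu) => Hu'.
  by kxi (opair1 H') v => Hv Hv'; krw (eq_upair_fun Hv' Hu').
by kxi (opair2 H') v => Hv Hv'; krw (eq_upair_fun Hv' Hu').
Qed.

Lemma opair_inj G p x y x' y' : G ⊢ opair p x y -> G ⊢ opair p x' y' ->
  (G ⊢ x ≡ x') /\ (G ⊢ y ≡ y').
Proof.
have L H x0 y0 x1 y1 : H ⊢ opair p x0 y0 -> H ⊢ opair p x1 y1 -> H ⊢ x0 ≡ x1.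
  move=> P P'; kxi (opair1 P) u => Hu Hu'; kor (opairE P' Hu) => U.
    by apply: EqS; apply: (eq_upair11 Hu'); apply: eq_upair1 U.
  by apply: EqS; apply: (eq_upair11 Hu'); apply: eq_upair1 U.
move=> P P'; have E := L _ _ _ _ _ P P'; split=> //.
kxi (opair2 P) u => Hu U; kxi (opair2 P') v => Hv V.
ksub E.
have Eq2 H a b w : H ⊢ eq_upair w x a -> H ⊢ b ∈ w -> H ⊢ a ≡ x -> H ⊢ b ≡ x.
  by move=> W B A; kor (eq_upairE W B) => // B'; krw (EqS B').
kor (opairE P' Hu) => U'.
  have Y : G ⊢ y ≡ x by apply: eq_upair11 U' _; apply: eq_upair2 U.
  kor (opairE P Hv) => V'.
    by krw (EqS Y); apply: EqS; apply: eq_upair11 V' _; apply: eq_upair2 V.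
  krw (EqS Y); apply: EqS; apply: Eq2 V' _ Y; exact: eq_upair2 V.
kor (eq_upairE U' (eq_upair2 U)) => // Y.
kor (eq_upairE U (eq_upair2 U')) => Y'; last exact: EqS.
by krw (EqS Y); apply: EqS.
Qed.

Lemma inst2_skip2 a b s q p :
  inst2 b a p = ren (scons b id) (ren (up (scons a id))
    (ren (up (up (scons s id))) (ren (up (up (up (scons q id)))) (ren skip2 p)))).
Proof. by rewrite /inst2 !ren_comp; apply: ren_ext => -[|[]]. Qed.

(* The four bounded quantifiers of [All_pr] and [Ex_pr] reach every pair, since
   [{a, b} ∈ <a, b>] contains both components. *)
Lemma All_prI G x p :
  (forall G', ext G G' -> forall q a b, G' ⊢ q ∈ x -> G' ⊢ opair q a b ->
     G' ⊢ inst2 b a p) -> G ⊢ All_pr x p.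
Proof.
move=> H; apply: AllI => q; apply: ImpI => G1 E1 Hq; apply: AllI => s; apply: ImpI => G2 E2 Hs.
apply: AllI => a; apply: ImpI => G3 E3 Ha; apply: AllI => b; apply: ImpI => G4 E4 Hb.
apply: ImpI => G5 E5 Hp.
have E25 := ext_trans E2 (ext_trans E3 (ext_trans E4 E5)).
have := H _ (ext_trans E1 E25) q a b (weaken E25 Hq) Hp.
by rewrite (inst2_skip2 a b s q).
Qed.

Lemma opair_mem G q a b r :
  G ⊢ opair q a b ->
  (forall G', ext G G' -> forall s, G' ⊢ s ∈ q -> G' ⊢ a ∈ s -> G' ⊢ b ∈ s -> G' ⊢ r) ->
  G ⊢ r.
Proof.
move=> H1 H2; apply: (ExinE (opair2 H1)) => G' E s Hs Hs'.
by apply: (H2 _ E s Hs); [apply: eq_upair1 Hs'|apply: eq_upair2 Hs'].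
Qed.

Lemma All_prE G x p q a b :
  G ⊢ All_pr x p -> G ⊢ q ∈ x -> G ⊢ opair q a b -> G ⊢ inst2 b a p.
Proof.
move=> H Hq Hp; apply: (opair_mem Hp) => G' E s Hs Ha Hb.
have := AllinE (AllinE (AllinE (AllinE (weaken E H) (weaken E Hq)) Hs) Ha) Hb.
move/ImpE/(_ (weaken E Hp)).
by rewrite (inst2_skip2 a b s q).
Qed.

Lemma Ex_prI G x p q a b :
  G ⊢ q ∈ x -> G ⊢ opair q a b -> G ⊢ inst2 b a p -> G ⊢ Ex_pr x p.
Proof.
move=> Hq Hp H; apply: (opair_mem Hp) => G' E s Hs Ha Hb.
apply: (ExinI (weaken E Hq)); apply: (ExinI Hs); apply: (ExinI Ha); apply: (ExinI Hb).
apply: prf_AndI; first exact: weaken E Hp.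
have := weaken E H.
by rewrite (inst2_skip2 a b s q).
Qed.

Lemma Ex_prE G x p r :
  G ⊢ Ex_pr x p ->
  (forall G', ext G G' -> forall q a b, G' ⊢ q ∈ x -> G' ⊢ opair q a b ->
     G' ⊢ inst2 b a p -> G' ⊢ r) -> G ⊢ r.
Proof.
move=> H1 H2; apply: (ExinE H1) => G1 E1 q Hq H; apply: (ExinE H) => G2 E2 s Hs {}H.
apply: (ExinE H) => G3 E3 a Ha {}H; apply: (ExinE H) => G4 E4 b Hb {}H.
have E24 := ext_trans E2 (ext_trans E3 E4).
case: (AndP (p := opair q a b) H) => Hp {}H.
apply: (H2 _ (ext_trans E1 E24) q a b) => //; first exact: weaken E24 Hq.
by rewrite (inst2_skip2 a b s q).
Qed.

Lemma opair_inP G x y r : G ⊢ pair_in x y r <-> G ⊢ opair_in x y r.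
Proof.
split=> H.
  by kx H p => /AndP[/opairP Hp Hr]; kei p.
by kxi H p => Hr Hp; ke p; kand => //; apply/opairP.
Qed.

Tactic Notation "kap" ident(p) ident(a) ident(b) :=
  apply: All_prI; kenter; intros p a b; ksimp.
Tactic Notation "kxp" constr(H) ident(p) ident(a) ident(b) :=
  apply: (Ex_prE H); kenter; intros p a b; ksimp.
Tactic Notation "kep" constr(Hp) constr(Ho) := apply: (Ex_prI Hp Ho); ksimp.

(** * The fundamental operations *)

(* [is_triple] with bounded quantifiers *)
Definition otriple (t x y z : nat) : form :=
  Ex_in t (Ex_in 0 (opair 0 y.+2 z.+2 ∧ opair t.+2 x.+2 0)).

(* "u = {v : <z, v> ∈ x}" *)
Definition eq_img (u z x : nat) : form :=
  All_in u (opair_in z.+1 0 x.+1) ∧ All_pr x (1 ≡ z.+2 ⇒ 0 ∈ u.+2).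

Lemma ren_otriple r t x y z : ren r (otriple t x y z) = otriple (r t) (r x) (r y) (r z).
Proof. by []. Qed.
Lemma ren_eq_img r u z x : ren r (eq_img u z x) = eq_img (r u) (r z) (r x).
Proof. by []. Qed.
#[global] Hint Rewrite ren_otriple ren_eq_img : kren.
Lemma Sigma0_otriple t x y z : Sigma0 (otriple t x y z). Proof. rewrite /otriple; s0. Qed.
Lemma Sigma0_eq_img u z x : Sigma0 (eq_img u z x). Proof. rewrite /eq_img; s0. Qed.
#[global] Hint Resolve Sigma0_otriple Sigma0_eq_img : s0.

(* A fundamental operation [F], by its membership formula "u ∈ F(x, y)", a
   bounded form of it, and a bounded form of "F(x, y) ⊆ w". *)
Record op : Type := Op {
  op_raw : nat -> nat -> nat -> form;
  op_in : nat -> nat -> nat -> form;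
  op_cov : nat -> nat -> nat -> form }.

Definition in_imp0 (u x y : nat) : form :=
  u ∈ x ∧ Ex_in y (Ex_in 0 (Ex_in 1 (opair y.+3 1 0 ∧ (u.+3 ∈ 1 ⇒ u.+3 ∈ 0)))).
Definition in_prod0 (u x y : nat) : form := Ex_in x (Ex_in y.+1 (opair u.+2 1 0)).
Definition in_images0 (u x y : nat) : form := Ex_in y (eq_img u.+1 0 x.+1).
Definition in_dom0 (u x y : nat) : form := Ex_pr x (1 ≡ u.+2).
Definition in_ran0 (u x y : nat) : form := Ex_pr x (0 ≡ u.+2).
Definition in_ext_right0 (u x y : nat) : form :=
  Ex_pr x (Ex_in y.+2 (otriple u.+3 2 1 0)).
Definition in_ext_mid0 (u x y : nat) : form :=
  Ex_pr x (Ex_in y.+2 (otriple u.+3 2 0 1)).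
Definition in_eq_rel0 (u x y : nat) : form :=
  Ex_in y (Ex_in x.+1 (opair u.+2 1 0 ∧ 0 ≡ 1)).
Definition in_mem_rel0 (u x y : nat) : form :=
  Ex_in y (Ex_in x.+1 (opair u.+2 1 0 ∧ 0 ∈ 1)).

Definition op_upair := Op in_upair in_upair (fun w x y => x ∈ w ∧ y ∈ w).
Definition op_bigcap := Op in_bigcap in_bigcap
  (fun w x y => All_in x (in_bigcap 0 x.+1 y.+1 ⇒ 0 ∈ w.+1)).
Definition op_bigcup := Op in_bigcup in_bigcup
  (fun w x y => All_in x (All_in 0 (0 ∈ w.+2))).
Definition op_diff := Op in_diff in_diff
  (fun w x y => All_in x (¬ 0 ∈ y.+1 ⇒ 0 ∈ w.+1)).
Definition op_prod := Op in_prod in_prod0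
  (fun w x y => All_in x (All_in y.+1 (Ex_in w.+2 (opair 0 2 1)))).
Definition op_imp := Op in_imp in_imp0
  (fun w x y => All_in x (in_imp0 0 x.+1 y.+1 ⇒ 0 ∈ w.+1)).
Definition op_images := Op in_images in_images0
  (fun w x y => All_in y (Ex_in w.+1 (eq_img 0 1 x.+2))).
Definition op_dom := Op in_dom in_dom0 (fun w x y => All_pr x (1 ∈ w.+2)).
Definition op_ran := Op in_ran in_ran0 (fun w x y => All_pr x (0 ∈ w.+2)).
Definition op_ext_right := Op in_ext_right in_ext_right0
  (fun w x y => All_pr x (All_in y.+2 (Ex_in w.+3 (otriple 0 3 2 1)))).
Definition op_ext_mid := Op in_ext_mid in_ext_mid0
  (fun w x y => All_pr x (All_in y.+2 (Ex_in w.+3 (otriple 0 3 1 2)))).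
Definition op_eq_rel := Op in_eq_rel in_eq_rel0
  (fun w x y => All_in y (All_in x.+1 (0 ≡ 1 ⇒ Ex_in w.+2 (opair 0 2 1)))).
Definition op_mem_rel := Op in_mem_rel in_mem_rel0
  (fun w x y => All_in y (All_in x.+1 (0 ∈ 1 ⇒ Ex_in w.+2 (opair 0 2 1)))).

(** The order is that of [fundamental_ops]; later on, operations are addressed by their position in
    this list. *)
Definition ops : seq op :=
  [:: op_upair; op_bigcap; op_bigcup; op_diff; op_prod; op_imp; op_images;
      op_dom; op_ran; op_ext_right; op_ext_mid; op_eq_rel; op_mem_rel].

Lemma fundamental_opsE : fundamental_ops = map op_raw ops. Proof. by []. Qed.

Lemma otripleI G t x y z q : G ⊢ opair q y z -> G ⊢ opair t x q -> G ⊢ otriple t x y z.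
Proof.
by move=> Hq Ht; kxi (opair2 Ht) s => Hs Hs'; kei s => //; kei q; [apply: eq_upair2 Hs'|kand].
Qed.

Lemma otripleE G t x y z r : G ⊢ otriple t x y z ->
  (forall G', ext G G' -> forall q, G' ⊢ opair q y z -> G' ⊢ opair t x q -> G' ⊢ r) ->
  G ⊢ r.
Proof.
move=> H H'; kxi H s => Hs {}H; kxi H q => Hq /AndP[H1 H2].
exact: (H' G (@ext_refl _) q).
Qed.

Lemma otripleP G t x y z : G ⊢ is_triple t x y z <-> G ⊢ otriple t x y z.
Proof.
split=> H; first by kx H q => /AndP[/opairP Hq /opairP Ht]; apply: otripleI Hq Ht.
by apply: (otripleE H); kenter => q Hq Ht; ke q; kand; apply/opairP.
Qed.

Lemma otriple_ex G x y z : G ⊢ Ex (otriple 0 x.+1 y.+1 z.+1).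
Proof.
kx (opair_ex G y z) q => Hq; kx (opair_ex G x q) t => Ht; ke t.
exact: otripleI Hq Ht.
Qed.

Lemma otriple_fun G t t' x y z :
  G ⊢ otriple t x y z -> G ⊢ otriple t' x y z -> G ⊢ t ≡ t'.
Proof.
move=> H H'; apply: (otripleE H); kenter => q Hq Ht; apply: (otripleE H'); kenter => q' Hq' Ht'.
by have E := opair_fun Hq Hq'; ksub E; apply: opair_fun Ht Ht'.
Qed.

Lemma eq_imgP G u z x : G ⊢ is_set (pair_in z.+1 0 x.+1) u <-> G ⊢ eq_img u z x.
Proof.
split=> H.
  kand.
    by kai v => Hv; apply/opair_inP; apply: is_set1 H Hv.
  kap p a b => Hp Hq; ki => E; ksub E; apply: (is_set2 H).
  by apply/opair_inP; kei p.
case/AndP: H => H1 H2; kset v => Hv; first by apply/opair_inP; apply: AllinE H1 Hv.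
move/opair_inP: Hv => Hv; kxi Hv p => Hp Hp'.
exact: (ImpE (All_prE H2 Hp Hp') (prf_EqI _ _ _)).
Qed.

Lemma eq_img1 G u z x v : G ⊢ eq_img u z x -> G ⊢ v ∈ u -> G ⊢ opair_in z v x.
Proof. by case/AndP=> H _; exact: (AllinE H). Qed.
Lemma eq_img2 G u z x v p : G ⊢ eq_img u z x -> G ⊢ p ∈ x -> G ⊢ opair p z v -> G ⊢ v ∈ u.
Proof.
by case/AndP=> _ H Hp Hp'; exact: (ImpE (All_prE H Hp Hp') (prf_EqI _ _ _)).
Qed.

Lemma eq_img_fun G u u' z x : G ⊢ eq_img u z x -> G ⊢ eq_img u' z x -> G ⊢ u ≡ u'.
Proof.
by move=> H H'; kext v => Hv;
  [kxi (eq_img1 H Hv) p => Hp Hp'; apply: eq_img2 H' Hp Hp'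
  |kxi (eq_img1 H' Hv) p => Hp Hp'; apply: eq_img2 H Hp Hp'].
Qed.

Lemma field_ex G x : G ⊢ Ex (All_pr x.+1 (1 ∈ 2 ∧ 0 ∈ 2)).
Proof.
kx (union_ex G x) y => Hy; kx (union_ex G y) z => Hz; ke z.
kap p a b => Hp Ho; apply: (opair_mem Ho); kenter => s Hs Ha Hb.
by kand; apply: (eq_unionI Hz (eq_unionI Hy Hp Hs)).
Qed.

Lemma field1 G d x p a b :
  G ⊢ All_pr x (1 ∈ d.+2 ∧ 0 ∈ d.+2) -> G ⊢ p ∈ x -> G ⊢ opair p a b -> G ⊢ a ∈ d.
Proof. by move=> H Hp /(All_prE H Hp)/(@AndP _ (a ∈ d))[]. Qed.
Lemma field2 G d x p a b :
  G ⊢ All_pr x (1 ∈ d.+2 ∧ 0 ∈ d.+2) -> G ⊢ p ∈ x -> G ⊢ opair p a b -> G ⊢ b ∈ d.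
Proof. by move=> H Hp /(All_prE H Hp)/(@AndP _ (a ∈ d))[]. Qed.

Lemma img_ex G z x : G ⊢ Ex (eq_img 0 z.+1 x.+1).
Proof.
kx (field_ex G x) d => Hd.
ksep d (opair_in z.+1 0 x.+1) u Hu; ke u; kand.
  by kai v => Hv; apply: (sep2 Hu Hv).
kap p a b => Hp Hp'; ki => E; ksub E; apply: (sepI Hu); first by apply: field2 Hd Hp Hp'.
by kei p.
Qed.

(** Without power sets, a superset of the product comes from two collections: for fixed a over the
    pairs <a, b>, then over a. The union of the sets so obtained contains every pair. *)
Lemma prod_bound G x y :
  G ⊢ Ex (All_in x.+1 (All_in y.+2 (Ex_in 2 (opair 0 2 1)))).
Proof.
kcoll x (All_in y.+2 (Ex_in 1 (opair 0 3 1))).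
  move=> a Ha; kcoll y (opair 0 a.+2 1).
    by move=> b Hb; exact: opair_ex.
  by move=> c Hc; ke c.
move=> c Hc; kx (union_ex G c) d => Hd; ke d.
kai a => Ha; kai b => Hb; kxi (AllinE Hc Ha) t => Ht Hat.
by kxi (AllinE Hat Hb) p => Hp Hp'; kei p => //; apply: eq_unionI Hd Ht Hp.
Qed.

Lemma prod_boundE G w x y u a b :
  G ⊢ All_in x (All_in y.+1 (Ex_in w.+2 (opair 0 2 1))) ->
  G ⊢ a ∈ x -> G ⊢ b ∈ y -> G ⊢ opair u a b -> G ⊢ u ∈ w.
Proof.
move=> H Ha Hb Hu; kxi (AllinE (AllinE H Ha) Hb) p => Hp Hp'.
by krw (opair_fun Hp' Hu).
Qed.

(** The interface through which all thirteen operations are used alike. [op_bound] gives only a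
    superset of the value; Sigma0 separation cuts it down in [eq_val_ex]. *)
Record op_spec (o : op) : Prop := OpSpec {
  ren_op_raw : forall r u x y, ren r (op_raw o u x y) = op_raw o (r u) (r x) (r y);
  ren_op_in : forall r u x y, ren r (op_in o u x y) = op_in o (r u) (r x) (r y);
  ren_op_cov : forall r u x y, ren r (op_cov o u x y) = op_cov o (r u) (r x) (r y);
  Sigma0_op_in : forall u x y, Sigma0 (op_in o u x y);
  Sigma0_op_cov : forall u x y, Sigma0 (op_cov o u x y);
  op_inP : forall G u x y, G ⊢ op_raw o u x y <-> G ⊢ op_in o u x y;
  op_covI : forall G w x y,
    (forall G', ext G G' -> forall u, G' ⊢ op_in o u x y -> G' ⊢ u ∈ w) ->
    G ⊢ op_cov o w x y;
  op_covE : forall G w x y u,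
    G ⊢ op_cov o w x y -> G ⊢ op_in o u x y -> G ⊢ u ∈ w;
  op_bound : forall G x y r,
    (forall G', ext G G' -> forall w,
      (forall G'', ext G' G'' -> forall u, G'' ⊢ op_in o u x y -> G'' ⊢ u ∈ w) ->
      G' ⊢ r) -> G ⊢ r }.

Lemma upair_spec : op_spec op_upair.
Proof.
split=> //=; try by move=> *; rewrite ?/in_upair; s0.
- move=> G w x y H; kand; apply: (H G (@ext_refl _)).
    by apply: prf_OrI1; apply: prf_EqI.
  by apply: prf_OrI2; apply: prf_EqI.
- by move=> G w x y u /AndP[H1 H2] H; kor H => E; krw (EqS E).
- move=> G x y r H; kx (upair_ex G x y) w => Hw; apply: (H G (@ext_refl _) w).
  by kenter => u Hu; kor Hu => E; krw (EqS E); [apply: eq_upair1 Hw|apply: eq_upair2 Hw].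
Qed.

Lemma bigcap_spec : op_spec op_bigcap.
Proof.
split=> //=; try by move=> *; rewrite /in_bigcap; s0.
- by move=> G w x y H; kai u => Hu; ki => Hu'; apply: (H G (@ext_refl _)).
- by move=> G w x y u H Hu; apply: (ImpE (AllinE H (proj1 (AndP Hu))) Hu).
- by move=> G x y r H; apply: (H G (@ext_refl _) x); kenter => u /AndP[].
Qed.

Lemma bigcup_spec : op_spec op_bigcup.
Proof.
split=> //=; try by move=> *; rewrite /in_bigcup; s0.
- move=> G w x y H; kai u => Hu; kai v => Hv; apply: (H G (@ext_refl _)).
  by kei u.
- by move=> G w x y u H Hu; kxi Hu v => Hv Huv; exact: (AllinE (AllinE H Hv) Huv).
- move=> G x y r H; kx (union_ex G x) w => Hw; apply: (H G (@ext_refl _) w).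
  by kenter => u Hu; kxi Hu v => Hv Huv; apply: eq_unionI Hw Hv Huv.
Qed.

Lemma diff_spec : op_spec op_diff.
Proof.
split=> //=; try by move=> *; rewrite /in_diff; s0.
- by move=> G w x y H; kai u => Hu; ki => Hu'; apply: (H G (@ext_refl _)); kand.
- by move=> G w x y u H /AndP[Hu Hu']; apply: (ImpE (AllinE H Hu) Hu').
- by move=> G x y r H; apply: (H G (@ext_refl _) x); kenter => u /AndP[].
Qed.

Lemma prod_spec : op_spec op_prod.
Proof.
split=> //=; try by move=> *; rewrite /in_prod0; s0.
- move=> G u x y; split=> H; kxi H a => Ha {}H; kxi H b => Hb Hu; kei a => //; kei b => //.
    exact/opairP.
  exact/opairP.
- move=> G w x y H; kai a => Ha; kai b => Hb; kx (opair_ex G a b) p => Hp; kei p => //.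
  by apply: (H G (@ext_refl _)); kei a => //; kei b.
- by move=> G w x y u H Hu; kxi Hu a => Ha {}Hu; kxi Hu b => Hb; apply: (prod_boundE H Ha Hb).
- move=> G x y r H; kx (prod_bound G x y) w => Hw; apply: (H G (@ext_refl _) w).
  by kenter => u Hu; kxi Hu a => Ha {}Hu; kxi Hu b => Hb; apply: (prod_boundE Hw Ha Hb).
Qed.

Lemma imp_spec : op_spec op_imp.
Proof.
split=> //=; try by move=> *; rewrite /in_imp0; s0.
- move=> G u x y; split=> /AndP[Hu H]; kand => //.
    kx H a => {}H; kx H b => /AndP[/opairP Hp H']; apply: (opair_mem Hp); kenter => s Hs Ha Hb.
    by kei s => //; kei a => //; kei b => //; kand.
  kxi H s => Hs {}H; kxi H a => Ha {}H; kxi H b => Hb /AndP[Hp H'].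
  by ke a; ke b; kand => //; apply/opairP.
- by move=> G w x y H; kai u => Hu; ki => Hu'; apply: (H G (@ext_refl _)).
- by move=> G w x y u H Hu; apply: (ImpE (AllinE H (proj1 (AndP Hu))) Hu).
- by move=> G x y r H; apply: (H G (@ext_refl _) x); kenter => u /AndP[].
Qed.

Lemma images_spec : op_spec op_images.
Proof.
split=> //=; try by move=> *; rewrite /in_images0; s0.
- by move=> G u x y; split=> H; kxi H z => Hz /eq_imgP Hu; kei z => //; apply/eq_imgP.
- move=> G w x y H; kai z => Hz; kx (img_ex G z x) u => Hu; kei u => //.
  by apply: (H G (@ext_refl _)); kei z.
- move=> G w x y u H Hu; kxi Hu z => Hz {}Hu; kxi (AllinE H Hz) v => Hv Hv'.
  by krw (eq_img_fun Hv' Hu).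
- move=> G x y r H; kcoll y (eq_img 0 1 x.+2).
    by move=> z Hz; exact: img_ex.
  move=> w Hw; apply: (H G (@ext_refl _) w); kenter => u Hu; kxi Hu z => Hz {}Hu.
  by kxi (AllinE Hw Hz) v => Hv Hv'; krw (eq_img_fun Hv' Hu).
Qed.

Lemma dom_spec : op_spec op_dom.
Proof.
split=> //=; try by move=> *; rewrite /in_dom0 ?ren_All_pr ?ren_Ex_pr; s0.
- move=> G u x y; split=> H.
    by kx H b => /opair_inP {}H; kxi H p => Hp Ho; kep Hp Ho; apply: prf_EqI.
  by kxp H p a b => Hp Ho E; ke b; apply/opair_inP; kei p => //; krw E.
- move=> G w x y H; kap p a b => Hp Ho; apply: (H G (@ext_refl _)).
  by kep Hp Ho; apply: prf_EqI.
- move=> G w x y u H Hu; kxp Hu p a b => Hp Ho E; krw E; exact: (All_prE H Hp Ho).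
- move=> G x y r H; kx (field_ex G x) w => Hw; apply: (H G (@ext_refl _) w).
  by kenter => u Hu; kxp Hu p a b => Hp Ho E; krw E; apply: field1 Hw Hp Ho.
Qed.

Lemma ran_spec : op_spec op_ran.
Proof.
split=> //=; try by move=> *; rewrite /in_ran0; s0.
- move=> G u x y; split=> H.
    by kx H b => /opair_inP {}H; kxi H p => Hp Ho; kep Hp Ho; apply: prf_EqI.
  by kxp H p a b => Hp Ho E; ke a; apply/opair_inP; kei p => //; krw E.
- move=> G w x y H; kap p a b => Hp Ho; apply: (H G (@ext_refl _)).
  by kep Hp Ho; apply: prf_EqI.
- move=> G w x y u H Hu; kxp Hu p a b => Hp Ho E; krw E; exact: (All_prE H Hp Ho).
- move=> G x y r H; kx (field_ex G x) w => Hw; apply: (H G (@ext_refl _) w).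
  by kenter => u Hu; kxp Hu p a b => Hp Ho E; krw E; apply: field2 Hw Hp Ho.
Qed.

Lemma triple_bound G x y z r :
  (forall G', ext G G' -> forall w,
    (forall G'', ext G' G'' -> forall u a b c, G'' ⊢ otriple u a b c ->
       G'' ⊢ a ∈ x -> G'' ⊢ b ∈ y -> G'' ⊢ c ∈ z -> G'' ⊢ u ∈ w) -> G' ⊢ r) ->
  G ⊢ r.
Proof.
move=> H; kx (prod_bound G y z) v => Hv; kx (prod_bound G x v) w => Hw.
apply: (H G (@ext_refl _) w); kenter => u a b c Hu Ha Hb Hc.
apply: (otripleE Hu); kenter => q Hq Ht; apply: (prod_boundE Hw Ha _ Ht).
exact: (prod_boundE Hv Hb Hc Hq).
Qed.

Lemma ext_right_spec : op_spec op_ext_right.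
Proof.
split=> //=; try by move=> *; rewrite /in_ext_right0; s0.
- move=> G u x y; split=> H.
    kx H a => {}H; kx H b => {}H; kx H c => /AndP[/otripleP Hu /AndP[/opair_inP Hp Hc]].
    by kxi Hp p => {}Hp Ho; kep Hp Ho; kei c.
  kxp H p a b => Hp Ho {}H; kxi H c => Hc Hu; ke a; ke b; ke c; kand; first exact/otripleP.
  by kand => //; apply/opair_inP; kei p.
- move=> G w x y H; kap p a b => Hp Ho; kai c => Hc; kx (otriple_ex G a b c) u => Hu.
  by kei u => //; apply: (H G (@ext_refl _)); kep Hp Ho; kei c.
- move=> G w x y u H Hu; kxp Hu p a b => Hp Ho {}Hu; kxi Hu c => Hc {}Hu.
  have K : G ⊢ Ex_in w (otriple 0 a.+1 b.+1 c.+1) := AllinE (All_prE H Hp Ho) Hc.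
  by kxi K v => Hv Hv'; krw (otriple_fun Hv' Hu).
- move=> G x y r H; kx (field_ex G x) d => Hd; apply: (triple_bound (x := d) (y := d) (z := y)).
  kenter => w Hw; apply: (H G (@ext_refl _) w); kenter => u Hu.
  kxp Hu p a b => Hp Ho {}Hu; kxi Hu c => Hc {}Hu.
  by apply: (Hw G (@ext_refl _) u a b c) => //; [apply: field1 Hd Hp Ho|apply: field2 Hd Hp Ho].
Qed.

Lemma ext_mid_spec : op_spec op_ext_mid.
Proof.
split=> //=; try by move=> *; rewrite /in_ext_mid0; s0.
- move=> G u x y; split=> H.
    kx H a => {}H; kx H b => {}H; kx H c => /AndP[/otripleP Hu /AndP[/opair_inP Hp Hc]].
    by kxi Hp p => {}Hp Ho; kep Hp Ho; kei c.
  kxp H p a b => Hp Ho {}H; kxi H c => Hc Hu; ke a; ke b; ke c; kand; first exact/otripleP.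
  by kand => //; apply/opair_inP; kei p.
- move=> G w x y H; kap p a b => Hp Ho; kai c => Hc; kx (otriple_ex G a c b) u => Hu.
  by kei u => //; apply: (H G (@ext_refl _)); kep Hp Ho; kei c.
- move=> G w x y u H Hu; kxp Hu p a b => Hp Ho {}Hu; kxi Hu c => Hc {}Hu.
  have K : G ⊢ Ex_in w (otriple 0 a.+1 c.+1 b.+1) := AllinE (All_prE H Hp Ho) Hc.
  by kxi K v => Hv Hv'; krw (otriple_fun Hv' Hu).
- move=> G x y r H; kx (field_ex G x) d => Hd; apply: (triple_bound (x := d) (y := y) (z := d)).
  kenter => w Hw; apply: (H G (@ext_refl _) w); kenter => u Hu.
  kxp Hu p a b => Hp Ho {}Hu; kxi Hu c => Hc {}Hu.
  by apply: (Hw G (@ext_refl _) u a c b) => //; [apply: field1 Hd Hp Ho|apply: field2 Hd Hp Ho].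
Qed.

Lemma eq_rel_spec : op_spec op_eq_rel.
Proof.
split=> //=; try by move=> *; rewrite /in_eq_rel0; s0.
- move=> G u x y; split=> H; kxi H b => Hb {}H; kxi H a => Ha /AndP[Hu E];
    kei b => //; kei a => //; kand => //; exact/opairP.
- move=> G w x y H; kai b => Hb; kai a => Ha; ki => E.
  kx (opair_ex G b a) p => Hp; kei p => //.
  by apply: (H G (@ext_refl _)); kei b => //; kei a => //; kand.
- move=> G w x y u H Hu; kxi Hu b => Hb {}Hu; kxi Hu a => Ha /AndP[{}Hu E].
  have K : G ⊢ Ex_in w (opair 0 b.+1 a.+1) := ImpE (AllinE (AllinE H Hb) Ha) E.
  by kxi K v => Hv Hv'; krw (opair_fun Hv' Hu).
- move=> G x y r H; kx (prod_bound G y x) w => Hw; apply: (H G (@ext_refl _) w).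
  kenter => u Hu; kxi Hu b => Hb {}Hu; kxi Hu a => Ha /AndP[{}Hu E].
  exact: prod_boundE Hw Hb Ha Hu.
Qed.

Lemma mem_rel_spec : op_spec op_mem_rel.
Proof.
split=> //=; try by move=> *; rewrite /in_mem_rel0; s0.
- move=> G u x y; split=> H; kxi H b => Hb {}H; kxi H a => Ha /AndP[Hu E];
    kei b => //; kei a => //; kand => //; exact/opairP.
- move=> G w x y H; kai b => Hb; kai a => Ha; ki => E.
  kx (opair_ex G b a) p => Hp; kei p => //.
  by apply: (H G (@ext_refl _)); kei b => //; kei a => //; kand.
- move=> G w x y u H Hu; kxi Hu b => Hb {}Hu; kxi Hu a => Ha /AndP[{}Hu E].
  have K : G ⊢ Ex_in w (opair 0 b.+1 a.+1) := ImpE (AllinE (AllinE H Hb) Ha) E.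
  by kxi K v => Hv Hv'; krw (opair_fun Hv' Hu).
- move=> G x y r H; kx (prod_bound G y x) w => Hw; apply: (H G (@ext_refl _) w).
  kenter => u Hu; kxi Hu b => Hb {}Hu; kxi Hu a => Ha /AndP[{}Hu E].
  exact: prod_boundE Hw Hb Ha Hu.
Qed.

Lemma ops_spec o : List.In o ops -> op_spec o.
Proof.
do 13! (case=> [<-|]; first by [exact: upair_spec|exact: bigcap_spec|exact: bigcup_spec
  |exact: diff_spec|exact: prod_spec|exact: imp_spec|exact: images_spec|exact: dom_spec
  |exact: ran_spec|exact: ext_right_spec|exact: ext_mid_spec|exact: eq_rel_spec
  |exact: mem_rel_spec]).
by [].
Qed.

(* "w = F(x, y)" *)
Definition eq_val (o : op) (w x y : nat) : form :=
  All_in w (op_in o 0 x.+1 y.+1) ∧ op_cov o w x y.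

Lemma ren_eq_val o r w x y : op_spec o ->
  ren r (eq_val o w x y) = eq_val o (r w) (r x) (r y).
Proof.
by move=> S; rewrite /eq_val; cbn [ren]; rewrite (ren_op_cov S) ren_All_in (ren_op_in S).
Qed.

Lemma Sigma0_eq_val o w x y : op_spec o -> Sigma0 (eq_val o w x y).
Proof.
move=> S; constructor; last exact: Sigma0_op_cov S _ _ _.
by constructor; apply: Sigma0_op_in S _ _ _.
Qed.

Lemma eq_val_in G o w x y u : op_spec o ->
  G ⊢ eq_val o w x y -> G ⊢ u ∈ w -> G ⊢ op_in o u x y.
Proof.
move=> S /AndP[H _] Hu; have := AllinE H Hu.
by rewrite /inst (ren_op_in S).
Qed.

Lemma in_eq_val G o w x y u : op_spec o ->
  G ⊢ eq_val o w x y -> G ⊢ op_in o u x y -> G ⊢ u ∈ w.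
Proof. by move=> S /AndP[_ H]; apply: op_covE S _ _ _ _ _ H. Qed.

Lemma eq_valI G o w x y : op_spec o ->
  (forall G', ext G G' -> forall u, G' ⊢ u ∈ w -> G' ⊢ op_in o u x y) ->
  (forall G', ext G G' -> forall u, G' ⊢ op_in o u x y -> G' ⊢ u ∈ w) ->
  G ⊢ eq_val o w x y.
Proof.
move=> S H H'; kand; last exact: (op_covI S).
kai u => Hu; rewrite (ren_op_in S); ksimp; exact: (H G (@ext_refl _)).
Qed.

Lemma eq_valP G o w x y : op_spec o ->
  G ⊢ is_set (op_raw o 0 x.+1 y.+1) w <-> G ⊢ eq_val o w x y.
Proof.
move=> S; split=> H.
  apply: (eq_valI S); kenter => u Hu.
    by have := is_set1 H Hu; rewrite /inst (ren_op_raw S) => /(op_inP S).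
  by apply: (is_set2 H); rewrite /inst (ren_op_raw S); apply/(op_inP S).
kset u; rewrite (ren_op_raw S); ksimp => Hu.
  by apply/(op_inP S); apply: (eq_val_in S H).
by apply: (in_eq_val S H); apply/(op_inP S).
Qed.

Lemma eq_val_fun G o w w' x y : op_spec o ->
  G ⊢ eq_val o w x y -> G ⊢ eq_val o w' x y -> G ⊢ w ≡ w'.
Proof.
by move=> S H H'; kext u => Hu; [apply: (in_eq_val S H')|apply: (in_eq_val S H)];
  [apply: (eq_val_in S H)|apply: (eq_val_in S H')].
Qed.

Lemma eq_val_ex G o x y : op_spec o -> G ⊢ Ex (eq_val o 0 x.+1 y.+1).
Proof.
move=> S; apply: (op_bound S (x := x) (y := y)); kenter => w Hw.
apply: (@sepE _ w (op_in o 0 x.+1 y.+1)); first exact: Sigma0_op_in S _ _ _.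
kenter => v Hv; ke v; rewrite (ren_eq_val _ _ _ _ S); ksimp; apply: (eq_valI S); kenter => u Hu.
  by have := sep2 Hv Hu; rewrite /inst (ren_op_in S).
apply: (sepI Hv); first exact: (Hw G (@ext_refl _)).
by rewrite /inst (ren_op_in S).
Qed.

(** * The hierarchy L *)

Definition some_val (u x y : nat) : form :=
  foldr Or Bot [seq eq_val o u x y | o <- ops].

Definition all_vals (s : seq op) (w x y : nat) : form :=
  foldr And (¬ Bot) [seq Ex_in w (eq_val o 0 x.+1 y.+1) | o <- s].

Definition in_succ (x v : nat) : form := x ∈ v ∨ x ≡ v.

(* [in_cl u v], with bounded quantifiers *)
Definition mem_cl (u v : nat) : form :=
  in_succ u v ∨ Ex_in v (Ex_in v.+1 (some_val u.+2 1 0))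
  ∨ Ex_in v (some_val u.+1 0 v.+1) ∨ Ex_in v (some_val u.+1 v.+1 0) ∨ some_val u v v.

(* "cl(v) ⊆ y", with bounded quantifiers *)
Definition cl_sub (v y : nat) : form :=
  All_in v (0 ∈ y.+1) ∧ v ∈ y ∧ All_in v (All_in v.+1 (all_vals ops y.+2 1 0))
  ∧ All_in v (all_vals ops y.+1 0 v.+1) ∧ All_in v (all_vals ops y.+1 v.+1 0)
  ∧ all_vals ops y v v.

(* [in_cl_step u b f], with bounded quantifiers *)
Definition mem_step (u b f : nat) : form := Ex_pr f (1 ∈ b.+2 ∧ mem_cl u.+2 0).

(* "y = ⋃_{c ∈ b} cl(f(c))" *)
Definition eq_step (y b f : nat) : form :=
  All_in y (mem_step 0 b.+1 f.+1) ∧ All_pr f (1 ∈ b.+2 ⇒ cl_sub 0 y.+2).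

(* [L_recursion f a], with bounded quantifiers *)
Definition is_rec (f a : nat) : form :=
  All_in f (Ex_in a.+1 (Ex_in 1 (Ex_in 0 (opair 3 2 0))))
  ∧ All_in a (Ex_pr f.+1 (1 ≡ 2))
  ∧ All_pr f (All_pr f.+2 (1 ≡ 3 ⇒ 0 ≡ 2))
  ∧ All_pr f (1 ∈ a.+2 ⇒ eq_step 0 1 f.+2).

Lemma ren_some_val r u x y : ren r (some_val u x y) = some_val (r u) (r x) (r y).
Proof.
rewrite /some_val; have := ops_spec; elim: ops => [//|o s IH] S; cbn [foldr map ren].
rewrite (ren_eq_val _ _ _ _ (S o _)); last by left.
by rewrite IH // => o' Ho'; apply: S; right.
Qed.
Lemma ren_all_vals r w x y :
  ren r (all_vals ops w x y) = all_vals ops (r w) (r x) (r y).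
Proof.
rewrite /all_vals; have := ops_spec; elim: ops => [//|o s IH] S; cbn [foldr map ren].
rewrite ren_Ex_in (ren_eq_val _ _ _ _ (S o _)); last by left.
by rewrite IH // => o' Ho'; apply: S; right.
Qed.
Lemma ren_in_succ r u v : ren r (in_succ u v) = in_succ (r u) (r v).
Proof. by []. Qed.
#[global] Hint Rewrite ren_some_val ren_all_vals ren_in_succ : kren.
Lemma ren_mem_cl r u v : ren r (mem_cl u v) = mem_cl (r u) (r v).
Proof. by rewrite /mem_cl; ksimp. Qed.
Lemma ren_cl_sub r u v : ren r (cl_sub u v) = cl_sub (r u) (r v).
Proof. by rewrite /cl_sub; ksimp. Qed.
#[global] Hint Rewrite ren_mem_cl ren_cl_sub : kren.
Lemma ren_mem_step r u b f : ren r (mem_step u b f) = mem_step (r u) (r b) (r f).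
Proof. by rewrite /mem_step; ksimp. Qed.
#[global] Hint Rewrite ren_mem_step : kren.
Lemma ren_eq_step r y b f : ren r (eq_step y b f) = eq_step (r y) (r b) (r f).
Proof. by rewrite /eq_step; ksimp. Qed.
#[global] Hint Rewrite ren_eq_step : kren.
Lemma ren_is_rec r f a : ren r (is_rec f a) = is_rec (r f) (r a).
Proof. by rewrite /is_rec; ksimp. Qed.
#[global] Hint Rewrite ren_is_rec : kren.

Lemma Sigma0_some_val u x y : Sigma0 (some_val u x y).
Proof.
rewrite /some_val; have := ops_spec; elim: ops => [|o s IH] S /=; first by constructor.
constructor; first by apply: Sigma0_eq_val; apply: S; left.
by apply: IH => o' Ho'; apply: S; right.
Qed.
Lemma Sigma0_all_vals w x y : Sigma0 (all_vals ops w x y).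
Proof.
rewrite /all_vals; have := ops_spec; elim: ops => [|o s IH] S /=; first by s0.
constructor; first by constructor; apply: Sigma0_eq_val; apply: S; left.
by apply: IH => o' Ho'; apply: S; right.
Qed.
#[global] Hint Resolve Sigma0_some_val Sigma0_all_vals : s0.
Lemma Sigma0_in_succ u v : Sigma0 (in_succ u v). Proof. rewrite /in_succ; s0. Qed.
#[global] Hint Resolve Sigma0_in_succ : s0.
Lemma Sigma0_mem_cl u v : Sigma0 (mem_cl u v). Proof. rewrite /mem_cl; s0. Qed.
Lemma Sigma0_cl_sub u v : Sigma0 (cl_sub u v). Proof. rewrite /cl_sub; s0. Qed.
#[global] Hint Resolve Sigma0_mem_cl Sigma0_cl_sub : s0.
Lemma Sigma0_mem_step u b f : Sigma0 (mem_step u b f). Proof. rewrite /mem_step; s0. Qed.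
#[global] Hint Resolve Sigma0_mem_step : s0.
Lemma Sigma0_eq_step u b f : Sigma0 (eq_step u b f). Proof. rewrite /eq_step; s0. Qed.
#[global] Hint Resolve Sigma0_eq_step : s0.
Lemma Sigma0_is_rec f a : Sigma0 (is_rec f a). Proof. rewrite /is_rec; s0. Qed.
#[global] Hint Resolve Sigma0_is_rec : s0.

Lemma some_valI G o u x y : List.In o ops -> G ⊢ eq_val o u x y -> G ⊢ some_val u x y.
Proof.
rewrite /some_val; elim: ops => //= o' s IH [->|Ho] H; first exact: prf_OrI1.
by apply: prf_OrI2; apply: IH.
Qed.

Lemma some_valE G u x y r : G ⊢ some_val u x y ->
  (forall G', ext G G' -> forall o, List.In o ops -> G' ⊢ eq_val o u x y -> G' ⊢ r) ->
  G ⊢ r.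
Proof.
rewrite /some_val; elim: ops G => [|o s IH] G /= H K; first exact: prf_BotE.
kor H => H'; first by apply: (K G (@ext_refl _) o) => //; left.
by apply: (IH _ H'); kenter => o' Ho'; apply: K => //; right.
Qed.

Lemma some_valP G u x y : G ⊢ is_fundamental_value u x y <-> G ⊢ some_val u x y.
Proof.
rewrite /is_fundamental_value /some_val fundamental_opsE -map_comp.
have := ops_spec; elim: ops G => [|o s IH] G S //=.
have So : op_spec o by apply: S; left.
have {}IH G' := IH G' (fun o' Ho' => S o' (or_intror Ho')).
split=> H.
  by kor H => H'; [apply: prf_OrI1; apply/(eq_valP _ _ _ _ So)|apply: prf_OrI2; apply/IH].
by kor H => H'; [apply: prf_OrI1; apply/(eq_valP _ _ _ _ So)|apply: prf_OrI2; apply/IH].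
Qed.

Lemma all_valsE G s o w x y : List.In o s ->
  G ⊢ all_vals s w x y -> G ⊢ Ex_in w (eq_val o 0 x.+1 y.+1).
Proof.
rewrite /all_vals; elim: s => //= o' s IH [->|Ho] /AndP[H1 H2] //.
exact: IH.
Qed.

Lemma all_valsI G s w x y :
  (forall o, List.In o s -> G ⊢ Ex_in w (eq_val o 0 x.+1 y.+1)) -> G ⊢ all_vals s w x y.
Proof.
rewrite /all_vals; elim: s => [|o s IH] H /=; first by apply: prf_ImpI; apply: prf_Hyp; left.
by kand; [apply: H; left|apply: IH => o' Ho'; apply: H; right].
Qed.

Lemma all_vals_ex G x y : G ⊢ Ex (all_vals ops 0 x.+1 y.+1).
Proof.
(* The induction runs over sublists of [ops]; the continuation form avoids substituting into such a
   list under a binder. *)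
suff : forall r, (forall G', ext G G' -> forall w, G' ⊢ all_vals ops w x y -> G' ⊢ r) -> G ⊢ r.
  by apply; kenter => w Hw; ke w.
have := ops_spec; elim: ops G => [|o s IH] G S r H.
  by apply: (H G (@ext_refl _) x); apply: all_valsI.
have So : op_spec o by apply: S; left.
apply: (IH G) => [o' Ho'|]; first by apply: S; right.
kenter => w Hw; kx (eq_val_ex G x y So) u; rewrite (ren_eq_val _ _ _ _ So); ksimp => Hu.
kx (adj_ex G w u) w' => Hw'; apply: (H G (@ext_refl _) w'); apply: all_valsI => o' /= [<-|Ho'].
  by kei u; [apply: adj2 Hw'|rewrite (ren_eq_val _ _ _ _ So)].
have So' : op_spec o' by apply: S; right.
kxi (all_valsE Ho' Hw) v => Hv; rewrite (ren_eq_val _ _ _ _ So'); ksimp => Hv'.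
by kei v; [apply: adj1 Hw' Hv|rewrite (ren_eq_val _ _ _ _ So')].
Qed.

(** * The closure cl and the recursion step *)

Lemma mem_cl_succ G u v : G ⊢ in_succ u v -> G ⊢ mem_cl u v.
Proof. exact: prf_OrI1. Qed.

(** An argument taken from v ∪ {v} is in v or equal to v. The four combinations are the last four
    disjuncts of [mem_cl], which thereby avoids naming the set v ∪ {v}. *)
Lemma mem_cl_op G o u x y v : List.In o ops -> G ⊢ in_succ x v -> G ⊢ in_succ y v ->
  G ⊢ eq_val o u x y -> G ⊢ mem_cl u v.
Proof.
move=> Ho Hx Hy /(some_valI Ho) H; apply: prf_OrI2.
kor Hx => {}Hx; kor Hy => {}Hy.
- by apply: prf_OrI1; kei x => //; kei y.
- by ksub (EqS Hy); apply: prf_OrI2; apply: prf_OrI1; kei x.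
- by ksub (EqS Hx); do 2! apply: prf_OrI2; apply: prf_OrI1; kei y.
- by ksub (EqS Hx); ksub (EqS Hy); do 3! apply: prf_OrI2.
Qed.

Lemma mem_clE G u v r : G ⊢ mem_cl u v ->
  (forall G', ext G G' -> G' ⊢ in_succ u v -> G' ⊢ r) ->
  (forall G', ext G G' -> forall o x y, List.In o ops -> G' ⊢ in_succ x v ->
     G' ⊢ in_succ y v -> G' ⊢ eq_val o u x y -> G' ⊢ r) -> G ⊢ r.
Proof.
move=> H H1 H2; kor H => [|{}H]; first exact: H1.
have Hv : G ⊢ in_succ v v by apply: prf_OrI2; apply: prf_EqI.
kor H => {}H.
  kxi H x => Hx {}H; kxi H y => Hy {}H; apply: (some_valE H); kenter => o Ho {}H.
  by apply: (H2 G (@ext_refl _) o x y) => //; apply: prf_OrI1.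
kor H => {}H.
  kxi H x => Hx {}H; apply: (some_valE H); kenter => o Ho {}H.
  by apply: (H2 G (@ext_refl _) o x v) => //; apply: prf_OrI1.
kor H => {}H.
  kxi H x => Hx {}H; apply: (some_valE H); kenter => o Ho {}H.
  by apply: (H2 G (@ext_refl _) o v x) => //; apply: prf_OrI1.
apply: (some_valE H); kenter => o Ho {}H.
by apply: (H2 G (@ext_refl _) o v v).
Qed.

Lemma all_vals_sub G v y x z :
  (forall G', ext G G' -> forall u, G' ⊢ mem_cl u v -> G' ⊢ u ∈ y) ->
  G ⊢ in_succ x v -> G ⊢ in_succ z v -> G ⊢ all_vals ops y x z.
Proof.
move=> H Hx Hz; apply: all_valsI => o Ho; have So := ops_spec Ho.
kx (eq_val_ex G x z So) u; rewrite (ren_eq_val _ _ _ _ So); ksimp => Hu.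
kei u; last by rewrite (ren_eq_val _ _ _ _ So).
by apply: (H G (@ext_refl _)); apply: mem_cl_op Hu.
Qed.

Lemma cl_subI G v y :
  (forall G', ext G G' -> forall u, G' ⊢ mem_cl u v -> G' ⊢ u ∈ y) -> G ⊢ cl_sub v y.
Proof.
move=> H; have Hv : G ⊢ in_succ v v by apply: prf_OrI2; apply: prf_EqI.
kand; first by kai u => Hu; apply: (H G (@ext_refl _)); apply: mem_cl_succ; apply: prf_OrI1.
kand; first by apply: (H G (@ext_refl _)); apply: mem_cl_succ.
kand.
  by kai x => Hx; kai z => Hz; apply: (all_vals_sub H); apply: prf_OrI1.
kand; first by kai x => Hx; apply: (all_vals_sub H) => //; apply: prf_OrI1.
kand; first by kai x => Hx; apply: (all_vals_sub H) => //; apply: prf_OrI1.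
exact: (all_vals_sub H).
Qed.

Lemma cl_subE G v y u : G ⊢ cl_sub v y -> G ⊢ mem_cl u v -> G ⊢ u ∈ y.
Proof.
move=> /AndP[H1 /AndP[H2 /AndP[H3 /AndP[H4 /AndP[H5 H6]]]]] Hu.
apply: (mem_clE Hu); kenter.
  by move=> {}Hu; kor Hu => {}Hu; [apply: AllinE H1 Hu|krw (EqS Hu)].
move=> o x z Ho Hx Hz {}Hu; have So := ops_spec Ho.
have K : G ⊢ all_vals ops y x z.
  kor Hx => {}Hx; kor Hz => {}Hz.
  - have K : G ⊢ All_in v (all_vals ops y.+1 x.+1 0).
      by have := AllinE H3 Hx; ksimp.
    by have := AllinE K Hz; ksimp.
  - by krw (EqS Hz); have := AllinE H4 Hx; ksimp.
  - by krw (EqS Hx); have := AllinE H5 Hz; ksimp.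
  - by krw (EqS Hx); krw (EqS Hz).
kxi (all_valsE Ho K) w => Hw; rewrite (ren_eq_val _ _ _ _ So); ksimp => Hw'.
by krw (eq_val_fun So Hw' Hu).
Qed.

Lemma mem_clP G u v : G ⊢ in_cl u v <-> G ⊢ mem_cl u v.
Proof.
split=> H.
  have {}H : G ⊢ Ex (is_set (0 ∈ v.+2 ∨ 0 ≡ v.+2) 0 ∧ in_cl0 u.+1 0) := H.
  apply: (ExE H); kenter => c /(@AndP _ (is_set (0 ∈ v.+1 ∨ 0 ≡ v.+1) c) (in_cl0 u c))[].
  move=> /eq_adjP Hc {}H; kor H => {}H; first by apply: mem_cl_succ; apply: adjE Hc H.
  apply: (ExinE H); kenter => x Hx {}H; apply: (ExinE H); kenter => y Hy {}H.
  have {H} /some_valP H : G ⊢ is_fundamental_value u x y := H.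
  apply: (some_valE H); kenter => o Ho {}H.
  exact: mem_cl_op Ho (adjE Hc Hx) (adjE Hc Hy) H.
kx (adj_ex G v v) c => Hc; apply: (@ExI _ _ c).
apply: (@prf_AndI _ _ (is_set (0 ∈ v.+1 ∨ 0 ≡ v.+1) c) (in_cl0 u c)); first exact/eq_adjP.
have S H' x : H' ⊢ eq_adj c v v -> H' ⊢ in_succ x v -> H' ⊢ x ∈ c.
  by move=> Hc' Hx; kor Hx => {}Hx; [apply: adj1 Hc' Hx|krw (EqS Hx); apply: adj2 Hc'].
apply: (mem_clE H); kenter; first by move=> Hu; apply: prf_OrI1; apply: S.
move=> o x y Ho Hx Hy Hu; apply: prf_OrI2.
apply: (@ExinI _ _ _ x); first exact: S.
apply: (@ExinI _ _ _ y); first exact: S.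
by change (G ⊢ is_fundamental_value u x y); apply/some_valP; apply: some_valI Hu.
Qed.

Lemma adj_succ G c v x : G ⊢ eq_adj c v v -> G ⊢ in_succ x v -> G ⊢ x ∈ c.
Proof.
by move=> Hc Hx; kor Hx => {}Hx; [apply: adj1 Hc Hx|krw (EqS Hx); apply: adj2 Hc].
Qed.

(** Two nested collections over v ∪ {v} gather sets holding the values at each pair of arguments;
    two unions flatten them, and v ∪ {v} itself is added. *)
Lemma cl_sub_ex G v : G ⊢ Ex (cl_sub v.+1 0).
Proof.
kx (adj_ex G v v) c => Hc.
kcoll c (All_in c.+2 (Ex_in 1 (all_vals ops 0 3 1))).
  move=> x Hx; kcoll c (all_vals ops 0 x.+2 1); last by move=> t Ht; ke t.
  by move=> z Hz; exact: all_vals_ex.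
move=> d Hd; kx (union_ex G d) e => He; kx (union_ex G e) f => Hf.
kx (cup_ex G f c) y => Hy; ke y; apply: cl_subI; kenter => u Hu; apply: (mem_clE Hu); kenter.
  by move=> {}Hu; apply: (cup2 Hy); apply: adj_succ Hc Hu.
move=> o x z Ho /(adj_succ Hc) Hx /(adj_succ Hc) Hz {}Hu; have So := ops_spec Ho.
kxi (AllinE Hd Hx) w => Hw Hw'; kxi (AllinE Hw' Hz) t => Ht Ht'.
kxi (all_valsE Ho Ht') u' => Hu'; rewrite (ren_eq_val _ _ _ _ So); ksimp => E.
krw (eq_val_fun So E Hu); apply: (cup1 Hy); apply: (eq_unionI Hf _ Hu').
exact: (eq_unionI He Hw).
Qed.

Lemma mem_stepI G u b f c v : G ⊢ c ∈ b -> G ⊢ opair_in c v f -> G ⊢ mem_cl u v ->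
  G ⊢ mem_step u b f.
Proof. by move=> Hc H Hu; kxi H p => Hp Hp'; kep Hp Hp'; kand. Qed.

Lemma mem_stepE G u b f r : G ⊢ mem_step u b f ->
  (forall G', ext G G' -> forall c v, G' ⊢ c ∈ b -> G' ⊢ opair_in c v f ->
     G' ⊢ mem_cl u v -> G' ⊢ r) -> G ⊢ r.
Proof.
move=> H H'; kxp H p c v => Hp Ho /AndP[Hc Hu]; apply: (H' G (@ext_refl _) c v) => //.
by kei p.
Qed.

Lemma mem_stepP G u b f : G ⊢ in_cl_step u b f <-> G ⊢ mem_step u b f.
Proof.
split=> H.
  apply: (ExinE H); kenter => c Hc {}H; apply: (ExE H); kenter => v {}H.
  case: (@AndP _ (pair_in c v f) (in_cl u v) H) => /opair_inP Hp /mem_clP Hu.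
  exact: mem_stepI Hc Hp Hu.
apply: (mem_stepE H); kenter => c v Hc /opair_inP Hp /mem_clP Hu.
apply: (@ExinI _ _ _ c) => //; apply: (@ExI _ _ v).
exact: (@prf_AndI _ _ (pair_in c v f) (in_cl u v)).
Qed.

Lemma eq_step1 G y b f u : G ⊢ eq_step y b f -> G ⊢ u ∈ y -> G ⊢ mem_step u b f.
Proof. by case/AndP=> H _ Hu; have := AllinE H Hu; ksimp. Qed.

Lemma eq_step2 G y b f u : G ⊢ eq_step y b f -> G ⊢ mem_step u b f -> G ⊢ u ∈ y.
Proof.
case/AndP=> _ H Hu; apply: (mem_stepE Hu); kenter => c v Hc Hp {}Hu.
kxi Hp p => {}Hp Ho; have := All_prE H Hp Ho; ksimp => K.
exact: cl_subE (ImpE K Hc) Hu.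
Qed.

Lemma eq_stepI G y b f :
  (forall G', ext G G' -> forall u, G' ⊢ u ∈ y -> G' ⊢ mem_step u b f) ->
  (forall G', ext G G' -> forall u, G' ⊢ mem_step u b f -> G' ⊢ u ∈ y) ->
  G ⊢ eq_step y b f.
Proof.
move=> H H'; kand; first by kai u; apply: (H G (@ext_refl _)).
kap p c v => Hp Ho; ki => Hc; apply: cl_subI; kenter => u Hu; apply: (H' G (@ext_refl _)).
by apply: (mem_stepI Hc _ Hu); kei p.
Qed.

Lemma eq_stepP G y b f : G ⊢ is_set (in_cl_step 0 b.+1 f.+1) y <-> G ⊢ eq_step y b f.
Proof.
split=> H.
  apply: eq_stepI; kenter => u Hu; first by apply/mem_stepP; apply: is_set1 H Hu.
  by apply: (is_set2 H); apply/mem_stepP.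
apply: is_setI; kenter => u Hu.
  by change (G ⊢ in_cl_step u b f); apply/mem_stepP; apply: eq_step1 H Hu.
have {Hu} /mem_stepP Hu : G ⊢ in_cl_step u b f := Hu.
exact: eq_step2 H Hu.
Qed.

Lemma eq_step_ex G b f : G ⊢ Ex (eq_step 0 b.+1 f.+1).
Proof.
kx (field_ex G f) d => Hd; kcoll d (cl_sub 1 0); first by move=> v Hv; exact: cl_sub_ex.
move=> c Hc; kx (union_ex G c) e => He; ksep e (mem_step 0 b.+1 f.+1) y Hy.
ke y; apply: eq_stepI; kenter => u Hu; first by have := sep2 Hy Hu; ksimp.
apply: (sepI Hy); last by ksimp.
apply: (mem_stepE Hu); kenter => w v Hw Hp {}Hu; kxi Hp p => {}Hp Ho.
kxi (AllinE Hc (field2 Hd Hp Ho)) z => Hz Hz'.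
exact: (eq_unionI He Hz (cl_subE Hz' Hu)).
Qed.

(** * Functions satisfying the recursion *)

Lemma rec_dom G f a b v : G ⊢ is_rec f a -> G ⊢ opair_in b v f -> G ⊢ b ∈ a.
Proof.
case/AndP=> H _ Hp; kxi Hp p => {}Hp Ho.
kxi (AllinE H Hp) b' => Hb {}H; kxi H s => Hs {}H; kxi H v' => Hv Ho'.
by krw (proj1 (opair_inj Ho' Ho)).
Qed.

Lemma rec_total G f a b : G ⊢ is_rec f a -> G ⊢ b ∈ a -> G ⊢ Ex (opair_in b.+1 0 f.+1).
Proof.
case/AndP=> _ /AndP[H _] Hb; have := AllinE H Hb; ksimp => {}H.
by kxp H p b' v => Hp Ho E; ke v; kei p => //; krw E.
Qed.

Lemma rec_fun G f a b v v' : G ⊢ is_rec f a -> G ⊢ opair_in b v f ->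
  G ⊢ opair_in b v' f -> G ⊢ v ≡ v'.
Proof.
case/AndP=> _ /AndP[_ /AndP[H _]] Hv Hv'; kxi Hv p => Hp Ho; kxi Hv' p' => Hp' Ho'.
have := All_prE H Hp' Ho'; ksimp => K; have := All_prE K Hp Ho; ksimp => {}K.
exact: ImpE K (prf_EqI _ _ _).
Qed.

Lemma rec_step G f a b v : G ⊢ is_rec f a -> G ⊢ opair_in b v f -> G ⊢ eq_step v b f.
Proof.
move=> Hf Hv; have Hb := rec_dom Hf Hv; case/AndP: Hf => _ /AndP[_ /AndP[_ H]].
by kxi Hv p => Hp Ho; have := All_prE H Hp Ho; ksimp => K; apply: ImpE K Hb.
Qed.

Lemma is_recI G f a :
  (forall G', ext G G' -> forall p, G' ⊢ p ∈ f ->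
     G' ⊢ Ex (Ex (1 ∈ a.+2 ∧ opair p.+2 1 0))) ->
  (forall G', ext G G' -> forall b, G' ⊢ b ∈ a -> G' ⊢ Ex (opair_in b.+1 0 f.+1)) ->
  (forall G', ext G G' -> forall b v v', G' ⊢ opair_in b v f -> G' ⊢ opair_in b v' f ->
     G' ⊢ v ≡ v') ->
  (forall G', ext G G' -> forall b v, G' ⊢ b ∈ a -> G' ⊢ opair_in b v f ->
     G' ⊢ eq_step v b f) ->
  G ⊢ is_rec f a.
Proof.
move=> H1 H2 H3 H4; kand; [|kand; [|kand]].
- kai p => /(H1 G (@ext_refl _)) H; kx H b => {}H; kx H v => /AndP[Hb Ho].
  by apply: (opair_mem Ho); kenter => s Hs Hbs Hvs; kei b => //; kei s => //; kei v.
- kai b => Hb; have H := H2 G (@ext_refl _) b Hb.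
  kx H v => {}H; kxi H p => Hp Ho; kep Hp Ho; exact: prf_EqI.
- kap p b v => Hp Ho; kap p' b' v' => Hp' Ho'; ki => E; ksub E.
  by apply: (H3 G (@ext_refl _) b'); [kei p'|kei p].
- kap p b v => Hp Ho; ki => Hb; apply: (H4 G (@ext_refl _)) => //.
  by kei p.
Qed.

Lemma L_recursionP G f a : G ⊢ L_recursion f a <-> G ⊢ is_rec f a.
Proof.
split=> H.
  case/AndP: H => /AndP[H1 H2] H3.
  have T G' : ext G G' -> forall b, G' ⊢ b ∈ a ->
      G' ⊢ Ex (pair_in b.+1 0 f.+1 ∧ All (pair_in b.+2 0 f.+2 ⇒ 0 ≡ 1)).
    by move=> E b Hb; have := AllinE (weaken E H2) Hb; ksimp.
  apply: is_recI.
  - kenter => p Hp; have := AllinE H1 Hp; ksimp => H; kxi H b => Hb {}H; kx H v => /opairP Ho.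
    by ke b; ke v; kand.
  - by kenter => b Hb; kx (T G (@ext_refl _) b Hb) v => /AndP[/opair_inP Hv _]; ke v.
  - kenter => b v v' Hv Hv'.
    have Hb : G ⊢ b ∈ a.
      kxi Hv p => Hp Ho; have := AllinE H1 Hp; ksimp => H; kxi H c => Hc {}H.
      by kx H w => /opairP Ho'; krw (proj1 (opair_inj Ho' Ho)).
    kx (T G (@ext_refl _) b Hb) w => /AndP[_ H].
    move/opair_inP: Hv; move/opair_inP: Hv' => Hv' Hv.
    have := AllE v H; ksimp => /ImpE/(_ Hv) E; have := AllE v' H; ksimp => /ImpE/(_ Hv') E'.
    by krw (EqS E'); krw (EqS E); apply: prf_EqI.
  - kenter => b v Hb /opair_inP Hv; apply/eq_stepP.
    have := AllinE H3 Hb; ksimp => K.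
    exact: (ImpE (AllE v K) Hv).
have Hf := H; kand; [kand|].
- kai p => Hp; case/AndP: H => H _; kxi (AllinE H Hp) b => Hb {}H.
  kxi H s => Hs {}H; kxi H v => Hv Ho; kei b => //; ke v; exact/opairP.
- kai b => Hb; kx (rec_total Hf Hb) v => Hv; ke v; kand; first exact/opair_inP.
  by ka w; ki => /opair_inP Hw; apply: rec_fun Hf Hw Hv.
- kai b => Hb; apply: AllI => v; apply: ImpI; kenter => Hv.
  have {Hv} /opair_inP Hv : G ⊢ pair_in b v f := Hv.
  by change (G ⊢ is_set (in_cl_step 0 b.+1 f.+1) v); apply/eq_stepP; apply: rec_step Hf Hv.
Qed.

(** * Ordinals and the stages of the hierarchy *)

Lemma Sigma0_transitive_set x : Sigma0 (transitive_set x).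
Proof. rewrite /transitive_set; s0. Qed.
#[global] Hint Resolve Sigma0_transitive_set : s0.
Lemma Sigma0_Ord x : Sigma0 (Ord x).
Proof. rewrite /Ord; s0. Qed.
#[global] Hint Resolve Sigma0_Ord : s0.

Lemma transE G x y z : G ⊢ transitive_set x -> G ⊢ y ∈ x -> G ⊢ z ∈ y -> G ⊢ z ∈ x.
Proof. by move=> H Hy Hz; have := AllinE H Hy; ksimp => /AllinE/(_ Hz). Qed.

Lemma transI G x :
  (forall G', ext G G' -> forall y z, G' ⊢ y ∈ x -> G' ⊢ z ∈ y -> G' ⊢ z ∈ x) ->
  G ⊢ transitive_set x.
Proof. by move=> H; kai y => Hy; kai z => Hz; apply: (H G (@ext_refl _)) Hz. Qed.

Lemma Ord_trans G x : G ⊢ Ord x -> G ⊢ transitive_set x.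
Proof. by case/AndP. Qed.
Lemma Ord_mem_trans G x y : G ⊢ Ord x -> G ⊢ y ∈ x -> G ⊢ transitive_set y.
Proof. by case/AndP=> _ H Hy; have := AllinE H Hy; ksimp. Qed.
Lemma OrdI G x : G ⊢ transitive_set x ->
  (forall G', ext G G' -> forall y, G' ⊢ y ∈ x -> G' ⊢ transitive_set y) -> G ⊢ Ord x.
Proof. by move=> H H'; kand => //; kai y => Hy; apply: (H' G (@ext_refl _)). Qed.
Lemma Ord_mem G x y : G ⊢ Ord x -> G ⊢ y ∈ x -> G ⊢ Ord y.
Proof.
move=> H Hy; apply: OrdI; first exact: Ord_mem_trans H Hy.
by kenter => z Hz; apply: (Ord_mem_trans H); apply: transE (Ord_trans H) Hy Hz.
Qed.

Lemma mem_step_agree G u a b f g :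
  G ⊢ is_rec g a -> G ⊢ sub b a ->
  (forall G', ext G G' -> forall c v v', G' ⊢ c ∈ b -> G' ⊢ opair_in c v f ->
     G' ⊢ opair_in c v' g -> G' ⊢ v ≡ v') ->
  G ⊢ mem_step u b f -> G ⊢ mem_step u b g.
Proof.
move=> Hg Hb H Hu; apply: (mem_stepE Hu); kenter => c v Hc Hv {}Hu.
kx (rec_total Hg (subE Hb Hc)) v' => Hv'; apply: (mem_stepI Hc Hv').
by krw (H G (@ext_refl _) _ _ _ Hc Hv Hv').
Qed.

(** Set induction on the argument b: transitivity of both domains keeps the elements of b inside
    them, where the values agree by hypothesis. *)
Lemma rec_agree G f g a a' b v v' :
  G ⊢ transitive_set a -> G ⊢ transitive_set a' -> G ⊢ is_rec f a -> G ⊢ is_rec g a' ->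
  G ⊢ opair_in b v f -> G ⊢ opair_in b v' g -> G ⊢ v ≡ v'.
Proof.
move=> Ta Ta' Hf Hg.
have H : G ⊢ inst b (All (All (opair_in 2 1 f.+3 ⇒ opair_in 2 0 g.+3 ⇒ 1 ≡ 0))).
  apply: set_induction; kenter => {v v' b} b IH; ksimp; ka v; ka v'; ki => Hv; ki => Hv'.
  have Sf : G ⊢ sub b a by kai c; apply: transE Ta (rec_dom Hf Hv).
  have Sg : G ⊢ sub b a' by kai c; apply: transE Ta' (rec_dom Hg Hv').
  have IH' : forall G', ext G G' -> forall c w w', G' ⊢ c ∈ b -> G' ⊢ opair_in c w f ->
     G' ⊢ opair_in c w' g -> G' ⊢ w ≡ w'.
    kenter => c w w' Hc Hw Hw'; have := IH G (@ext_refl _) c Hc; ksimp => K.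
    by have := AllE w' (AllE w K); ksimp => {}K; apply: ImpE (ImpE K Hw) Hw'.
  kext u => Hu.
    apply: (eq_step2 (rec_step Hg Hv')); apply: (mem_step_agree Hg Sg IH').
    exact: eq_step1 (rec_step Hf Hv) Hu.
  apply: (eq_step2 (rec_step Hf Hv)); apply: (mem_step_agree Hf Sf (f := g)).
    by kenter => c w w' Hc Hw Hw'; apply: EqS; apply: IH' Hw' Hw.
  exact: eq_step1 (rec_step Hg Hv') Hu.
by move: H; ksimp => H Hv Hv'; have := AllE v' (AllE v H); ksimp => {}H; apply: ImpE (ImpE H Hv) Hv'.
Qed.

Lemma eq_step_agree G f g a b v :
  G ⊢ transitive_set a -> G ⊢ transitive_set b -> G ⊢ sub b a ->
  G ⊢ is_rec f a -> G ⊢ is_rec g b -> G ⊢ eq_step v b f -> G ⊢ eq_step v b g.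
Proof.
move=> Ta Tb S Hf Hg Hv; apply: eq_stepI; kenter => u Hu.
  apply: (mem_step_agree Hg (Sub_refl _ _) _ (eq_step1 Hv Hu)); kenter => c x x' Hc.
  exact: rec_agree Ta Tb Hf Hg.
apply: (eq_step2 Hv); apply: (mem_step_agree Hf S _ Hu); kenter => c x x' Hc.
exact: rec_agree Tb Ta Hg Hf.
Qed.

(* "v = L_a" for an ordinal a *)
Definition isL (v a : nat) : form := Ord a ∧ Ex (is_rec 0 a.+1 ∧ eq_step v.+1 a.+1 0).
Lemma ren_isL r v a : ren r (isL v a) = isL (r v) (r a).
Proof. by rewrite /isL; ksimp. Qed.
#[global] Hint Rewrite ren_isL : kren.

Lemma isL_Ord G v a : G ⊢ isL v a -> G ⊢ Ord a.
Proof. by case/AndP. Qed.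

Lemma isLI G v a f : G ⊢ Ord a -> G ⊢ is_rec f a -> G ⊢ eq_step v a f -> G ⊢ isL v a.
Proof. by move=> Ha Hf Hv; kand => //; ke f; kand. Qed.

Lemma isL_step G v a f : G ⊢ isL v a -> G ⊢ is_rec f a -> G ⊢ eq_step v a f.
Proof.
case/AndP=> Ha H Hf; kx H g => /AndP[Hg Hv]; have T := Ord_trans Ha.
by apply: (eq_step_agree T T (Sub_refl _ _) Hg Hf).
Qed.

Lemma isL_fun G v v' a : G ⊢ isL v a -> G ⊢ isL v' a -> G ⊢ v ≡ v'.
Proof.
move=> H; case/AndP=> Ha H'; kx H' f => /AndP[Hf Hv']; have Hv := isL_step H Hf.
by kext u => Hu; [apply: (eq_step2 Hv'); apply: eq_step1 Hv Hu
                 |apply: (eq_step2 Hv); apply: eq_step1 Hv' Hu].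
Qed.

(** The usual argument for Sigma-recursion: by induction every b in a has a stage, and the function
    sending b to it is separated from a bound of a product. *)
Lemma rec_ex G a : G ⊢ Ord a -> G ⊢ Ex (is_rec 0 a.+1).
Proof.
apply: ImpE; have : G ⊢ inst a (Ord 0 ⇒ Ex (is_rec 0 1)); last by ksimp.
apply: set_induction; kenter => {}a IH; ksimp; ki => Ha.
have IH' : forall G', ext G G' -> forall b, G' ⊢ b ∈ a -> G' ⊢ Ex (isL 0 b.+1).
  kenter => b Hb; have := IH G (@ext_refl _) b Hb; ksimp => K.
  have Ob := Ord_mem Ha Hb; kx (ImpE K Ob) f => Hf.
  by kx (eq_step_ex G b f) v => Hv; ke v; apply: isLI Hf Hv.
(* Collection requires a Sigma0 formula, while [isL] hides an unbounded quantifier over recursions.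
   A set t containing both the recursion and the stage makes the quantifiers bounded. *)
kcoll a (Ex_in 0 (Ex_in 1 (is_rec 1 3 ∧ eq_step 0 3 1))).
  move=> b Hb; kx (IH' G (@ext_refl _) b Hb) v => /AndP[_ H]; kx H f => /AndP[Hf Hv].
  kx (upair_ex G f v) t => Ht; ke t; kei f; first exact: eq_upair1 Ht.
  by kei v; [exact: eq_upair2 Ht|kand].
move=> c Hc; kx (union_ex G c) d => Hd; kx (prod_bound G a d) e => He.
ksep e (Ex_in a.+1 (Ex_in c.+2 (Ex_in 0 (Ex_in 1
  (is_rec 1 3 ∧ eq_step 0 3 1 ∧ opair 4 3 0))))) f Hf; ke f.
have A : forall G', ext G G' -> forall p r, G' ⊢ p ∈ f -> (forall G'', ext G' G'' ->
    forall b v, G'' ⊢ b ∈ a -> G'' ⊢ isL v b -> G'' ⊢ opair p b v -> G'' ⊢ r) -> G' ⊢ r.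
  kenter => p r Hp H; have := sep2 Hf Hp; ksimp => K; kxi K b => Hb {}K; kxi K t => Ht {}K.
  kxi K g => Hg {}K; kxi K v => Hv /AndP[Rg /AndP[Rv Ho]].
  by apply: (H G (@ext_refl _) b v) => //; apply: isLI Rg Rv; apply: Ord_mem Ha Hb.
have A' : forall G', ext G G' -> forall b v, G' ⊢ opair_in b v f -> G' ⊢ isL v b.
  kenter => b v H; kxi H p => Hp Ho; apply: (A G (@ext_refl _) _ _ Hp).
  by kenter => b' v' Hb H' /(opair_inj Ho)[E E']; krw (EqS E'); krw (EqS E).
have B : forall G', ext G G' -> forall b, G' ⊢ b ∈ a -> G' ⊢ Ex (opair_in b.+1 0 f.+1).
  kenter => b Hb; kxi (AllinE Hc Hb) t => Ht K; kxi K g => Hg {}K; kxi K v => Hv /AndP[Rg Rv].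
  kx (opair_ex G b v) p => Hp; ke v; kei p => //; apply: (sepI Hf).
    by apply: (prod_boundE He Hb _ Hp); apply: eq_unionI Hd Ht Hv.
  by ksimp; kei b => //; kei t => //; kei g => //; kei v => //; kand => //; kand.
apply: is_recI => //.
- kenter => p Hp; apply: (A G (@ext_refl _) _ _ Hp); kenter => b v Hb _ Ho.
  by ke b; ke v; kand.
- by kenter => b v v' /(A' G (@ext_refl _)) Hv /(A' G (@ext_refl _)); apply: isL_fun.
kenter => b v Hb /(A' G (@ext_refl _)) Hv; have [Ob K] := AndP Hv; kx K g => /AndP[Rg Rv].
(* The values of g are stages as well, by comparison with a recursion h on x itself. Hence f and g
   agree below b, and f inherits the recursion equation at b. *)
have C : forall G', ext G G' -> forall c w, G' ⊢ opair_in c w g -> G' ⊢ isL w c.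
  kenter => x w Hw; have Hx := rec_dom Rg Hw.
  kx (IH' G (@ext_refl _) x (transE (Ord_trans Ha) Hb Hx)) w' => Hw'.
  have [Ox L] := AndP Hw'; kx L h => /AndP[Rh _]; apply: (isLI Ox Rh).
  apply: (eq_step_agree (Ord_trans Ob) (Ord_trans Ox) _ Rg Rh (rec_step Rg Hw)).
  by kai z => Hz; apply: transE (Ord_trans Ob) Hx Hz.
have S : G ⊢ sub b a by kai z => Hz; apply: transE (Ord_trans Ha) Hb Hz.
have D : forall G', ext G G' -> forall x w w', G' ⊢ opair_in x w g -> G' ⊢ opair_in x w' f ->
   G' ⊢ w ≡ w'.
  by kenter => x w w' Hw Hw'; apply: isL_fun (C G (@ext_refl _) _ _ Hw) (A' G (@ext_refl _) _ _ Hw').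
apply: eq_stepI; kenter => u Hu.
  apply: (mem_stepE (eq_step1 Rv Hu)); kenter => x w Hx Hw {}Hu.
  kx (B G (@ext_refl _) x (subE S Hx)) w' => Hw'; apply: (mem_stepI Hx Hw').
  by krw (D G (@ext_refl _) _ _ _ Hw Hw').
apply: (eq_step2 Rv); apply: (mem_stepE Hu); kenter => x w Hx Hw {}Hu.
kx (rec_total Rg Hx) w' => Hw'; apply: (mem_stepI Hx Hw').
by krw (EqS (D G (@ext_refl _) _ _ _ Hw' Hw)).
Qed.

Lemma isL_ex G a : G ⊢ Ord a -> G ⊢ Ex (isL 0 a.+1).
Proof.
move=> Ha; kx (rec_ex Ha) f => Hf; kx (eq_step_ex G a f) v => Hv; ke v.
exact: isLI Hf Hv.
Qed.

Lemma isL_rec G a f b v : G ⊢ Ord a -> G ⊢ is_rec f a -> G ⊢ opair_in b v f -> G ⊢ isL v b.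
Proof.
move=> Ha Hf Hv; have Hb := rec_dom Hf Hv; have Ob := Ord_mem Ha Hb.
kx (rec_ex Ob) g => Hg; apply: (isLI Ob Hg).
apply: (eq_step_agree (Ord_trans Ha) (Ord_trans Ob) _ Hf Hg (rec_step Hf Hv)).
by kai z => Hz; apply: transE (Ord_trans Ha) Hb Hz.
Qed.

Lemma isL_memI G v a b w u : G ⊢ isL v a -> G ⊢ b ∈ a -> G ⊢ isL w b -> G ⊢ mem_cl u w ->
  G ⊢ u ∈ v.
Proof.
move=> /AndP[Ha H] Hb Hw Hu; kx H f => /AndP[Hf Hv]; apply: (eq_step2 Hv).
kx (rec_total Hf Hb) w' => Hw'; apply: (mem_stepI Hb Hw').
by krw (isL_fun Hw (isL_rec Ha Hf Hw')).
Qed.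

Lemma isL_memE G v a u r : G ⊢ isL v a -> G ⊢ u ∈ v ->
  (forall G', ext G G' -> forall b w, G' ⊢ b ∈ a -> G' ⊢ isL w b -> G' ⊢ mem_cl u w ->
     G' ⊢ r) -> G ⊢ r.
Proof.
move=> /AndP[Ha H] Hu K; kx H f => /AndP[Hf Hv]; apply: (mem_stepE (eq_step1 Hv Hu)).
kenter => b w Hb Hw {}Hu; apply: (K G (@ext_refl _) b w) => //.
exact: isL_rec Ha Hf Hw.
Qed.

Lemma isL_in_L G v a x : G ⊢ isL v a -> G ⊢ x ∈ v -> G ⊢ in_L x.
Proof.
move=> /AndP[Ha H] Hx; kx H f => /AndP[Hf Hv]; apply: (@ExI _ _ a).
apply: (@prf_AndI _ _ (Ord a) (in_L_at x a)) => //; apply: (@ExI _ _ f).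
apply: (@prf_AndI _ _ (L_recursion f a) (in_cl_step x a f)); first exact/L_recursionP.
by apply/mem_stepP; apply: eq_step1 Hv Hx.
Qed.

Lemma in_L_isL G x r : G ⊢ in_L x ->
  (forall G', ext G G' -> forall a v, G' ⊢ isL v a -> G' ⊢ x ∈ v -> G' ⊢ r) -> G ⊢ r.
Proof.
move=> H K; apply: (ExE H); kenter => a {H} /(@AndP _ (Ord a) (in_L_at x a))[Ha H].
apply: (ExE H); kenter => f {H} /(@AndP _ (L_recursion f a) (in_cl_step x a f))[].
move=> /L_recursionP Hf /mem_stepP Hx; kx (eq_step_ex G a f) v => Hv.
apply: (K G (@ext_refl _) a v); first exact: isLI Hf Hv.
exact: eq_step2 Hv Hx.
Qed.

Lemma ren_in_L r x : ren r (in_L x) = in_L (r x). Proof. by []. Qed.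
Lemma ren_in_L_at r x a : ren r (in_L_at x a) = in_L_at (r x) (r a). Proof. by []. Qed.
#[global] Hint Rewrite ren_in_L ren_in_L_at : kren.

(** * Transitivity of L *)

Lemma Ord_succ G s a : G ⊢ Ord a -> G ⊢ eq_adj s a a -> G ⊢ Ord s.
Proof.
move=> Ha Hs; apply: OrdI.
  apply: transI; kenter => y z Hy Hz; kor (adjE Hs Hy) => {}Hy.
    by apply: (adj1 Hs); apply: transE (Ord_trans Ha) Hy Hz.
  by krwin (EqS Hy) Hz; apply: adj1 Hs Hz.
kenter => y Hy; kor (adjE Hs Hy) => {}Hy; first exact: Ord_mem_trans Ha Hy.
by krw (EqS Hy); apply: Ord_trans.
Qed.

Lemma Ord_cup G c a b : G ⊢ Ord a -> G ⊢ Ord b -> G ⊢ eq_cup c a b -> G ⊢ Ord c.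
Proof.
move=> Ha Hb Hc; apply: OrdI.
  apply: transI; kenter => y z Hy Hz; kor (cupE Hc Hy) => {}Hy.
    by apply: (cup1 Hc); apply: transE (Ord_trans Ha) Hy Hz.
  by apply: (cup2 Hc); apply: transE (Ord_trans Hb) Hy Hz.
by kenter => y Hy; kor (cupE Hc Hy) => {}Hy; [apply: Ord_mem_trans Ha Hy|apply: Ord_mem_trans Hb Hy].
Qed.

Lemma Ord_union G c d :
  (forall G', ext G G' -> forall x, G' ⊢ x ∈ d -> G' ⊢ Ord x) ->
  G ⊢ eq_union c d -> G ⊢ Ord c.
Proof.
move=> H Hc; apply: OrdI.
  apply: transI; kenter => y z Hy Hz; kxi (eq_unionE Hc Hy) x => Hx Hyx.
  by apply: (eq_unionI Hc Hx); apply: transE (Ord_trans (H G (@ext_refl _) x Hx)) Hyx Hz.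
kenter => y Hy; kxi (eq_unionE Hc Hy) x => Hx Hyx.
exact: Ord_mem_trans (H G (@ext_refl _) x Hx) Hyx.
Qed.

(** Monotonicity holds for inclusion of the indices, not merely for membership; this lets a union of
    ordinals act as an upper bound. *)
Lemma isL_mono G v a w b : G ⊢ isL v a -> G ⊢ isL w b -> G ⊢ sub a b -> G ⊢ sub v w.
Proof.
move=> Hv Hw S; kai u => Hu; apply: (isL_memE Hv Hu); kenter => c x Hc Hx {}Hu.
exact: isL_memI Hw (subE S Hc) Hx Hu.
Qed.

Lemma cl_in_L G v a u : G ⊢ isL v a -> G ⊢ mem_cl u v -> G ⊢ in_L u.
Proof.
move=> Hv Hu; kx (adj_ex G a a) s => Hs.
kx (isL_ex (Ord_succ (isL_Ord Hv) Hs)) w => Hw; apply: (isL_in_L Hw).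
exact: isL_memI Hw (adj2 Hs) Hv Hu.
Qed.

Lemma isL_L G v a : G ⊢ isL v a -> G ⊢ in_L v.
Proof. by move=> Hv; apply: (cl_in_L Hv); apply: mem_cl_succ; apply: prf_OrI2; apply: prf_EqI. Qed.

(** Two ordinals need not be comparable, so the common stage has index a ∪ b. *)
Lemma L_directed G x y r : G ⊢ in_L x -> G ⊢ in_L y ->
  (forall G', ext G G' -> forall a v, G' ⊢ isL v a -> G' ⊢ x ∈ v -> G' ⊢ y ∈ v -> G' ⊢ r) ->
  G ⊢ r.
Proof.
move=> Hx Hy H; apply: (in_L_isL Hx); kenter => a v Hv Hxv; apply: (in_L_isL Hy); kenter => b w Hw Hyw.
kx (cup_ex G a b) c => Hc; kx (isL_ex (Ord_cup (isL_Ord Hv) (isL_Ord Hw) Hc)) z => Hz.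
apply: (H G (@ext_refl _) c z Hz).
  by apply: (subE (isL_mono Hv Hz _) Hxv); kai t; apply: cup1 Hc.
by apply: (subE (isL_mono Hw Hz _) Hyw); kai t; apply: cup2 Hc.
Qed.

Lemma L_op G o w x y : List.In o ops -> G ⊢ in_L x -> G ⊢ in_L y ->
  G ⊢ eq_val o w x y -> G ⊢ in_L w.
Proof.
move=> Ho Hx Hy Hw; apply: (L_directed Hx Hy); kenter => a v Hv {}Hx {}Hy.
by apply: (cl_in_L Hv); apply: (mem_cl_op Ho _ _ Hw); apply: prf_OrI1.
Qed.

Lemma L_op_ex G o x y r : List.In o ops -> G ⊢ in_L x -> G ⊢ in_L y ->
  (forall G', ext G G' -> forall w, G' ⊢ in_L w -> G' ⊢ eq_val o w x y -> G' ⊢ r) ->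
  G ⊢ r.
Proof.
move=> Ho Hx Hy H; have So := ops_spec Ho; kx (eq_val_ex G x y So) w.
rewrite (ren_eq_val _ _ _ _ So); ksimp => Hw.
by apply: (H G (@ext_refl _) w) => //; apply: L_op Hw.
Qed.

(** Being an ordinal is Sigma0, so the ordinals in c form a set. Its union d is an ordinal including
    each of them, and [isL_mono] applies. *)
Lemma L_bound G c r :
  (forall G', ext G G' -> forall d v, G' ⊢ isL v d ->
    (forall G'', ext G' G'' -> forall a w, G'' ⊢ a ∈ c -> G'' ⊢ isL w a -> G'' ⊢ sub w v) ->
    G' ⊢ r) -> G ⊢ r.
Proof.
move=> H; ksep c (Ord 0) e He; kx (union_ex G e) d => Hd.
have Od : G ⊢ Ord d.
  by apply: (Ord_union _ Hd); kenter => x Hx; have := sep2 He Hx; ksimp.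
kx (isL_ex Od) v => Hv; apply: (H G (@ext_refl _) d v Hv); kenter => a w Ha Hw.
apply: (isL_mono Hw Hv); kai x => Hx; apply: (eq_unionI Hd _ Hx); apply: (sepI He Ha); ksimp.
exact: isL_Ord Hw.
Qed.

(* "x is an element of a transitive set t ⊆ L".  The levels L_a are not
   transitive; this notion is what goes through the induction on a. *)
Definition hered_L (x : nat) : form :=
  Ex (Ex (Ex (transitive_set 2 ∧ x.+3 ∈ 2 ∧ isL 1 0 ∧ sub 2 1))).
Lemma ren_hered_L r x : ren r (hered_L x) = hered_L (r x).
Proof. by rewrite /hered_L; ksimp. Qed.
#[global] Hint Rewrite ren_hered_L : kren.

Lemma hered_LI G x t v a : G ⊢ transitive_set t -> G ⊢ x ∈ t -> G ⊢ isL v a -> G ⊢ sub t v ->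
  G ⊢ hered_L x.
Proof. by move=> H1 H2 H3 H4; ke t; ke v; ke a; kand => //; kand => //; kand. Qed.

Lemma hered_LE G x r : G ⊢ hered_L x ->
  (forall G', ext G G' -> forall t v a, G' ⊢ transitive_set t -> G' ⊢ x ∈ t ->
     G' ⊢ isL v a -> G' ⊢ sub t v -> G' ⊢ r) -> G ⊢ r.
Proof.
move=> H K; kx H t => {}H; kx H v => {}H; kx H a => /AndP[H1 /AndP[H2 /AndP[H3 H4]]].
exact: (K G (@ext_refl _) t v a).
Qed.

Lemma hered_L_in_L G x : G ⊢ hered_L x -> G ⊢ in_L x.
Proof.
move=> H; apply: (hered_LE H); kenter => t v a _ Hx Hv S; apply: (isL_in_L Hv).
exact: subE S Hx.
Qed.

Lemma hered_L_mem G x y : G ⊢ hered_L x -> G ⊢ y ∈ x -> G ⊢ hered_L y.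
Proof.
move=> H Hy; apply: (hered_LE H); kenter => t v a T Hx Hv S.
exact: hered_LI T (transE T Hx Hy) Hv S.
Qed.

Lemma hered_L_step G x : G ⊢ in_L x ->
  (forall G', ext G G' -> forall y, G' ⊢ y ∈ x -> G' ⊢ hered_L y) -> G ⊢ hered_L x.
Proof.
move=> Hx H; apply: (in_L_isL Hx); kenter => a0 v0 Hv0 Hxv.
(* the variables are f = 0, a = 1, v = 2, t = 3, the set of witnesses = 4, y = 5 *)
kcoll x (Ex_in 0 (Ex_in 1 (Ex_in 2 (Ex_in 3 (transitive_set 3 ∧ 5 ∈ 3 ∧ sub 3 2
   ∧ Ord 1 ∧ is_rec 0 1 ∧ eq_step 2 1 0))))).
  move=> y Hy; apply: (hered_LE (H G (@ext_refl _) y Hy)); kenter => t v a T Hyt /AndP[Ha K] S.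
  kx K f => /AndP[Hf Hv]; kx (upair_ex G t v) s1 => H1; kx (adj_ex G s1 a) s2 => H2.
  kx (adj_ex G s2 f) s => H3; ke s; kei t.
    by apply: (adj1 H3); apply: (adj1 H2); apply: eq_upair1 H1.
  kei v; first by apply: (adj1 H3); apply: (adj1 H2); apply: eq_upair2 H1.
  kei a; first by apply: (adj1 H3); apply: adj2 H2.
  kei f; first exact: adj2 H3.
  by do 5! (kand => //).
(* The index a0 is adjoined so that the bounding stage w contains x as well as the collected
   transitive sets. *)
move=> c Hc; kx (union_ex G c) d => Hd; kx (adj_ex G d a0) d' => Hd'.
apply: (L_bound (c := d')); kenter => b w Hw B.
(* No witness is selected for the individual y: all transitive subsets of w found in d are united,
   and a union of transitive sets is transitive. *)
ksep d (transitive_set 0 ∧ sub 0 w.+1) e He; kx (union_ex G e) t => Ht.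
have He' : forall G', ext G G' -> forall z, G' ⊢ z ∈ e ->
    (G' ⊢ transitive_set z) /\ (G' ⊢ sub z w).
  by kenter => z Hz; have := sep2 He Hz; ksimp => /AndP.
kx (adj_ex G t x) t' => Ht'; apply: (hered_LI _ (adj2 Ht') Hw).
  apply: transI; kenter => y z Hy Hz; apply: (adj1 Ht'); kor (adjE Ht' Hy) => {}Hy.
    kxi (eq_unionE Ht Hy) s => Hs Hys; apply: (eq_unionI Ht Hs).
    exact: (transE (proj1 (He' G (@ext_refl _) s Hs)) Hys Hz).
  krwin (EqS Hy) Hz; kxi (AllinE Hc Hz) s => Hs K; kxi K u => Hu {}K.
  kxi K v => Hv {}K; kxi K a => Ha {}K; kxi K f => Hf.
  move=> /AndP[K1 /AndP[K2 /AndP[K3 /AndP[K4 /AndP[K5 K6]]]]].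
  apply: (eq_unionI Ht _ K2); apply: (sepI He (eq_unionI Hd Hs Hu)); ksimp; kand => //.
  apply: (Sub_trans K3); apply: (B G (@ext_refl _) a); last exact: isLI K4 K5 K6.
  by apply: (adj1 Hd'); apply: eq_unionI Hd Hs Ha.
kai y => Hy; kor (adjE Ht' Hy) => {}Hy.
  kxi (eq_unionE Ht Hy) s => Hs Hys.
  exact: (subE (proj2 (He' G (@ext_refl _) s Hs)) Hys).
krw (EqS Hy); apply: (subE (B G (@ext_refl _) a0 v0 _ Hv0) Hxv); exact: adj2 Hd'.
Qed.

Lemma hered_L_upair G z x y : G ⊢ hered_L x -> G ⊢ hered_L y -> G ⊢ eq_upair z x y ->
  G ⊢ hered_L z.
Proof.
move=> Hx Hy Hz; apply: hered_L_step.
  have Ho : List.In op_upair ops by left.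
  apply: (L_op Ho (hered_L_in_L Hx) (hered_L_in_L Hy)); apply/(eq_valP _ _ _ _ (ops_spec Ho)).
  exact/eq_upairP.
by kenter => u Hu; kor (eq_upairE Hz Hu) => E; krw (EqS E).
Qed.

Lemma hered_L_opair G z x y : G ⊢ hered_L x -> G ⊢ hered_L y -> G ⊢ opair z x y ->
  G ⊢ hered_L z.
Proof.
move=> Hx Hy Hz; kx (upair_ex G x x) s => Hs; kx (upair_ex G x y) t => Ht.
kx (upair_ex G s t) p => Hp.
have Ls := hered_L_upair Hx Hx Hs; have Lt := hered_L_upair Hx Hy Ht.
suff E : G ⊢ p ≡ z by krw E; apply: hered_L_upair Ls Lt Hp.
apply: (opair_fun _ Hz); kand; first by kei s => //; apply: eq_upair1 Hp.
kand; first by kei t => //; apply: eq_upair2 Hp.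
by kai u => Hu; kor (eq_upairE Hp Hu) => E; [apply: prf_OrI1|apply: prf_OrI2]; krw (EqS E).
Qed.

Lemma hered_L_opair1 G z x y : G ⊢ hered_L z -> G ⊢ opair z x y -> G ⊢ hered_L x.
Proof.
move=> Hz Ho; apply: (opair_mem Ho); kenter => s Hs Hx _.
exact: hered_L_mem (hered_L_mem Hz Hs) Hx.
Qed.

Lemma hered_L_opair2 G z x y : G ⊢ hered_L z -> G ⊢ opair z x y -> G ⊢ hered_L y.
Proof.
move=> Hz Ho; apply: (opair_mem Ho); kenter => s Hs _ Hy.
exact: hered_L_mem (hered_L_mem Hz Hs) Hy.
Qed.

Lemma hered_L_otriple G t x y z : G ⊢ hered_L x -> G ⊢ hered_L y -> G ⊢ hered_L z ->
  G ⊢ otriple t x y z -> G ⊢ hered_L t.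
Proof.
move=> Hx Hy Hz Ht; apply: (otripleE Ht); kenter => q Hq {}Ht.
exact: hered_L_opair Hx (hered_L_opair Hy Hz Hq) Ht.
Qed.

(* {v : <z, v> ∈ x} is the union of the singleton F(x, {z}), F being [op_images]. *)
Lemma hered_L_img G u z x : G ⊢ hered_L x -> G ⊢ hered_L z -> G ⊢ eq_img u z x ->
  G ⊢ hered_L u.
Proof.
move=> Hx Hz Hu; kx (upair_ex G z z) s => Hs; have Ls := hered_L_upair Hz Hz Hs.
apply: hered_L_step; last first.
  kenter => v Hv; kxi (eq_img1 Hu Hv) p => Hp Ho.
  exact: hered_L_opair2 (hered_L_mem Hx Hp) Ho.
have Ho : List.In op_images ops by do 6! right; left.
apply: (L_op_ex Ho (hered_L_in_L Hx) (hered_L_in_L Ls)); kenter => w Lw Hw.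
have Ho' : List.In op_bigcup ops by right; right; left.
apply: (L_op Ho' Lw Lw); apply: eq_valI; first exact: ops_spec Ho'.
  kenter => v Hv; kei u => //; apply: (in_eq_val (ops_spec Ho) Hw).
  by kei z => //; apply: eq_upair1 Hs.
kenter => v Hv; kxi Hv u' => Hu' Hv'; have K := eq_val_in (ops_spec Ho) Hw Hu'.
kxi K z' => Hz' K'; krwin (EqS (eq_upair11 Hs Hz')) K'.
by krw (eq_img_fun K' Hu).
Qed.

(** The value itself is in L by closure; only its elements need the case analysis. Each is x, y, an
    element at some depth of x or y, or a pair, triple or image formed from such sets. *)
Lemma hered_L_op G o w x y : List.In o ops -> G ⊢ hered_L x -> G ⊢ hered_L y ->
  G ⊢ eq_val o w x y -> G ⊢ hered_L w.
Proof.
move=> Ho Hx Hy Hw; have So := ops_spec Ho.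
apply: hered_L_step; first exact: L_op Ho (hered_L_in_L Hx) (hered_L_in_L Hy) Hw.
kenter => u /(eq_val_in So Hw) {Hw So}; move: Ho.
case=> [<-|] /=; first by move=> H; kor H => E; krw (EqS E).
case=> [<-|] /=; first by move=> /AndP[H _]; apply: hered_L_mem Hx H.
case=> [<-|] /=; first by move=> H; kxi H v => Hv Hu; apply: hered_L_mem (hered_L_mem Hx Hv) Hu.
case=> [<-|] /=; first by move=> /AndP[H _]; apply: hered_L_mem Hx H.
case=> [<-|] /=.
  move=> H; kxi H a => Ha {}H; kxi H b => Hb.
  exact: hered_L_opair (hered_L_mem Hx Ha) (hered_L_mem Hy Hb).
case=> [<-|] /=; first by move=> /AndP[H _]; apply: hered_L_mem Hx H.
case=> [<-|] /=.
  by move=> H; kxi H z => Hz; apply: hered_L_img Hx (hered_L_mem Hy Hz).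
case=> [<-|] /=.
  by move=> H; kxp H p a b => Hp Ho E; krw E; apply: hered_L_opair1 (hered_L_mem Hx Hp) Ho.
case=> [<-|] /=.
  by move=> H; kxp H p a b => Hp Ho E; krw E; apply: hered_L_opair2 (hered_L_mem Hx Hp) Ho.
case=> [<-|] /=.
  move=> H; kxp H p a b => Hp Ho {}H; have Lp := hered_L_mem Hx Hp; kxi H c => Hc.
  exact: hered_L_otriple (hered_L_opair1 Lp Ho) (hered_L_opair2 Lp Ho) (hered_L_mem Hy Hc).
case=> [<-|] /=.
  move=> H; kxp H p a b => Hp Ho {}H; have Lp := hered_L_mem Hx Hp; kxi H c => Hc.
  exact: hered_L_otriple (hered_L_opair1 Lp Ho) (hered_L_mem Hy Hc) (hered_L_opair2 Lp Ho).
case=> [<-|] /=.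
  move=> H; kxi H b => Hb {}H; kxi H a => Ha /AndP[{}H _]; move: H.
  exact: hered_L_opair (hered_L_mem Hy Hb) (hered_L_mem Hx Ha).
case=> [<-|] //=.
move=> H; kxi H b => Hb {}H; kxi H a => Ha /AndP[{}H _]; move: H.
exact: hered_L_opair (hered_L_mem Hy Hb) (hered_L_mem Hx Ha).
Qed.

(** Induction on a. For b in a, the elements of L_b are covered by hypothesis, L_b itself then by
    [hered_L_step], and one more application of an operation by [hered_L_op]. *)
Lemma isL_hered_L G v a x : G ⊢ isL v a -> G ⊢ x ∈ v -> G ⊢ hered_L x.
Proof.
have H : G ⊢ inst a (All (All (isL 1 2 ⇒ 0 ∈ 1 ⇒ hered_L 0))); last first.
  move: H; ksimp => K Hv Hx; have := AllE v K; ksimp => {}K; have := AllE x K; ksimp => {}K.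
  exact: ImpE (ImpE K Hv) Hx.
apply: set_induction; kenter => {v x}a IH; ksimp; ka v; ka x; ki => Hv; ki => Hx.
apply: (isL_memE Hv Hx); kenter => b w Hb Hw {}Hx.
have := IH G (@ext_refl _) b Hb; ksimp => /(AllE w); ksimp => K.
have IH' : forall G', ext G G' -> forall y, G' ⊢ in_succ y w -> G' ⊢ hered_L y.
  have Kw : forall G', ext G G' -> forall y, G' ⊢ y ∈ w -> G' ⊢ hered_L y.
    by kenter => y Hy; have := AllE y K; ksimp => /ImpE/(_ Hw)/ImpE; apply.
  kenter => y Hy; kor Hy => {}Hy; first exact: Kw.
  by krw (EqS Hy); apply: hered_L_step (isL_L Hw) Kw.
apply: (mem_clE Hx); first by kenter => {}Hx; exact: (IH' G (@ext_refl _)).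
kenter => o y z Ho /(IH' G (@ext_refl _)) Hy /(IH' G (@ext_refl _)) Hz.
exact: hered_L_op Ho Hy Hz.
Qed.

Lemma L_trans G x y : G ⊢ in_L x -> G ⊢ y ∈ x -> G ⊢ in_L y.
Proof.
move=> H Hy; apply: (in_L_isL H); kenter => a v Hv Hx; apply: hered_L_in_L.
exact: hered_L_mem (isL_hered_L Hv Hx) Hy.
Qed.

(** * Separation in L *)

(* "t = <x_0, <x_1, ... <x_{n-1}, e>>>"; the terminator [e] spares a case
   distinction on the last component. *)
Fixpoint Tup (G : seq form) (e t : nat) (xs : seq nat) : Prop :=
  match xs with
  | [::] => G ⊢ t ≡ e
  | x :: xs => exists2 t', G ⊢ opair t x t' & Tup G e t' xs
  end.

Fixpoint Mems (G : seq form) (xs As : seq nat) : Prop :=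
  match xs, As with
  | [::], [::] => True
  | x :: xs, A :: As => (G ⊢ x ∈ A) /\ Mems G xs As
  | _, _ => False
  end.

Fixpoint all_L (G : seq form) (As : seq nat) : Prop :=
  if As is A :: As then (G ⊢ in_L A) /\ all_L G As else True.

(* [D] is a constructible set of tuples, the set of those <x_0, ..., x_{n-1}>
   in the product of [As] that satisfy [p]. *)
Definition codes (G : seq form) (e D : nat) (As : seq nat) (p : form) : Prop :=
  [/\ G ⊢ in_L D,
      forall G', ext G G' -> forall t r, G' ⊢ t ∈ D ->
        (forall G'', ext G' G'' -> forall xs, Tup G'' e t xs -> Mems G'' xs As ->
           G'' ⊢ r) -> G' ⊢ r
    & forall G', ext G G' -> forall t xs, Tup G' e t xs -> Mems G' xs As ->
        (G' ⊢ t ∈ D <-> G' ⊢ ren (nth e xs) p)].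

(** The binary analogue of [codes], with plain pairs and no terminator, as the operations for
    equality and membership produce them. *)
Definition pair_codes (G : seq form) (R A B : nat) (rl : nat -> nat -> form) : Prop :=
  [/\ G ⊢ in_L R,
      forall G', ext G G' -> forall s r, G' ⊢ s ∈ R ->
        (forall G'', ext G' G'' -> forall a b, G'' ⊢ opair s a b -> G'' ⊢ a ∈ A ->
           G'' ⊢ b ∈ B -> G'' ⊢ r) -> G' ⊢ r
    & forall G', ext G G' -> forall s a b, G' ⊢ opair s a b -> G' ⊢ a ∈ A ->
        G' ⊢ b ∈ B -> (G' ⊢ s ∈ R <-> G' ⊢ rl a b)].

Lemma weaken_Tup G G' e t xs : ext G G' -> Tup G e t xs -> Tup G' e t xs.
Proof.
move=> E; elim: xs t => [|x xs IH] t /=; first exact: weaken.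
by case=> t' /(weaken E) H /IH; exists t'.
Qed.
Lemma weaken_Mems G G' xs As : ext G G' -> Mems G xs As -> Mems G' xs As.
Proof. by move=> E; elim: xs As => [|x xs IH] [|A As] //= [/(weaken E) H /IH]. Qed.
Lemma weaken_all_L G G' As : ext G G' -> all_L G As -> all_L G' As.
Proof. by move=> E; elim: As => [|A As IH] //= [/(weaken E) H /IH]. Qed.
Lemma weaken_codes G G' e D As p : ext G G' -> codes G e D As p -> codes G' e D As p.
Proof.
by move=> E [/(weaken E) H1 H2 H3]; split=> // G'' E';
  [apply: H2|apply: H3]; apply: ext_trans E'.
Qed.
Lemma weaken_pair_codes G G' R A B rl : ext G G' ->
  pair_codes G R A B rl -> pair_codes G' R A B rl.
Proof.
by move=> E [/(weaken E) H1 H2 H3]; split=> // G'' E';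
  [apply: H2|apply: H3]; apply: ext_trans E'.
Qed.

Definition vars_L (G : seq form) (rho : nat -> nat) : Prop := forall n, G ⊢ in_L (rho n).

Lemma weaken_vars_L G G' rho : ext G G' -> vars_L G rho -> vars_L G' rho.
Proof. by move=> E H n; apply: weaken (H n). Qed.

Ltac klift E ::=
  match type of E with ext ?G ?G' =>
    repeat match goal with
    | H : prf IKP_minus_Inf G _ |- _ => apply (weaken E) in H
    | H : Tup G _ _ _ |- _ => apply (weaken_Tup E) in H
    | H : Mems G _ _ |- _ => apply (weaken_Mems E) in H
    | H : all_L G _ |- _ => apply (weaken_all_L E) in H
    | H : codes G _ _ _ _ |- _ => apply (weaken_codes E) in H
    | H : vars_L G _ |- _ => apply (weaken_vars_L E) in H
    | H : pair_codes G _ _ _ _ |- _ => apply (weaken_pair_codes E) in H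
    | H : forall G'', ext G G'' -> _ |- _ =>
        let H' := fresh in
        pose proof (fun G0 E0 => H G0 (ext_trans E E0)) as H'; cbv beta in H';
        clear H; rename H' into H
    end; clear E; clear G; rename G' into G
  end.

Lemma codes_L G e D As p : codes G e D As p -> G ⊢ in_L D.
Proof. by case. Qed.
Lemma codesE G e D As p t r : codes G e D As p -> G ⊢ t ∈ D ->
  (forall G', ext G G' -> forall xs, Tup G' e t xs -> Mems G' xs As -> G' ⊢ r) -> G ⊢ r.
Proof. by case=> _ H _; apply: H. Qed.
Lemma codesP G e D As p t xs : codes G e D As p -> Tup G e t xs -> Mems G xs As ->
  (G ⊢ t ∈ D <-> G ⊢ ren (nth e xs) p).
Proof. by case=> _ _ H; apply: H. Qed.
Lemma pair_codesE G R A B rl s r : pair_codes G R A B rl -> G ⊢ s ∈ R ->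
  (forall G', ext G G' -> forall a b, G' ⊢ opair s a b -> G' ⊢ a ∈ A ->
     G' ⊢ b ∈ B -> G' ⊢ r) -> G ⊢ r.
Proof. by case=> _ H _; apply: H. Qed.
Lemma pair_codesP G R A B rl s a b : pair_codes G R A B rl ->
  G ⊢ opair s a b -> G ⊢ a ∈ A -> G ⊢ b ∈ B -> (G ⊢ s ∈ R <-> G ⊢ rl a b).
Proof. by case=> _ _ H; apply: H. Qed.

Lemma Tup_eq G e t t' xs : G ⊢ t ≡ t' -> Tup G e t xs -> Tup G e t' xs.
Proof.
case: xs => [|x xs] /= E; first by move=> H; krw E.
by case=> u H Hu; exists u => //; krw E.
Qed.

Lemma otriple_inj G t a b c x v y w : G ⊢ otriple t a b c -> G ⊢ opair t x v ->
  G ⊢ opair v y w -> [/\ G ⊢ x ≡ a, G ⊢ y ≡ b & G ⊢ w ≡ c].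
Proof.
move=> Ht Hx Hv.
have E : G ⊢ (x ≡ a ∧ y ≡ b ∧ w ≡ c).
  apply: (otripleE Ht); kenter => q Hq {}Ht; have [E1 E2] := opair_inj Hx Ht.
  by ksub E2; have [E3 E4] := opair_inj Hv Hq; kand => //; kand.
by case/AndP: E => E1 /AndP[].
Qed.

Lemma otriple_opair G t a b c q : G ⊢ otriple t a b c -> G ⊢ opair q b c -> G ⊢ opair t a q.
Proof.
move=> Ht Hq; apply: (otripleE Ht); kenter => q' Hq' {}Ht.
by krw (opair_fun Hq' Hq).
Qed.

Lemma op_In n : n < 13 -> List.In (nth op_upair ops n) ops.
Proof. by do 13! (case: n => [_|n]; first by do ?[by left|right]). Qed.

(* Introduces the value [w] of operation number [n] at [x] and [y], with [L] for its
   constructibility and [H] for its equation. The numbers: 0 unordered pair, 1 intersection, 2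
   union, 3 difference, 4 product, 5 implication, 6 images, 7 domain, 8 range, 9 and 10 extension on
   the right and in the middle, 11 equality, 12 membership. *)
Tactic Notation "kop" constr(n) constr(x) constr(y) ident(w) ident(L) ident(H) :=
  apply: (L_op_ex (x := x) (y := y) (@op_In n isT));
  [ | | kenter; cbn [nth ops]; intros w L H].

(** * Coding atomic formulas *)

Lemma prod_codes As G e r : G ⊢ in_L e -> all_L G As ->
  (forall G', ext G G' -> forall D, codes G' e D As (¬ Bot) -> G' ⊢ r) -> G ⊢ r.
Proof.
have T G' : G' ⊢ ¬ Bot by apply: prf_ImpI; apply: prf_Hyp; left.
elim: As G r => [|A As IH] G r Le /=.
  move=> _ H; kop 0 e e D LD HD => //; apply: (H G (@ext_refl _) D); split=> //.
    kenter => t r' Ht K; apply: (K G (@ext_refl _) [::]) => //=.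
    by have H1 := eq_val_in upair_spec HD Ht; kor H1.
  move=> G' E t [|? ?] //= Ht _; split=> // _; have {}HD := weaken E HD.
  by apply: (in_eq_val upair_spec HD) => /=; apply: prf_OrI1.
case=> LA LAs H; apply: (IH _ r Le LAs); kenter => P HP; kop 4 A P D LD HD => //.
  exact: codes_L HP.
apply: (H G (@ext_refl _) D); split=> //.
  kenter => t r' Ht K; have H1 := eq_val_in prod_spec HD Ht.
  kxi H1 x => Hx {}H1; kxi H1 t' => Ht' Ho; apply: (codesE HP Ht'); kenter => xs Hxs Mxs.
  by apply: (K G (@ext_refl _) (x :: xs)) => //=; exists t'.
move=> G' E t [|x xs] //= [t' Ho Ht'] [Hx Mxs]; split=> // _; klift E.
apply: (in_eq_val prod_spec HD) => /=; kei x => //; kei t' => //.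
exact/(codesP HP Ht' Mxs).
Qed.

Lemma eq_rel_codes G A B r : G ⊢ in_L A -> G ⊢ in_L B ->
  (forall G', ext G G' -> forall R, pair_codes G' R A B Defs.Eq -> G' ⊢ r) -> G ⊢ r.
Proof.
(* The operation forms pairs in y × x, hence the reversed arguments. *)
move=> LA LB H; kop 11 B A R LR HR => //; apply: (H G (@ext_refl _) R); split=> //.
  kenter => s r' Hs K; have H1 := eq_val_in eq_rel_spec HR Hs.
  kxi H1 a => Ha {}H1; kxi H1 b => Hb /AndP[Ho _].
  exact: (K G (@ext_refl _) a b).
kenter => s a b Ho Ha Hb; split=> [Hs|E].
  have H1 := eq_val_in eq_rel_spec HR Hs; kxi H1 a' => Ha' {}H1; kxi H1 b' => Hb' /AndP[Ho' E].
  by have [E1 E2] := opair_inj Ho Ho'; krw (EqS E1); krw (EqS E2); apply: EqS.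
apply: (in_eq_val eq_rel_spec HR) => /=; kei a => //; kei b => //; kand => //.
exact: EqS.
Qed.

Lemma mem_rel_codes G A B r : G ⊢ in_L A -> G ⊢ in_L B ->
  (forall G', ext G G' -> forall R, pair_codes G' R A B (fun a b => b ∈ a) -> G' ⊢ r) ->
  G ⊢ r.
Proof.
move=> LA LB H; kop 12 B A R LR HR => //; apply: (H G (@ext_refl _) R); split=> //.
  kenter => s r' Hs K; have H1 := eq_val_in mem_rel_spec HR Hs.
  kxi H1 a => Ha {}H1; kxi H1 b => Hb /AndP[Ho _].
  exact: (K G (@ext_refl _) a b).
kenter => s a b Ho Ha Hb; split=> [Hs|E].
  have H1 := eq_val_in mem_rel_spec HR Hs; kxi H1 a' => Ha' {}H1; kxi H1 b' => Hb' /AndP[Ho' E].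
  by have [E1 E2] := opair_inj Ho Ho'; krw (EqS E1); krw (EqS E2).
by apply: (in_eq_val mem_rel_spec HR) => /=; kei a => //; kei b => //; kand.
Qed.

(* With S = {<b, a> : a ∈ b}, the set {<a, b'> : a ∈ b'} is the range of
   {<b, a, b'> : <b, a> ∈ S} ∩ {<b, a, b'> : b = b'}. *)
Lemma mem_codes G A B r : G ⊢ in_L A -> G ⊢ in_L B ->
  (forall G', ext G G' -> forall R, pair_codes G' R A B Defs.Mem -> G' ⊢ r) -> G ⊢ r.
Proof.
move=> LA LB H.
apply: (mem_rel_codes LB LA); kenter => S HS; have [LS _ _] := HS.
apply: (eq_rel_codes LB LB); kenter => Q HQ; have [LQ _ _] := HQ.
kop 9 S B X LX HX => //; kop 10 Q A Y LY HY => //.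
kop 0 Y Y W LW HW => //; kop 1 X W Z LZ HZ => //; kop 8 Z Z R LR HR => //.
have {HZ} HZ : forall G', ext G G' -> forall z, G' ⊢ z ∈ Z <-> (G' ⊢ z ∈ X) /\ (G' ⊢ z ∈ Y).
  kenter => z; split.
    move=> /(eq_val_in bigcap_spec HZ) /AndP[Hz K]; split=> //.
    apply: (AllinE K (x := Y)); apply: (in_eq_val upair_spec HW) => /=.
    by apply: prf_OrI1; apply: prf_EqI.
  case=> Hx Hy; apply: (in_eq_val bigcap_spec HZ) => /=; kand => //.
  kai v => Hv; have H1 := eq_val_in upair_spec HW Hv.
  by kor H1 => E; krw (EqS E).
have P : forall G', ext G G' -> forall s r, G' ⊢ s ∈ R ->
    (forall G'', ext G' G'' -> forall a b, G'' ⊢ opair s a b -> G'' ⊢ a ∈ A ->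
     G'' ⊢ b ∈ B -> G'' ⊢ a ∈ b -> G'' ⊢ r) -> G' ⊢ r.
  kenter => s r' Hs K; have H1 := eq_val_in ran_spec HR Hs; kxp H1 z b s' => Hz Ho E.
  ksub (EqS E); have [Hx Hy] := proj1 (HZ G (@ext_refl _) z) Hz.
  have H2 := eq_val_in ext_right_spec HX Hx; kxp H2 p b1 a1 => Hp Hop {}H2.
  kxi H2 b2 => Hb2 T2; have H3 := eq_val_in ext_mid_spec HY Hy.
  kxp H3 q b3 b4 => Hq Hoq {}H3; kxi H3 a3 => Ha3 T3.
  kx (opair_ex G a1 b2) s1 => Hs1; have Ho1 := otriple_opair T2 Hs1.
  have [E1 E2] := opair_inj Ho Ho1; ksub E2.
  have [E3 E4 E5] := otriple_inj T3 Ho1 Hs1.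
  apply: (pair_codesE HS Hp); kenter => b' a' Ho' Hb' Ha'; have [E6 E7] := opair_inj Ho' Hop.
  ksub E6; ksub E7; have M := proj1 (pair_codesP HS Ho' Hb' Ha') Hp.
  apply: (pair_codesE HQ Hq); kenter => c c' Hoc Hc Hc'; have [E8 E9] := opair_inj Hoc Hoq.
  ksub E8; ksub E9; have N := proj1 (pair_codesP HQ Hoc Hc Hc') Hq.
  apply: (K G (@ext_refl _) a' b2) => //.
  by krw (EqS E5); krw N; krw E3.
apply: (H G (@ext_refl _) R); split=> //.
  kenter => s r' Hs K; apply: (P G (@ext_refl _) s _ Hs); kenter => a b Ho Ha Hb _.
  exact: (K G (@ext_refl _) a b).
kenter => s a b Ho Ha Hb; split=> [Hs|M].
  apply: (P G (@ext_refl _) s _ Hs); kenter => a' b' Ho' _ _ M.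
  by have [E1 E2] := opair_inj Ho Ho'; krw (EqS E1); krw (EqS E2).
kx (opair_ex G b s) z => Hz; apply: (in_eq_val ran_spec HR) => /=.
suff Hz' : G ⊢ z ∈ Z by kep Hz' Hz; apply: prf_EqI.
apply/HZ => //; split.
  kx (opair_ex G b a) p => Hp; have Hp' := proj2 (pair_codesP HS Hp Hb Ha) M.
  apply: (in_eq_val ext_right_spec HX) => /=; kep Hp' Hp; kei b => //.
  exact: otripleI Ho Hz.
kx (opair_ex G b b) p => Hp; have Hp' := proj2 (pair_codesP HQ Hp Hb Hb) (prf_EqI _ _ _).
apply: (in_eq_val ext_mid_spec HY) => /=; kep Hp' Hp; kei a => //.
exact: otripleI Ho Hz.
Qed.

Definition codable (rl : nat -> nat -> form) : Prop :=
  forall G A B r, G ⊢ in_L A -> G ⊢ in_L B ->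
  (forall G', ext G G' -> forall R, pair_codes G' R A B rl -> G' ⊢ r) -> G ⊢ r.

(** Relates the first component to a later one. If that is the second, operation 9 appends the free
    components as a tail; otherwise operation 10 inserts one free component after the first, and the
    induction continues. *)
Lemma rel_codes rl Bs j : codable rl -> (forall r x y, ren r (rl x y) = rl (r x) (r y)) ->
  j < size Bs -> forall G e A r, G ⊢ in_L e -> G ⊢ in_L A -> all_L G Bs ->
  (forall G', ext G G' -> forall D, codes G' e D (A :: Bs) (rl 0 j.+1) -> G' ⊢ r) ->
  G ⊢ r.
Proof.
move=> Hrl Rrl; elim: Bs j => [|B Bs IH] [|j] //= Hj G e A r Le LA [LB LBs] H.
  apply: (Hrl _ _ _ _ LA LB); kenter => R HR; have [LR _ _] := HR.
  apply: (prod_codes Le LBs); kenter => P HP.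
  kop 9 R P D LD HD => //; first exact: codes_L HP.
  apply: (H G (@ext_refl _) D); split=> //.
    kenter => s r' Hs K; have H1 := eq_val_in ext_right_spec HD Hs; kxp H1 q a b => Hq Ho {}H1.
    kxi H1 c => Hc T; apply: (codesE HP Hc); kenter => cs Tc Mc.
    apply: (pair_codesE HR Hq); kenter => a' b' Ho' Ha Hb; have [E1 E2] := opair_inj Ho' Ho.
    ksub (EqS E1); ksub (EqS E2); apply: (otripleE T); kenter => v Hv Hs'.
    by apply: (K G (@ext_refl _) (a :: b :: cs)) => //=; exists v => //; exists c.
  kenter => s [|x [|y ys]] //=; first by move=> _ [_ []].
  move=> [v Hs [c Hv Tc]] [Hx [Hy Mc]]; rewrite Rrl /=; split=> [K|K].
    have H1 := eq_val_in ext_right_spec HD K; kxp H1 q a b => Hq Ho {}H1.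
    kxi H1 c' => Hc' T; have [E1 E2 E3] := otriple_inj T Hs Hv.
    ksub E1; ksub E2; exact: (proj1 (pair_codesP HR Ho Hx Hy) Hq).
  kx (opair_ex G x y) q => Hq; have Hq' := proj2 (pair_codesP HR Hq Hx Hy) K.
  apply: (in_eq_val ext_right_spec HD) => /=; kep Hq' Hq; kei c; last exact: otripleI Hv Hs.
  by apply/(codesP HP Tc Mc); apply: prf_ImpI; apply: prf_Hyp; left.
apply: (IH j Hj _ _ _ _ Le LA LBs); kenter => Y HY.
kop 10 Y B D LD HD => //; first exact: codes_L HY.
apply: (H G (@ext_refl _) D); split=> //.
  kenter => s r' Hs K; have H1 := eq_val_in ext_mid_spec HD Hs; kxp H1 q a b => Hq Ho {}H1.
  kxi H1 c => Hc T; apply: (codesE HY Hq); kenter => -[|a' bs] //= [b' Ho' Tb] [Ha Mb].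
  have [E1 E2] := opair_inj Ho' Ho; ksub (EqS E1); have {}Tb := Tup_eq E2 Tb.
  apply: (otripleE T); kenter => v Hv Hs'.
  by apply: (K G (@ext_refl _) (a :: c :: bs)) => //=; exists v => //; exists b.
kenter => s [|x [|y ys]] //=; first by move=> _ [_ []].
move=> [v Hs [w Hv Tw]] [Hx [Hy Mw]].
have M : Mems G (x :: ys) (A :: Bs) by [].
have {}Rrl : ren (nth e [:: x, y & ys]) (rl 0 j.+2) = ren (nth e (x :: ys)) (rl 0 j.+1).
  by rewrite !Rrl.
rewrite {}Rrl; split=> [K|K].
  have H1 := eq_val_in ext_mid_spec HD K; kxp H1 q a b => Hq Ho {}H1.
  kxi H1 c' => Hc' T; have [E1 E2 E3] := otriple_inj T Hs Hv.
  have T' : Tup G e q (x :: ys) by exists w => //; krw (EqS E1); krw (EqS E3).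
  exact: (proj1 (codesP HY T' M) Hq).
kx (opair_ex G x w) q => Hq; have T' : Tup G e q (x :: ys) by exists w.
have Hq' := proj2 (codesP HY T' M) K.
apply: (in_eq_val ext_mid_spec HD) => /=; kep Hq' Hq; kei y => //.
exact: otripleI Hv Hs.
Qed.

Lemma codes_equiv G e D As p q :
  (forall G', ext G G' -> forall xs, Mems G' xs As ->
     (G' ⊢ ren (nth e xs) p <-> G' ⊢ ren (nth e xs) q)) ->
  codes G e D As p -> codes G e D As q.
Proof.
move=> H [H1 H2 H3]; split=> // G' E t xs Ht Hxs.
by rewrite -(H G' E xs Hxs); apply: H3.
Qed.

Lemma bot_codes G e As r : G ⊢ in_L e ->
  (forall G', ext G G' -> forall D, codes G' e D As Bot -> G' ⊢ r) -> G ⊢ r.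
Proof.
move=> Le H; kop 3 e e D LD HD => //; apply: (H G (@ext_refl _) D).
have N : forall G', ext G G' -> forall t, G' ⊢ t ∈ D -> G' ⊢ Bot.
  by kenter => t /(eq_val_in diff_spec HD) /AndP[Ht /ImpE]; apply.
split=> //; first by kenter => t r' /(N G (@ext_refl _)) /prf_BotE.
by kenter => t xs _ _; split=> [/(N G (@ext_refl _))|] //=; apply: prf_BotE.
Qed.

Lemma not_self_mem G x : G ⊢ x ∈ x -> G ⊢ Bot.
Proof.
move=> Hx; have H : G ⊢ inst x (0 ∈ 0 ⇒ Bot); last by move: H; ksimp => /ImpE; apply.
apply: set_induction; kenter => y IH; ksimp; ki => Hy.
by have := IH G (@ext_refl _) y Hy; ksimp => /ImpE; apply.
Qed.

(** Leading components are multiplied on until one of the two indices is 0. If only the second is 0,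
    the converse relation is what [rel_codes] needs; if both are, [Diag] applies. *)
Lemma atom_codes rl : codable rl -> codable (fun a b => rl b a) ->
  (forall r x y, ren r (rl x y) = rl (r x) (r y)) ->
  (forall As G e r, G ⊢ in_L e -> all_L G As ->
    (forall G', ext G G' -> forall D, codes G' e D As (rl 0 0) -> G' ⊢ r) -> G ⊢ r) ->
  forall i j As, i < size As -> j < size As -> forall G e r, G ⊢ in_L e -> all_L G As ->
    (forall G', ext G G' -> forall D, codes G' e D As (rl i j) -> G' ⊢ r) -> G ⊢ r.
Proof.
move=> C1 C2 R Diag i j As; elim: As i j => // A As IH [|i] [|j] /= Hi Hj G e r Le.
- by move=> LAs; apply: (Diag (A :: As)).
- by case=> LA LAs H; apply: (rel_codes C1 R Hj Le LA LAs).
- by case=> LA LAs H; apply: (rel_codes C2 (fun r x y => R r y x) Hi Le LA LAs).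
case=> LA LAs H; apply: (IH i j Hi Hj _ _ _ Le LAs); kenter => P HP.
kop 4 A P D LD HD => //; first exact: codes_L HP.
apply: (H G (@ext_refl _) D); split=> //.
  kenter => t r' Ht K; have H1 := eq_val_in prod_spec HD Ht.
  kxi H1 x => Hx {}H1; kxi H1 t' => Ht' Ho; apply: (codesE HP Ht'); kenter => xs Hxs Mxs.
  by apply: (K G (@ext_refl _) (x :: xs)) => //=; exists t'.
kenter => t [|x xs] //= [t' Ho Ht'] [Hx Mxs].
have {}R : ren (nth e (x :: xs)) (rl i.+1 j.+1) = ren (nth e xs) (rl i j) by rewrite !R.
rewrite {}R; split=> [K|K].
  have H1 := eq_val_in prod_spec HD K; kxi H1 x1 => Hx1 {}H1; kxi H1 t1 => Ht1 Ho1.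
  have [E1 E2] := opair_inj Ho1 Ho; krwin (EqS E2) Ht1.
  exact: (proj1 (codesP HP Ht' Mxs) Ht1).
apply: (in_eq_val prod_spec HD) => /=; kei x => //; kei t' => //.
exact: (proj2 (codesP HP Ht' Mxs) K).
Qed.

(** * Coding connectives and bounded quantifiers *)

Lemma ren_nth_cons e u xs p :
  ren (nth e (u :: xs)) p = inst u (ren (up (nth e xs)) p).
Proof. by rewrite /inst ren_comp; apply: ren_ext => -[|n]. Qed.

Lemma nth_Mems G e xs As i : Mems G xs As -> i < size As -> G ⊢ nth e xs i ∈ nth e As i.
Proof. by elim: xs As i => [|x xs IH] [|A As] [|i] //= []; auto. Qed.
Lemma nth_all_L G e As i : all_L G As -> i < size As -> G ⊢ in_L (nth e As i).
Proof. by elim: As i => [|A As IH] [|i] //= []; auto. Qed.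

Lemma and_codes G e P Q As p q r : codes G e P As p -> codes G e Q As q ->
  (forall G', ext G G' -> forall D, codes G' e D As (p ∧ q) -> G' ⊢ r) -> G ⊢ r.
Proof.
(* P ∩ Q is obtained as P ∩ ⋂{Q}. *)
move=> HP HQ H; kop 0 Q Q W LW HW; [exact: codes_L HQ..|].
kop 1 P W D LD HD => //; first exact: codes_L HP.
apply: (H G (@ext_refl _) D); split=> //.
  kenter => t r' /(eq_val_in bigcap_spec HD) /AndP[Ht _] K; exact: codesE HP Ht K.
kenter => t xs Ht Hxs /=; have EP := codesP HP Ht Hxs; have EQ := codesP HQ Ht Hxs.
split=> [/(eq_val_in bigcap_spec HD) /AndP[K1 K2]|/AndP[/EP K1 /EQ K2]].
  kand; first exact/EP.
  apply/EQ; apply: (AllinE K2 (x := Q)); apply: (in_eq_val upair_spec HW) => /=.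
  by apply: prf_OrI1; apply: prf_EqI.
apply: (in_eq_val bigcap_spec HD) => {EP EQ} /=; kand => //; kai v => Hv.
by have H1 := eq_val_in upair_spec HW Hv; kor H1 => E; krw (EqS E).
Qed.

Lemma or_codes G e P Q As p q r : codes G e P As p -> codes G e Q As q ->
  (forall G', ext G G' -> forall D, codes G' e D As (p ∨ q) -> G' ⊢ r) -> G ⊢ r.
Proof.
move=> HP HQ H; kop 0 P Q W LW HW; [exact: codes_L HP|exact: codes_L HQ|].
kop 2 W W D LD HD => //.
have S : forall G', ext G G' -> forall t, G' ⊢ t ∈ D <-> G' ⊢ t ∈ P ∨ t ∈ Q.
  kenter => t; split=> [/(eq_val_in bigcup_spec HD) H1|H1].
    kxi H1 u => Hu Htu; have H2 := eq_val_in upair_spec HW Hu.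
    by kor H2 => E; krwin (EqS E) Htu; [apply: prf_OrI1|apply: prf_OrI2].
  apply: (in_eq_val bigcup_spec HD) => /=; kor H1 => H2; [kei P => //|kei Q => //].
    by apply: (in_eq_val upair_spec HW); apply: prf_OrI1; apply: prf_EqI.
  by apply: (in_eq_val upair_spec HW); apply: prf_OrI2; apply: prf_EqI.
apply: (H G (@ext_refl _) D); split=> //.
  kenter => t r' /(S G (@ext_refl _)) Ht K.
  by kor Ht => {}Ht; [apply: codesE HP Ht K|apply: codesE HQ Ht K].
kenter => t xs Ht Hxs /=; rewrite (S G (@ext_refl _)).
have EP : forall G', ext G G' -> G' ⊢ t ∈ P <-> G' ⊢ ren (nth e xs) p.
  by kenter; apply: codesP HP Ht Hxs.
have EQ : forall G', ext G G' -> G' ⊢ t ∈ Q <-> G' ⊢ ren (nth e xs) q.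
  by kenter; apply: codesP HQ Ht Hxs.
split=> K; apply: (OrE K) => G' E.
- by move=> /(EP _ E); apply: prf_OrI1.
- by move=> /(EQ _ E); apply: prf_OrI2.
- by move=> /(EP _ E); apply: prf_OrI1.
- by move=> /(EQ _ E); apply: prf_OrI2.
Qed.

(** Complements do not express implication intuitionistically, so there is an operation for it. It
    reads P and Q off the Kuratowski pair Y = {{P}, {P, Q}} and selects within the full product
    X. *)
Lemma imp_codes G e P Q As p q r : G ⊢ in_L e -> all_L G As ->
  codes G e P As p -> codes G e Q As q ->
  (forall G', ext G G' -> forall D, codes G' e D As (p ⇒ q) -> G' ⊢ r) -> G ⊢ r.
Proof.
move=> Le LAs HP HQ H; apply: (prod_codes Le LAs); kenter => X HX.
have LP := codes_L HP; have LQ := codes_L HQ; have LX := codes_L HX.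
kop 0 P P S LS HS => //; kop 0 P Q T LT HT => //; kop 0 S T Y LY HY => //.
kop 5 X Y D LD HD => //.
have HY' : G ⊢ opair Y P Q.
  have U G' a b c : G' ⊢ eq_val op_upair a b c -> G' ⊢ eq_upair a b c.
    by move/(eq_valP _ _ _ _ upair_spec)/eq_upairP.
  move/U: HS => HS; move/U: HT => HT; move/U: HY => HY.
  kand; first by kei S => //; apply: eq_upair1 HY.
  kand; first by kei T => //; apply: eq_upair2 HY.
  by kai u => Hu; kor (eq_upairE HY Hu) => E; [apply: prf_OrI1|apply: prf_OrI2]; krw (EqS E).
apply: (H G (@ext_refl _) D); split=> //.
  kenter => t r' /(eq_val_in imp_spec HD) /AndP[Ht _] K; exact: codesE HX Ht K.
kenter => t xs Ht Hxs /=.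
have EP : forall G', ext G G' -> G' ⊢ t ∈ P <-> G' ⊢ ren (nth e xs) p.
  by kenter; apply: codesP HP Ht Hxs.
have EQ : forall G', ext G G' -> G' ⊢ t ∈ Q <-> G' ⊢ ren (nth e xs) q.
  by kenter; apply: codesP HQ Ht Hxs.
split=> [/(eq_val_in imp_spec HD) /AndP[_ K]|K].
  have K' : G ⊢ t ∈ P ⇒ t ∈ Q.
    kxi K s => Hs {}K; kxi K a => Ha {}K; kxi K b => Hb /AndP[Ho K'].
    by have [E1 E2] := opair_inj Ho HY'; krwin (EqS E1) K'; krwin (EqS E2) K'.
  by apply: ImpI => G' E /(EP _ E) /(ImpE (weaken E K')) /(EQ _ E).
have K' : G ⊢ t ∈ P ⇒ t ∈ Q.
  by apply: ImpI => G' E /(EP _ E) /(ImpE (weaken E K)) /(EQ _ E).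
apply: (in_eq_val imp_spec HD) => /=; kand.
  by apply/(codesP HX Ht Hxs) => /=; apply: prf_ImpI; apply: prf_Hyp; left.
by apply: (opair_mem HY'); kenter => s Hs HP' HQ'; kei s => //; kei P => //; kei Q => //; kand.
Qed.

(** On the diagonal, x ∈ x is refutable by set induction, so the empty set codes it. *)
Lemma mem_atom_codes i j As G e r : i < size As -> j < size As -> G ⊢ in_L e -> all_L G As ->
  (forall G', ext G G' -> forall D, codes G' e D As (i ∈ j) -> G' ⊢ r) -> G ⊢ r.
Proof.
move=> Hi Hj; apply: (atom_codes (rl := Defs.Mem)) => //.
- by move=> ? ? ? ?; apply: mem_codes.
- by move=> ? ? ? ?; apply: mem_rel_codes.
move=> {Hi Hj i j G e r}Bs G e r Le LBs H; apply: (bot_codes (As := Bs) Le); kenter => D HD.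
apply: (H G (@ext_refl _) D); apply: codes_equiv HD; kenter => xs _ /=.
by split=> [/prf_BotE|/not_self_mem]; apply.
Qed.

Lemma eq_atom_codes i j As G e r : i < size As -> j < size As -> G ⊢ in_L e -> all_L G As ->
  (forall G', ext G G' -> forall D, codes G' e D As (i ≡ j) -> G' ⊢ r) -> G ⊢ r.
Proof.
move=> Hi Hj; apply: (atom_codes (rl := Defs.Eq)) => //.
- by move=> ? ? ? ?; apply: eq_rel_codes.
- move=> G' A B r' LA LB H; apply: (eq_rel_codes LA LB); kenter => R [H1 H2 H3].
  apply: (H G' (@ext_refl _) R); split=> //; kenter => s a b Ho Ha Hb.
  have [K1 K2] := H3 G' (@ext_refl _) s a b Ho Ha Hb.
  by split=> [/K1/EqS|/EqS/K2].
move=> {Hi Hj i j G e r}Bs G e r Le LBs H; apply: (prod_codes Le LBs); kenter => D HD.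
apply: (H G (@ext_refl _) D); apply: codes_equiv HD; kenter => xs _ /=.
by split=> _; [apply: prf_EqI|apply: prf_ImpI; apply: prf_Hyp; left].
Qed.

(** A universal quantifier is the intersection of the fibres {t : <u, t> ∈ E} over u in U, and the
    operation of images yields the set of these fibres. Intersecting inside the full product X is
    right even when U is empty. *)
Lemma all_in_codes G e As y p U E r : G ⊢ in_L e -> all_L G As -> y < size As ->
  G ⊢ in_L U ->
  (forall G', ext G G' -> forall a u, G' ⊢ a ∈ nth e As y -> G' ⊢ u ∈ a -> G' ⊢ u ∈ U) ->
  codes G e E (U :: As) (0 ∈ y.+1 ⇒ p) ->
  (forall G', ext G G' -> forall D, codes G' e D As (All_in y p) -> G' ⊢ r) -> G ⊢ r.
Proof.
move=> Le LAs Hy LU HU HE H; apply: (prod_codes Le LAs); kenter => X HX.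
kop 6 E U I LI HI => //; first exact: codes_L HE.
kop 1 X I D LD HD => //; first exact: codes_L HX.
apply: (H G (@ext_refl _) D); split=> //.
  kenter => t r' /(eq_val_in bigcap_spec HD) /AndP[Ht _] K; exact: codesE HX Ht K.
kenter => t xs Ht Hxs; rewrite ren_All_in.
have HE' : forall G', ext G G' -> forall s u, G' ⊢ opair s u t -> G' ⊢ u ∈ U ->
    (G' ⊢ s ∈ E <-> G' ⊢ u ∈ nth e xs y ⇒ inst u (ren (up (nth e xs)) p)).
  kenter => s u Ho Hu; rewrite -ren_nth_cons.
  by apply: (codesP HE (xs := u :: xs)) => //=; exists t.
split=> [/(eq_val_in bigcap_spec HD) /AndP[_ K]|K].
  apply: AllinI; kenter => u Hu; have HuU := HU G (@ext_refl _) _ _ (nth_Mems e Hxs Hy) Hu.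
  kx (img_ex G u E) v => Hv; have Htv : G ⊢ t ∈ v.
    by apply: (AllinE K (x := v)); apply: (in_eq_val images_spec HI) => /=; kei u.
  kxi (eq_img1 Hv Htv) s => Hs Ho.
  exact: (ImpE (proj1 (HE' G (@ext_refl _) _ _ Ho HuU) Hs) Hu).
apply: (in_eq_val bigcap_spec HD) => /=; kand.
  by apply/(codesP HX Ht Hxs) => /=; apply: prf_ImpI; apply: prf_Hyp; left.
kai v => Hv; have H1 := eq_val_in images_spec HI Hv; kxi H1 u => Hu Huv.
kx (opair_ex G u t) s => Hs; apply: (eq_img2 Huv _ Hs); apply/(HE' G (@ext_refl _) _ _ Hs Hu).
by apply: ImpI; kenter => Hu'; exact: (AllinE K Hu').
Qed.

(** An existential quantifier projects away the first component, which stands for index 0: the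
    result is the range of E. *)
Lemma ex_in_codes G e As y p U E r : G ⊢ in_L e -> all_L G As -> y < size As ->
  G ⊢ in_L U ->
  (forall G', ext G G' -> forall a u, G' ⊢ a ∈ nth e As y -> G' ⊢ u ∈ a -> G' ⊢ u ∈ U) ->
  codes G e E (U :: As) (0 ∈ y.+1 ∧ p) ->
  (forall G', ext G G' -> forall D, codes G' e D As (Ex_in y p) -> G' ⊢ r) -> G ⊢ r.
Proof.
move=> Le LAs Hy LU HU HE H; kop 8 E E D LD HD; [exact: codes_L HE..|].
apply: (H G (@ext_refl _) D); split=> //.
  kenter => t r' Ht K; have H1 := eq_val_in ran_spec HD Ht; kxp H1 s u t' => Hs Ho E1.
  apply: (codesE HE Hs); kenter => -[|u' xs] //= [t1 Ho1 Ht1] [_ Mxs].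
  apply: (K G (@ext_refl _) xs) => //; apply: Tup_eq Ht1.
  by have [_ E2] := opair_inj Ho1 Ho; krw E1.
kenter => t xs Ht Hxs; rewrite ren_Ex_in.
have HE' : forall G', ext G G' -> forall s u, G' ⊢ opair s u t -> G' ⊢ u ∈ U ->
    (G' ⊢ s ∈ E <-> G' ⊢ u ∈ nth e xs y ∧ inst u (ren (up (nth e xs)) p)).
  kenter => s u Ho Hu; rewrite -ren_nth_cons.
  by apply: (codesP HE (xs := u :: xs)) => //=; exists t.
split=> [K|K].
  have H1 := eq_val_in ran_spec HD K; kxp H1 s u t' => Hs Ho E1; krwin (EqS E1) Ho.
  apply: (codesE HE Hs); kenter => -[|u' ys] //= [t1 Ho1 Ht1] [Hu' _].
  have [E2 _] := opair_inj Ho1 Ho; krwin (EqS E2) Hu'.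
  have [Ku Kp] := AndP (proj1 (HE' G (@ext_refl _) _ _ Ho Hu') Hs).
  exact: ExinI Ku Kp.
apply: (ExinE K); kenter => u Hu Ku; have HuU := HU G (@ext_refl _) _ _ (nth_Mems e Hxs Hy) Hu.
kx (opair_ex G u t) s => Hs; apply: (in_eq_val ran_spec HD) => /=.
suff HsE : G ⊢ s ∈ E by kep HsE Hs; apply: prf_EqI.
by apply/(HE' G (@ext_refl _) _ _ Hs HuU); apply: prf_AndI.
Qed.

Lemma Sigma0_codes p : Sigma0 p -> forall As, fv p <= size As ->
  forall G e r, G ⊢ in_L e -> all_L G As ->
  (forall G', ext G G' -> forall D, codes G' e D As p -> G' ⊢ r) -> G ⊢ r.
Proof.
elim=> {p} [i j|i j||p q _ IHp _ IHq|p q _ IHp _ IHq|p q _ IHp _ IHq|y p _ IHp|y p _ IHp] As H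
  G e r Le LAs K; move: H; rewrite ?geq_max.
- by case/andP=> Hi Hj; apply: mem_atom_codes K.
- by case/andP=> Hi Hj; apply: eq_atom_codes K.
- by move=> _; apply: bot_codes Le K.
- rewrite /= ?geq_max => /andP[Hp Hq]; apply: (IHp As Hp _ _ _ Le LAs); kenter => P HP.
  by apply: (IHq As Hq _ _ _ Le LAs); kenter => Q HQ; apply: and_codes HP HQ K.
- rewrite /= ?geq_max => /andP[Hp Hq]; apply: (IHp As Hp _ _ _ Le LAs); kenter => P HP.
  by apply: (IHq As Hq _ _ _ Le LAs); kenter => Q HQ; apply: or_codes HP HQ K.
- rewrite /= ?geq_max => /andP[Hp Hq]; apply: (IHp As Hp _ _ _ Le LAs); kenter => P HP.
  by apply: (IHq As Hq _ _ _ Le LAs); kenter => Q HQ; apply: imp_codes Le LAs HP HQ K.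
- rewrite /= -ltnS => /(leq_trans (leqSpred _)); rewrite !geq_max => /andP[/andP[_ Hy] Hp].
  (* The component numbered y lies in [nth e As y], so the union of that set bounds the quantifier
     for all tuples at once. *)
  kop 2 (nth e As y) e U LU HU => //; first exact: nth_all_L.
  have LUs : all_L G (U :: As) by [].
  apply: (IHp (U :: As) Hp _ _ _ Le LUs); kenter => P HP.
  apply: (mem_atom_codes (i := 0) (j := y.+1) (As := U :: As) _ _ Le LUs) => //.
  kenter => Q HQ; apply: (imp_codes Le LUs HQ HP); kenter => E HE.
  apply: (all_in_codes Le LAs Hy LU _ HE K); kenter => a u Ha Hu.
  by apply: (in_eq_val bigcup_spec HU) => /=; kei a.
- rewrite /= -ltnS => /(leq_trans (leqSpred _)); rewrite !geq_max => /andP[/andP[_ Hy] Hp].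
  kop 2 (nth e As y) e U LU HU => //; first exact: nth_all_L.
  have LUs : all_L G (U :: As) by [].
  apply: (IHp (U :: As) Hp _ _ _ Le LUs); kenter => P HP.
  apply: (mem_atom_codes (i := 0) (j := y.+1) (As := U :: As) _ _ Le LUs) => //.
  kenter => Q HQ; apply: (and_codes HQ HP); kenter => E HE.
  apply: (ex_in_codes Le LAs Hy LU _ HE K); kenter => a u Ha Hu.
  by apply: (in_eq_val bigcup_spec HU) => /=; kei a.
Qed.

(** * From codes to separation *)

Lemma Tup_ex G e xs r :
  (forall G', ext G G' -> forall t, Tup G' e t xs -> G' ⊢ r) -> G ⊢ r.
Proof.
elim: xs G r => [|x xs IH] G r K; first by apply: (K G (@ext_refl _) e); apply: prf_EqI.
apply: (IH G); kenter => t Ht; kx (opair_ex G x t) s => Hs.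
by apply: (K G (@ext_refl _) s) => /=; exists t.
Qed.

(** Parameters enter the product as singletons, so that every coded tuple carries exactly the
    prescribed parameters. *)
Lemma L_singletons G cs r : all_L G cs ->
  (forall G', ext G G' -> forall Cs, all_L G' Cs -> size Cs = size cs -> Mems G' cs Cs ->
     (forall G'', ext G' G'' -> forall e t xs, Tup G'' e t xs -> Mems G'' xs Cs ->
        Tup G'' e t cs) -> G' ⊢ r) -> G ⊢ r.
Proof.
elim: cs G r => [|c cs IH] G r /=.
  move=> _ K; apply: (K G (@ext_refl _) [::]) => //.
  by kenter => e t [|].
case=> Lc Lcs K; apply: (IH _ _ Lcs); kenter => Cs LCs S M U.
kop 0 c c C LC HC => //; apply: (K G (@ext_refl _) (C :: Cs)) => //=.
- by rewrite S.
- split=> //; apply: (in_eq_val upair_spec HC) => /=; apply: prf_OrI1; exact: prf_EqI.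
kenter => e t [|x xs] //= [t' Ho Ht'] [Hx Mxs]; exists t'; last exact: U Ht' Mxs.
have H1 := eq_val_in upair_spec HC Hx.
by kor H1 => E; krw E.
Qed.

Lemma L_separation G p a rho r : Sigma0 p -> G ⊢ in_L a ->
  (forall n, G ⊢ in_L (rho n)) ->
  (forall G', ext G G' -> forall b, G' ⊢ in_L b ->
     G' ⊢ is_set (0 ∈ a.+1 ∧ ren (up rho) p) b -> G' ⊢ r) -> G ⊢ r.
Proof.
(* Index 0 is the tested element, so [(fv p).-1] parameters suffice. The set a serves both as range
   of that element and as terminator. *)
move=> Hp La Lrho K; pose n := (fv p).-1; pose cs := [seq rho i | i <- iota 0 n].
have Lcs : all_L G cs by rewrite /cs; elim: (iota 0 n) => //= i s IH; split.
apply: (L_singletons Lcs) => {Lrho}; kenter => Cs LCs S M U.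
have LAs : all_L G (a :: Cs) by [].
have Sp : fv p <= size (a :: Cs).
  by rewrite /= S size_map size_iota /n; case: (fv p).
apply: (Sigma0_codes Hp Sp La LAs); kenter => D HD.
(* With the parameters fixed, the required set consists of the first components of the coded
   tuples. *)
kop 7 D D b Lb Hb; [exact: codes_L HD..|]; apply: (K G (@ext_refl _) b Lb).
have E u : ren (nth a (u :: cs)) p = inst u (ren (up rho) p).
  rewrite /inst ren_comp; apply: ren_fv => -[|i] //= Hi.
  by rewrite (nth_map 0) ?nth_iota // ?size_iota /n; case: (fv p) Hi.
apply: is_setI; kenter => u Hu.
  have H1 := eq_val_in dom_spec Hb Hu; kxp H1 s u' t => Hs Ho Eu; krwin (EqS Eu) Ho.
  apply: (codesE HD Hs); kenter => -[|x xs] //= [t' Ho' Ht'] [Hx Mxs].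
  have [E1 E2] := opair_inj Ho' Ho; krwin (EqS E1) Hx.
  apply: (@prf_AndI _ _ (u ∈ a) (inst u (ren (up rho) p))) => //; rewrite -E.
  apply/(codesP HD (xs := u :: cs)); last exact: Hs; last by split.
  by exists t => //; apply: U Mxs => //; apply: Tup_eq Ht'.
have {Hu} [Hua Hu] := @AndP _ (u ∈ a) (inst u (ren (up rho) p)) Hu.
apply: (Tup_ex (xs := cs) (e := a)); kenter => t Ht; kx (opair_ex G u t) s => Hs.
apply: (in_eq_val dom_spec Hb) => /=.
suff HsD : G ⊢ s ∈ D by kep HsD Hs; apply: prf_EqI.
apply/(codesP HD (xs := u :: cs)); [by exists t|by []|by rewrite E].
Qed.

(** * Relativization to L *)

Definition inst3 (t y x : nat) (p : form) : form :=
  ren (scons t (scons y (scons x id))) p.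

(* In [p], index 2 is the argument in [a], index 1 the value in L and index 0 an
   auxiliary witness, which need not be constructible. *)
Lemma L_collection G a p r : Sigma0 p ->
  (forall G', ext G G' -> forall x, G' ⊢ x ∈ a -> forall q,
     (forall G'', ext G' G'' -> forall y t, G'' ⊢ in_L y -> G'' ⊢ inst3 t y x p ->
        G'' ⊢ q) -> G' ⊢ q) ->
  (forall G', ext G G' -> forall d v, G' ⊢ isL v d ->
     (forall G'', ext G' G'' -> forall x, G'' ⊢ x ∈ a -> forall q,
       (forall G''', ext G'' G''' -> forall y t, G''' ⊢ y ∈ v -> G''' ⊢ inst3 t y x p ->
          G''' ⊢ q) -> G'' ⊢ q) -> G' ⊢ r) ->
  G ⊢ r.
Proof.
move=> Hp H1 H2.
(* the variables are v = 0, g = 1, d = 2, t = 3, y = 4, the set of witnesses = 5 *)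
kcoll a (Ex_in 0 (Ex_in 1 (ren (up (up S)) p ∧ Ex_in 2 (Ex_in 3 (Ex_in 4
   (Ord 2 ∧ is_rec 1 2 ∧ eq_step 0 2 1 ∧ 4 ∈ 0)))))).
  move=> x Hx; apply: (H1 G (@ext_refl _) x Hx); kenter => y t Ly Hpy.
  apply: (in_L_isL Ly); kenter => d v /AndP[Hd K] Hy; kx K g => /AndP[Hg Hv].
  kx (upair_ex G y t) s1 => S1; kx (adj_ex G s1 d) s2 => S2.
  kx (adj_ex G s2 g) s3 => S3; kx (adj_ex G s3 v) s => S4; ke s.
  kei y; first by apply: (adj1 S4); apply: (adj1 S3); apply: (adj1 S2); apply: eq_upair1 S1.
  kei t; first by apply: (adj1 S4); apply: (adj1 S3); apply: (adj1 S2); apply: eq_upair2 S1.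
  kand; first by move: Hpy; rewrite /inst3 !ren_comp (@ren_ext p _
    (scons t (scons y (scons x id)))) // => -[|[|[]]].
  kei d; first by apply: (adj1 S4); apply: (adj1 S3); apply: adj2 S2.
  kei g; first by apply: (adj1 S4); apply: adj2 S3.
  kei v; first by apply: adj2 S4.
  by do 3! (kand => //).
(* The indices of the stages of all the collected values lie in e. One stage w therefore includes
   these stages, and being itself in L it can serve as the collecting set. *)
move=> c Hc; kx (union_ex G c) e => He; apply: (L_bound (c := e)); kenter => b w Hw B.
apply: (H2 G (@ext_refl _) b w Hw); kenter => x Hx q K.
kxi (AllinE Hc Hx) s => Hs L; kxi L y => Hy {}L; kxi L t => Ht /AndP[Hpy {}L].
kxi L d => Hd {}L; kxi L g => Hg {}L; kxi L v => Hv /AndP[L1 /AndP[L2 /AndP[L3 L4]]].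
apply: (K G (@ext_refl _) y t).
  apply: subE L4; apply: (B G (@ext_refl _) d); last exact: isLI L1 L2 L3.
  exact: eq_unionI He Hs Hd.
by move: Hpy; rewrite /inst3 !ren_comp (@ren_ext p _
    (scons t (scons y (scons x id)))) // => -[|[|[]]].
Qed.

Notation relL := (relativize in_L).

Lemma rel_ren p r : relL (ren r p) = ren r (relL p).
Proof. by elim: p r => //= [p IHp q IHq|p IHp q IHq|p IHp q IHq|p IHp|p IHp] r; rewrite ?IHp ?IHq. Qed.

Lemma rel_inst p x : relL (inst x p) = inst x (relL p).
Proof. exact: rel_ren. Qed.

Lemma vars_L_scons G y rho : G ⊢ in_L y -> vars_L G rho -> vars_L G (scons y rho).
Proof. by move=> Hy H [|n]; [exact: Hy|exact: (H n)]. Qed.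

Lemma inst_up y rho p : ren (scons y rho) p = inst y (ren (up rho) p).
Proof. by rewrite inst_ren. Qed.

(** Absoluteness: a quantifier bounded by an element of L ranges over elements of L anyway, by
    transitivity of L. *)
Lemma rel_Sigma0 p : Sigma0 p -> forall G rho, vars_L G rho ->
  (G ⊢ ren rho (relL p) <-> G ⊢ ren rho p).
Proof.
elim=> {p} [i j|i j||p q _ IHp _ IHq|p q _ IHp _ IHq|p q _ IHp _ IHq|y p _ IHp|y p _ IHp]
  G rho L //=.
- by split=> /AndP[/(IHp _ _ L) H1 /(IHq _ _ L) H2]; apply: prf_AndI.
- by split=> H; kor H => {}H; [apply: prf_OrI1; apply/(IHp _ _ L)|apply: prf_OrI2; apply/(IHq _ _ L)
    |apply: prf_OrI1; apply/(IHp _ _ L)|apply: prf_OrI2; apply/(IHq _ _ L)].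
- split=> H; ki => K; [apply/(IHq _ _ L)|apply/(IHq _ _ L)]; apply: (ImpE H); exact/(IHp _ _ L).
- split=> H.
    apply: AllinI; kenter => u Hu; have Lu := L_trans (L y) Hu.
    rewrite -inst_up; apply/(IHp _ _ (vars_L_scons Lu L)); rewrite inst_up.
    exact: (ImpE (ImpE (AllE u H) Lu) Hu).
  apply: AllI => u; apply: ImpI; kenter => Lu; apply: ImpI; kenter => Hu.
  change (G ⊢ inst u (ren (up rho) (relL p))).
  rewrite -inst_up; apply/(IHp _ _ (vars_L_scons Lu L)); rewrite inst_up.
  exact: (AllinE (p := ren (up rho) p) H Hu).
split=> H.
  apply: (ExE H); kenter => u /(@AndP _ (in_L u) (u ∈ rho y ∧ inst u (ren (up rho) (relL p))))[Lu].
  case/AndP=> Hu; rewrite -inst_up => /(IHp _ _ (vars_L_scons Lu L)); rewrite inst_up.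
  exact: ExinI Hu.
apply: (ExinE (p := ren (up rho) p) H); kenter => u Hu K; have Lu := L_trans (L y) Hu.
apply: (@ExI _ _ u).
apply: (@prf_AndI _ _ (in_L u) (u ∈ rho y ∧ inst u (ren (up rho) (relL p)))) => //.
apply: prf_AndI => //; rewrite -inst_up; apply/(IHp _ _ (vars_L_scons Lu L)).
by rewrite inst_up.
Qed.

Lemma rel_axiom p : IKP_minus_Inf p -> forall G rho, vars_L G rho -> G ⊢ ren rho (relL p).
Proof.
case=> {p} [||||p|p Hp|p Hp] G rho L.
- rewrite /ax_extensionality /Iff; cbn [relativize ren]; ka x; ki => Lx; ka y; ki => Ly; ki => H.
  kext u => Hu.
    have Lu := L_trans Lx Hu; have := AllE u H; ksimp => /ImpE/(_ Lu)/AndP[K _].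
    exact: ImpE K Hu.
  have Lu := L_trans Ly Hu; have := AllE u H; ksimp => /ImpE/(_ Lu)/AndP[_ K].
  exact: ImpE K Hu.
(* The empty set is x \ x for any x in L, and the assignment supplies such an x. *)
- apply: (L_op_ex (op_In (n := 3) isT) (L 0) (L 0)); kenter => w Lw Hw.
  rewrite /ax_empty /Neg; cbn [relativize ren]; ke w; kand => //; ka u; ki => Lu; ki => Hu.
  by have /AndP[K /ImpE] := eq_val_in diff_spec Hw Hu; apply.
- rewrite /ax_pairing /Iff; cbn [relativize ren]; ka x; ki => Lx; ka y; ki => Ly.
  apply: (L_op_ex (op_In (n := 0) isT) Lx Ly); kenter => w Lw Hw.
  ke w; kand => //; ka u; ki => Lu; kand; ki => Hu; first exact: (eq_val_in upair_spec Hw Hu).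
  exact: (in_eq_val upair_spec Hw).
- rewrite /ax_union /Iff /Ex_in; cbn [relativize ren]; ka x; ki => Lx.
  apply: (L_op_ex (op_In (n := 2) isT) Lx Lx); kenter => w Lw Hw.
  ke w; kand => //; ka u; ki => Lu; kand; ki => Hu.
    have K := eq_val_in bigcup_spec Hw Hu; kxi K v => Hv Huv; ke v; kand; first exact: L_trans Lx Hv.
    by kand.
  kx Hu v => /AndP[Lv /AndP[Hv Huv]]; apply: (in_eq_val bigcup_spec Hw) => /=; by kei v.
- rewrite /ax_set_induction /All_in; cbn [relativize ren]; apply: ImpI; kenter => H.
  (* Set induction in L is set induction in V for the implication from [in_L] to the relativized
     formula. *)
  apply: AllI => x; apply: set_induction; kenter => {}x IH; apply: ImpI; kenter => Lx.
  apply: (ImpE (ImpE (AllE x H) Lx)).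
  apply: AllI => y; apply: ImpI; kenter => Ly; apply: ImpI; kenter => Hy.
  have E : ren (scons y id) (ren (up (scons x id)) (ren (up (up rho)) (relL (ren (up S) p))))
      = ren (scons y id) (ren (up rho) (relL p)).
    by rewrite rel_ren !ren_comp; apply: ren_ext => -[|n].
  change (G ⊢ ren (scons y id) (ren (up (scons x id)) (ren (up (up rho)) (relL (ren (up S) p))))).
  by rewrite E; exact: (ImpE (IH G (@ext_refl _) y Hy) Ly).
- rewrite /ax_separation /Iff; cbn [relativize ren]; apply: AllI => a; apply: ImpI; kenter => La.
  have {}L := vars_L_scons La L.
  apply: (L_separation (p := p) (rho := scons a rho) Hp La L); kenter => b Lb Hb.
  apply: (@ExI _ _ b); apply: prf_AndI => //; apply: AllI => x; apply: ImpI; kenter => Lx.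
  have {}L := vars_L_scons Lx L; have R := rel_Sigma0 Hp L.
  have E : ren (scons x id) (ren (up (scons b id)) (ren (up (up (scons a id)))
      (ren (up (up (up rho))) (relL (ren (up S) p))))) = ren (scons x (scons a rho)) (relL p).
    by rewrite rel_ren !ren_comp; apply: ren_ext => -[|[|n]].
  have E' : inst x (ren (up (scons a rho)) p) = ren (scons x (scons a rho)) p.
    by rewrite inst_up.
  change (G ⊢ (x ∈ b ⇒ x ∈ a ∧ ren (scons x id) (ren (up (scons b id)) (ren (up (up (scons a id)))
      (ren (up (up (up rho))) (relL (ren (up S) p)))))) ∧
      (x ∈ a ∧ ren (scons x id) (ren (up (scons b id)) (ren (up (up (scons a id)))
      (ren (up (up (up rho))) (relL (ren (up S) p))))) ⇒ x ∈ b)).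
  rewrite E; apply: prf_AndI; apply: ImpI => G' X Hx.
    have Hb' := weaken X Hb; apply: prf_AndI; first exact: sep1 Hb' Hx.
    by apply/(rel_Sigma0 Hp (weaken_vars_L X L)); rewrite -E'; apply: sep2 Hb' Hx.
  case/AndP: Hx => Hx /(rel_Sigma0 Hp (weaken_vars_L X L)); rewrite -E'.
  exact: sepI (weaken X Hb) Hx.
rewrite /ax_collection /All_in /Ex_in; cbn [relativize ren]; apply: AllI => a.
apply: ImpI; kenter => La; apply: ImpI; kenter => H.
(* [ren S] frees index 0 for the auxiliary witness of [L_collection]; [a] will be supplied as this
   witness. *)
pose q := ren S (ren (up (up (scons a rho))) p).
have E G' x y t : G' ⊢ inst3 t y x q <-> G' ⊢ ren (scons y (scons x (scons a rho))) p.
  suff -> : inst3 t y x q = ren (scons y (scons x (scons a rho))) p by [].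
  by rewrite /inst3 /q !ren_comp; apply: ren_ext => -[|[|[|n]]].
have E2 x y : ren (scons y id) (ren (up (scons x id)) (ren (up (up (scons a id)))
     (ren (up (up (up rho))) (relL p)))) = ren (scons y (scons x (scons a rho))) (relL p).
  by rewrite !ren_comp; apply: ren_ext => -[|[|[|n]]].
have E3 b x y : ren (scons y id) (ren (up (scons x id)) (ren (up (up (scons b id)))
     (ren (up (up (up (scons a id)))) (ren (up (up (up (up rho)))) (relL (ren (up (up S)) p))))))
     = ren (scons y (scons x (scons a rho))) (relL p).
  by rewrite rel_ren !ren_comp; apply: ren_ext => -[|[|[|n]]].
apply: (@L_collection _ a q).
- by apply: Sigma0_ren; apply: Sigma0_ren.
- kenter => x Hx r K; have Lx := L_trans La Hx.
  apply: (ExE (ImpE (ImpE (AllE x H) Lx) Hx)); kenter => y Hy.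
  case: (@AndP _ (in_L y) (ren (scons y id) (ren (up (scons x id)) (ren (up (up (scons a id)))
     (ren (up (up (up rho))) (relL p))))) Hy) => Ly; rewrite E2.
  have Lxy := vars_L_scons Ly (vars_L_scons Lx (vars_L_scons La L)).
  move=> /(rel_Sigma0 Hp Lxy) K'; apply: (K G (@ext_refl _) y a) => //; exact/E.
kenter => d v Hv K; apply: (@ExI _ _ v); apply: prf_AndI; first exact: isL_L Hv.
apply: AllI => x; apply: ImpI; kenter => Lx; apply: ImpI; kenter => Hx.
apply: (K G (@ext_refl _) x Hx); kenter => y t Hy /E K'.
have Ly : G ⊢ in_L y := L_trans (isL_L Hv) Hy.
have Lxy := vars_L_scons Ly (vars_L_scons Lx (vars_L_scons La L)).
apply: (@ExI _ _ y); apply: prf_AndI => //; apply: prf_AndI => //.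
change (G ⊢ ren (scons y id) (ren (up (scons x id)) (ren (up (up (scons v id)))
     (ren (up (up (up (scons a id)))) (ren (up (up (up (up rho)))) (relL (ren (up (up S)) p))))))).
by rewrite E3; apply/(rel_Sigma0 Hp Lxy).
Qed.

(** The variables are assigned elements of L because instantiating a relativized universal, or
    giving a witness for an existential, demands membership in L. *)
Theorem relativization G p : prf IKP_minus_Inf G p -> forall G' rho, vars_L G' rho ->
  (forall h, List.In h G -> G' ⊢ ren rho (relL h)) -> G' ⊢ ren rho (relL p).
Proof.
elim=> {G p}.
- by move=> G p Hp G' rho L _; apply: rel_axiom.
- by move=> G p Hp G' rho L; apply.
- by move=> G p _ IH G' rho L H; apply: prf_BotE; apply: (IH _ _ L H).
- by move=> G p q _ IH _ IH' G' rho L H; apply: prf_AndI; [apply: IH|apply: IH'].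
- by move=> G p q _ IH G' rho L H; apply: prf_AndE1; apply: (IH _ _ L H).
- by move=> G p q _ IH G' rho L H; apply: prf_AndE2; apply: (IH _ _ L H).
- by move=> G p q _ IH G' rho L H; apply: prf_OrI1; apply: (IH _ _ L H).
- by move=> G p q _ IH G' rho L H; apply: prf_OrI2; apply: (IH _ _ L H).
- move=> G p q r _ IH1 _ IH2 _ IH3 G' rho L H; apply: (OrE (IH1 _ _ L H)) => G1 E K.
    apply: (IH2 _ _ (weaken_vars_L E L)) => h [<-|Hh] //; exact: weaken (H h Hh).
  apply: (IH3 _ _ (weaken_vars_L E L)) => h [<-|Hh] //; exact: weaken (H h Hh).
- move=> G p q _ IH G' rho L H; apply: ImpI => G1 E K.
  apply: (IH _ _ (weaken_vars_L E L)) => h [<-|Hh] //; exact: weaken (H h Hh).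
- by move=> G p q _ IH _ IH' G' rho L H; apply: ImpE (IH _ _ L H) (IH' _ _ L H).
- move=> G p _ IH G' rho L H; apply: AllI => y; apply: ImpI => G1 E Ly.
  change (G1 ⊢ inst y (ren (up rho) (relL p))); rewrite -inst_up.
  apply: (IH _ _ (vars_L_scons Ly (weaken_vars_L E L))) => h /List.in_map_iff [h' [<- Hh]].
  by rewrite /shift rel_ren ren_comp; apply: weaken (H h' Hh).
- move=> G p x _ IH G' rho L H; rewrite rel_inst ren_inst.
  exact: ImpE (AllE (rho x) (IH _ _ L H)) (L x).
- move=> G p x _ IH G' rho L H; apply: (@ExI _ _ (rho x)).
  apply: (@prf_AndI _ _ (in_L (rho x)) (inst (rho x) (ren (up rho) (relL p)))); first exact: L.
  by have := IH _ _ L H; rewrite rel_inst ren_inst.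
- move=> G p q _ IH _ IH' G' rho L H; apply: (ExE (IH _ _ L H)) => G1 E y.
  move=> /(@AndP _ (in_L y) (inst y (ren (up rho) (relL p))))[Ly]; rewrite -inst_up => K.
  have := IH' _ _ (vars_L_scons Ly (weaken_vars_L E L)).
  rewrite /shift rel_ren ren_comp; apply => h [<-|/List.in_map_iff [h' [<- Hh]]] //.
  by rewrite rel_ren ren_comp; apply: weaken (H h' Hh).
- by move=> G x G' rho L H; apply: prf_EqI.
- move=> G p x y _ IH _ IH' G' rho L H.
  have E z : ren rho (relL (inst z p)) = inst (rho z) (ren (up rho) (relL p)).
    by rewrite rel_inst ren_inst.
  by rewrite E; apply: (EqR (IH _ _ L H)); rewrite -E; apply: IH'.
Qed.

(** * Constructible ordinals *)

(** The theorem [rec_ex] is relativized, and since [is_rec] is Sigma0, the f that it yields inside L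
    is a recursion in V too. *)
Lemma L_rec_ex G a r : G ⊢ in_L a -> G ⊢ Ord a ->
  (forall G', ext G G' -> forall f, G' ⊢ in_L f -> G' ⊢ is_rec f a -> G' ⊢ r) -> G ⊢ r.
Proof.
move=> La Ha K; pose rho (n : nat) := a.
have L : vars_L G rho by [].
have P : prf IKP_minus_Inf [::] (Ord 0 ⇒ Ex (is_rec 0 1)) by apply: ImpI => G' _; apply: rec_ex.
have {P} P := relativization P L (fun h (Hh : List.In h [::]) => match Hh with end).
have Ha' : G ⊢ ren rho (relL (Ord 0)) by apply/(rel_Sigma0 (Sigma0_Ord 0) L).
apply: (ExE (ImpE P Ha')); kenter => f.
move=> /(@AndP _ (in_L f) (inst f (ren (up rho) (relL (is_rec 0 1)))))[Lf]; rewrite -inst_up.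
move=> /(rel_Sigma0 (Sigma0_is_rec 0 1) (vars_L_scons Lf L)); rewrite ren_is_rec.
exact: (K G (@ext_refl _) f).
Qed.

(** Absoluteness does not apply to [in_L_at] directly, because of its unbounded quantifiers. Its
    derivation from the bounded form is relativized instead, and absoluteness is used for that form
    only. *)
Lemma L_at_rel G x a f : G ⊢ in_L x -> G ⊢ in_L a -> G ⊢ in_L f ->
  G ⊢ is_rec f a -> G ⊢ mem_step x a f ->
  G ⊢ ren (scons x (fun=> a)) (relL (in_L_at 0 1)).
Proof.
move=> Lx La Lf Hf Hx; set rho := scons x _.
have L : vars_L G rho by case.
have P : prf IKP_minus_Inf [::] (Ex (is_rec 0 2 ∧ mem_step 1 2 0) ⇒ in_L_at 0 1).
  apply: ImpI => G' _ H; kx H g => /AndP[/L_recursionP Hg /mem_stepP Hgx].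
  apply: (@ExI _ _ g); exact: (@prf_AndI _ _ (L_recursion g 1) (in_cl_step 0 1 g)).
apply: (ImpE (relativization P L (fun h (Hh : List.In h [::]) => match Hh with end))).
apply: (@ExI _ _ f); apply: (@prf_AndI _ _ (in_L f)
  (inst f (ren (up rho) (relL (is_rec 0 2 ∧ mem_step 1 2 0))))) => //.
rewrite -inst_up; apply/(rel_Sigma0 _ (vars_L_scons Lf L)); first by s0.
by ksimp; kand.
Qed.

Lemma L_union G z x : G ⊢ in_L x -> G ⊢ eq_union z x -> G ⊢ in_L z.
Proof.
move=> Lx Hz; apply: (L_op (op_In (n := 2) isT) Lx Lx); apply: (eq_valI bigcup_spec).
  by kenter => u Hu; exact: eq_unionE Hz Hu.
by kenter => u Hu; kxi Hu v => Hv Huv; exact: eq_unionI Hz Hv Huv.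
Qed.

Lemma L_upair G z x y : G ⊢ in_L x -> G ⊢ in_L y -> G ⊢ eq_upair z x y -> G ⊢ in_L z.
Proof.
move=> Lx Ly Hz; apply: (L_op (op_In (n := 0) isT) Lx Ly).
by apply/(eq_valP _ _ _ _ upair_spec); apply/eq_upairP.
Qed.

Lemma L_cup G z x y : G ⊢ in_L x -> G ⊢ in_L y -> G ⊢ eq_cup z x y -> G ⊢ in_L z.
Proof.
move=> Lx Ly Hz; kx (upair_ex G x y) p => Hp; apply: (L_union (L_upair Lx Ly Hp)).
kand; first kai u => Hu.
  by kai v => Hv; kor (eq_upairE Hp Hu) => E; krwin (EqS E) Hv; [apply: cup1 Hz Hv|apply: cup2 Hz Hv].
kai v => Hv; kor (cupE Hz Hv) => {}Hv; [kei x => //|kei y => //].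
  exact: eq_upair1 Hp.
exact: eq_upair2 Hp.
Qed.

(* An ordinal need not be constructible, but its level of the hierarchy is also
   the level of a constructible ordinal a*: take those ordinals c of a large
   enough L_d with cl(L_c) ⊆ L_a, and close them downwards.  By induction every
   b ∈ a has such a counterpart b*, and d is chosen by collection so that these
   b* are in L_d. *)
Lemma L_ordinal G a : G ⊢ Ord a -> G ⊢ Ex (Ex (in_L 1 ∧ isL 0 1 ∧ isL 0 a.+2)).
Proof.
suff H : G ⊢ inst a (Ord 0 ⇒ Ex (Ex (in_L 1 ∧ isL 0 1 ∧ isL 0 2))).
  by apply: ImpE; move: H; ksimp.
apply: set_induction; kenter => {}a IH; ksimp; ki => Ha.
kx (isL_ex Ha) va => Hva; have Lva := isL_L Hva.
(* The variables are h' = 0, h = 1, w = 2, t = 3, b' = 4, b = 5: the ordinals b' and b share the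
   stage w, as witnessed by h and h'. Only b' has to be constructible. *)
apply: (@L_collection _ a (Ex_in 0 (Ex_in 1 (Ex_in 2
  (Ord 4 ∧ is_rec 1 4 ∧ eq_step 2 4 1 ∧ is_rec 0 5 ∧ eq_step 2 5 0))))); first by s0.
  kenter => b Hb q K; have := IH G (@ext_refl _) b Hb; ksimp => I.
  kx (ImpE I (Ord_mem Ha Hb)) b' => {}I; kx I w => /AndP[Lb' /AndP[/AndP[Ob' H'] /AndP[Ob H]]].
  kx H h' => /AndP[Rh' Sh']; kx H' h => /AndP[Rh Sh].
  kx (upair_ex G w h) s => Hs; kx (adj_ex G s h') t => Ht.
  apply: (K G (@ext_refl _) b' t Lb'); rewrite /inst3; ksimp.
  kei w; first by apply: (adj1 Ht); apply: eq_upair1 Hs.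
  kei h; first by apply: (adj1 Ht); apply: eq_upair2 Hs.
  kei h'; first exact: adj2 Ht.
  by do 4! (kand => //).
kenter => d X HX HX'; have LX := isL_L HX.
apply: (L_separation (p := Ord 0) (rho := fun=> X) (Sigma0_Ord 0) LX (fun=> LX)).
kenter => X1 LX1; ksimp => HX1.
have O1 : forall G', ext G G' -> forall c, G' ⊢ c ∈ X1 -> G' ⊢ Ord c.
  by kenter => c Hc; have := sep2 HX1 Hc; ksimp.
(* Separation in L needs a Sigma0 condition with constructible parameters. The pairs of a recursion
   on c and the stage L_c, for c in X1, are therefore gathered in one stage W. *)
apply: (@L_collection _ X1 (Ex_in 1 (Ex_in 2 (is_rec 1 4 ∧ eq_step 0 4 1)))); first by s0.
  kenter => c Hc q K; have Oc := O1 G (@ext_refl _) c Hc.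
  apply: (L_rec_ex (L_trans LX1 Hc) Oc); kenter => g Lg Hg.
  kx (eq_step_ex G c g) v => Hv; have Lv := isL_L (isLI Oc Hg Hv).
  kx (upair_ex G g v) t => Ht; apply: (K G (@ext_refl _) t t); first exact: L_upair Lg Lv Ht.
  rewrite /inst3; ksimp; kei g; first exact: eq_upair1 Ht.
  by kei v; [exact: eq_upair2 Ht|kand].
kenter => d' W HW HW'; have LW := isL_L HW.
pose rho := scons W (fun=> va).
have Lrho n : G ⊢ in_L (rho n) by case: n.
(* The variables are v = 0, g = 1, t = 2, c = 3, W = 4, va = 5, and the condition says cl(L_c) ⊆
   L_a. *)
apply: (L_separation (p := Ex_in 1 (Ex_in 0 (Ex_in 1
  (is_rec 1 3 ∧ eq_step 0 3 1 ∧ cl_sub 0 5)))) (rho := rho) _ LX1 Lrho); first by s0.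
rewrite {Lrho}/rho {rho}; kenter => Y LY; ksimp => HY.
have Y1 : forall G', ext G G' -> forall c, G' ⊢ c ∈ Y -> G' ⊢ Ord c.
  by kenter => c Hc; apply: (O1 G (@ext_refl _)); apply: sep1 HY Hc.
have Y2 : forall G', ext G G' -> forall c v, G' ⊢ c ∈ Y -> G' ⊢ isL v c -> G' ⊢ cl_sub v va.
  kenter => c v Hc Hv; have := sep2 HY Hc; ksimp => K; kxi K t => Ht {}K.
  kxi K g => Hg {}K; kxi K v' => Hv' /AndP[Rg /AndP[Sg C]].
  by krw (isL_fun (isLI (Y1 G (@ext_refl _) c Hc) Rg Sg) Hv).
have Y3 : forall G', ext G G' -> forall c v, G' ⊢ c ∈ X -> G' ⊢ isL v c -> G' ⊢ cl_sub v va ->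
    G' ⊢ c ∈ Y.
  kenter => c v Hc Hv C; have Oc := isL_Ord Hv.
  have Hc1 : G ⊢ c ∈ X1 by apply: (sepI HX1 Hc); ksimp.
  apply: (sepI HY Hc1); ksimp; apply: (HW' G (@ext_refl _) c Hc1); kenter => t t' Ht.
  rewrite /inst3; ksimp => K; kxi K g => Hg {}K; kxi K v' => Hv' /AndP[Rg Sg].
  kei t => //; kei g => //; kei v' => //; kand => //; kand => //.
  by krw (isL_fun Hv (isLI Oc Rg Sg)).
(* Y need not be transitive. A single union closes it downwards, since its elements are ordinals and
   hence transitive. *)
kx (union_ex G Y) Z => HZ; kx (cup_ex G Y Z) a' => Ha'.
have La' := L_cup LY (L_union LY HZ) Ha'.
have Oa' : G ⊢ Ord a'.
  apply: OrdI.
    apply: transI; kenter => y z Hy Hz; apply: (cup2 Ha'); kor (cupE Ha' Hy) => {}Hy.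
      exact: eq_unionI HZ Hy Hz.
    kxi (eq_unionE HZ Hy) c => Hc Hyc; apply: (eq_unionI HZ Hc).
    exact: transE (Ord_trans (Y1 G (@ext_refl _) c Hc)) Hyc Hz.
  kenter => y Hy; kor (cupE Ha' Hy) => {}Hy; first exact: Ord_trans (Y1 G (@ext_refl _) y Hy).
  kxi (eq_unionE HZ Hy) c => Hc; exact: Ord_mem_trans (Y1 G (@ext_refl _) c Hc).
ke a'; ke va; kand => //; kand => //.
kx (isL_ex Oa') v => Hv; suff E : G ⊢ v ≡ va by krwin (EqS E) Hv.
kext u => Hu.
  (* Every c in Y has cl(L_c) ⊆ L_a. For c below some c' in Y, cl(L_c) ⊆ L_c', which is included in
     cl(L_c') and so in L_a. *)
  apply: (isL_memE Hv Hu); kenter => c w Hc Hw {}Hu; kor (cupE Ha' Hc) => {}Hc.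
    exact: cl_subE (Y2 G (@ext_refl _) c w Hc Hw) Hu.
  kxi (eq_unionE HZ Hc) c' => Hc' Hcc'; kx (isL_ex (Y1 G (@ext_refl _) c' Hc')) w' => Hw'.
  apply: (cl_subE (Y2 G (@ext_refl _) c' w' Hc' Hw')); apply: mem_cl_succ; apply: prf_OrI1.
  exact: isL_memI Hw' Hcc' Hw Hu.
(* Conversely, b in a has a counterpart b' in X with L_b' = L_b. Then cl(L_b') = cl(L_b) ⊆ L_a,
   which puts b' in Y. *)
apply: (isL_memE Hva Hu); kenter => b w Hb Hw {}Hu.
apply: (HX' G (@ext_refl _) b Hb); kenter => b' t Hb'; rewrite /inst3; ksimp => K.
kxi K w' => Hw' {}K; kxi K h => Hh {}K; kxi K h' => Hh'.
move=> /AndP[K1 /AndP[K2 /AndP[K3 /AndP[K4 K5]]]].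
have Hw1 := isLI K1 K2 K3; have Hw2 := isLI (isL_Ord Hw) K4 K5.
krwin (isL_fun Hw Hw2) Hw1; apply: (isL_memI Hv (b := b') _ Hw1 Hu).
apply: (cup1 Ha'); apply: (Y3 G (@ext_refl _) b' w Hb' Hw1); apply: cl_subI; kenter => z Hz.
exact: isL_memI Hva Hb Hw Hz.
Qed.

Theorem mainTheorem10 : provable IKP_minus_Inf (relativize in_L V_eq_L).
Proof.
apply: AllI => x; apply: ImpI => G _ Hx; have {Hx} Lx : G ⊢ in_L x := Hx.
apply: (in_L_isL Lx); kenter => a v Hv Hxv.
kx (L_ordinal (isL_Ord Hv)) a' => K; kx K w => /AndP[La /AndP[Hw Hwv]].
krwin (isL_fun Hv Hwv) Hw; have Oa := isL_Ord Hw.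
(* Not only the ordinal but also the recursion witnessing x ∈ L_a' has to be constructible for the
   relativized formula. *)
apply: (L_rec_ex La Oa); kenter => f Lf Hf; have Hxf := eq_step1 (isL_step Hw Hf) Hxv.
have L : vars_L G (scons a' (scons x (fun=> a'))) by case=> [|[|n]].
apply: (@ExI _ _ a'); apply: (@prf_AndI _ _ (in_L a')
  (inst a' (ren (up (scons x id)) (relL (Ord 0) ∧ relL (in_L_at 1 0))))) => //.
apply: prf_AndI; first by apply/(rel_Sigma0 (Sigma0_Ord 0) L).
have := L_at_rel Lx La Lf Hf Hxf; rewrite -rel_ren ren_in_L_at => {}K.
change (G ⊢ ren (scons a' id) (ren (up (scons x id)) (relL (in_L_at 1 0)))).
by rewrite -!rel_ren.
Qed.
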